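(* Let $d\in(0,1/2)$ and let $\{X_k\}_{k\in\mathbb{Z}}$ be a $q$-variate FARIMA process with spectral density $w(e^{i\theta})=|1-e^{i\theta}|^{-2d}g(e^{i\theta})g(e^{i\theta})^*$, where the entries of $g(z)$ are rational functions of $z$ with no poles on $\overline{\mathbb{D}}$ and $\det g$ has no zeros on $\overline{\mathbb{D}}$. Let $\phi_{n,j}$ and $\phi_j$ be the forward finite and infinite predictor coefficients of $\{X_k\}$. Then there exists a positive constant $K$ such that $$\sum_{j=1}^n\|\phi_{n,j}-\phi_j\|\le K\sum_{j=n+1}^\infty\|\phi_j\|,\qquad n\in\mathbb{N}.$$
   Context: $\overline{\mathbb{D}}$ is the closed unit disk, $\mathbb{D}$ the open one, $\mathbb{T}$ the unit circle; $\|a\|$ is the spectral (operator) norm of $a\in\mathbb{C}^{q\times q}$. A $q$-variate stationary process $\{X_k\}_{k\in\mathbb{Z}}$ ($q\in\mathbb{N}$) is a $\mathbb{C}^q$-valued, centered, weakly stationary process on a probability space; it has spectral density $w$ if $w\in L_1^{q\times q}(\mathbb{T})$ is positive-semidefinite-Hermitian-valued and $E[X_mX_n^*]=\int_{-\pi}^{\pi}e^{-i(m-n)\theta}w(e^{i\theta})\frac{d\theta}{2\pi}$. A $q$-variate FARIMA process is a $q$-variate stationary process with spectral density of the form in the claim. $P_{[-n,-1]}$ denotes the orthogonal projection, applied entrywise, in the Hilbert space spanned in $L^2(\Omega,\mathcal F,P)$ by all entries of all $X_k$ (inner product $E[x\overline y]$) onto the linear span of the entries of $X_{-1},\dots,X_{-n}$.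 The forward finite predictor coefficients $\phi_{n,j}\in\mathbb{C}^{q\times q}$ ($1\le j\le n$) are the unique matrices with $P_{[-n,-1]}X_0=\phi_{n,1}X_{-1}+\cdots+\phi_{n,n}X_{-n}$. Let $h(z)=(1-z)^{-d}g(z)$, $c_0=h(0)=g(0)$, and define $a_k\in\mathbb{C}^{q\times q}$ by $-h(z)^{-1}=\sum_{k=0}^\infty z^ka_k$, $z\in\mathbb{D}$. The forward infinite predictor coefficients are $\phi_k:=c_0a_k$, $k\in\mathbb{N}$. *)

(* Defs.v *)
From HB Require Import structures.
From mathcomp Require Export all_boot all_order all_algebra.
From mathcomp Require Export complex.
From mathcomp Require Export all_classical all_reals all_analysis.
Export Order.TTheory GRing.Theory Num.Theory.
Export numFieldNormedType.Exports.
Export Normc.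

Set Implicit Arguments.
Unset Strict Implicit.
Unset Printing Implicit Defensive.

Local Open Scope classical_set_scope.
Local Open Scope ring_scope.
Local Open Scope complex_scope.

Section complex_numbers.
Context {R : realType}.

(* The absolute value [normc z : R] is used rather than [`|z| : R[i]], so that
   sizes are real numbers. *)
Definition open_disk : set R[i] := [set z | normc z < 1].
Definition closed_disk : set R[i] := [set z | normc z <= 1].

Definition cis (t : R) : R[i] := cos t +i* sin t.

(* Principal argument, with values in ]-pi, pi] for z != 0. *)
Definition carg (z : R[i]) : R :=
  if 0 <= complex.Im z then acos (complex.Re z / normc z)
  else - acos (complex.Re z / normc z).

(* Principal branch of z^s for real s and z != 0. *)
Definition cpow (z : R[i]) (s : R) : R[i] :=
  (normc z `^ s)%:C * cis (s * carg z).

End complex_numbers.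

Section complex_matrices.
Context {R : realType} {q : nat}.

Definition adjmx m n (A : 'M[R[i]]_(m, n)) : 'M[R[i]]_(n, m) :=
  map_mx (@conjc R) A^T.

(* In the order of [R[i]], [0 <= z] means that z is real and nonnegative. *)
Definition psd_hermitian (A : 'M[R[i]]_q) : Prop :=
  A = adjmx A /\ forall x : 'cV[R[i]]_q, 0 <= (adjmx x *m A *m x) 0 0.

Definition l2norm (x : 'cV[R[i]]_q) : R :=
  Num.sqrt (\sum_(i < q) normc (x i 0) ^+ 2).

Definition spectral_norm (A : 'M[R[i]]_q) : R :=
  sup [set l2norm (A *m x) | x in [set x | l2norm x <= 1]].

End complex_matrices.

Section complex_integral.
Context {R : realType} {disp : measure_display} {T : measurableType disp}.
Variable mu : {measure set T -> \bar R}.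

Definition cintegrable (D : set T) (f : T -> R[i]) : Prop :=
  mu.-integrable D (EFin \o (fun x => complex.Re (f x))) /\
  mu.-integrable D (EFin \o (fun x => complex.Im (f x))).

Definition cintegral (D : set T) (f : T -> R[i]) : R[i] :=
  Rintegral mu D (fun x => complex.Re (f x)) +i*
  Rintegral mu D (fun x => complex.Im (f x)).

Definition cmeasurable (f : T -> R[i]) : Prop :=
  measurable_fun setT (fun x => complex.Re (f x)) /\
  measurable_fun setT (fun x => complex.Im (f x)).

Definition square_integrable (f : T -> R[i]) : Prop :=
  cmeasurable f /\ mu.-integrable setT (EFin \o (fun x => normc (f x) ^+ 2)).

End complex_integral.

Section processes.
Context {R : realType} {disp : measure_display} {T : measurableType disp}.
Variables (P : probability T R) (q : nat).
Implicit Types X : int -> T -> 'cV[R[i]]_q.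

Definition entry X (k : int) (i : 'I_q) : T -> R[i] := fun t => X k t i 0.

Definition inner (x y : T -> R[i]) : R[i] :=
  cintegral P setT (fun t => x t * conjc (y t)).

(* E[X_m X_n^*] *)
Definition covariance_mx X (m n : int) : 'M[R[i]]_q :=
  \matrix_(i, j) inner (entry X m i) (entry X n j).

Definition stationary_process X : Prop :=
  [/\ forall k i, square_integrable P (entry X k i),
      forall k i, cintegral P setT (entry X k i) = 0
    & forall m n k, covariance_mx X (m + k) (n + k) = covariance_mx X m n].

(* The circle is parametrized by t |-> cis t on [-pi, pi]; elements of L_1
   being classes modulo null sets, the values of w matter only a.e. *)
Definition has_spectral_density X (w : R[i] -> 'M[R[i]]_q) : Prop :=
  [/\ forall i j, cintegrable (@lebesgue_measure R) `[- pi, pi]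
        (fun t => w (cis t) i j),
      {ae @lebesgue_measure R, forall t, t \in `[- pi, pi] ->
        psd_hermitian (w (cis t))}
    & forall (m n : int) i j, covariance_mx X m n i j =
        ((2 * pi)^-1)%:C * cintegral (@lebesgue_measure R) `[- pi, pi]
          (fun t => cis (- ((m - n)%:~R * t)) * w (cis t) i j)].

(* y represents the orthogonal projection of x onto the subspace M of
   L^2(P), whose elements are classes modulo P-a.e. equality. *)
Definition orthogonal_projection (M : set (T -> R[i])) (x y : T -> R[i]) :
    Prop :=
  (exists2 y', M y' & {ae P, forall t, y t = y' t}) /\
  forall v, M v -> inner (x \- y) v = 0.

(* Linear span of the entries of X_{-1}, ..., X_{-n} *)
Definition past_span X (n : nat) : set (T -> R[i]) :=
  [set y | exists c : 'I_n -> 'I_q -> R[i],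
    y = fun t => \sum_(j < n) \sum_(i < q)
          c j i * entry X (- (j.+1)%:Z) i t].

Definition forward_finite_predictor X (n : nat) (phi : nat -> 'M[R[i]]_q) :
    Prop :=
  forall i : 'I_q, orthogonal_projection (past_span X n) (entry X 0 i)
    (fun t => (\sum_(1 <= j < n.+1) phi j *m X (- j%:Z) t) i 0).

End processes.

Section farima.
Context {R : realType} {q : nat}.
Implicit Types (d : R) (g : R[i] -> 'M[R[i]]_q) (a : nat -> 'M[R[i]]_q).

(* The restriction to the closed disk of a rational function without poles
   there *)
Definition rational_on_closed_disk (f : R[i] -> R[i]) : Prop :=
  exists num den : {poly R[i]},
    (forall z, closed_disk z -> den.[z] != 0) /\
    (forall z, closed_disk z -> f z = num.[z] / den.[z]).

Definition farima_density d g (z : R[i]) : 'M[R[i]]_q :=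
  (normc (1 - z) `^ (- (2 * d)))%:C *: (g z *m adjmx (g z)).

Definition farima_h d g (z : R[i]) : 'M[R[i]]_q :=
  cpow (1 - z) (- d) *: g z.

(* - h(z)^{-1} = \sum_k z^k a_k on the open disk, entrywise *)
Definition neg_inverse_coefficients (h : R[i] -> 'M[R[i]]_q) a : Prop :=
  forall z, open_disk z -> forall i j : 'I_q,
    (fun N : nat => \sum_(0 <= k < N) z ^+ k * a k i j : R[i]^o) @ \oo -->
      ((- invmx (h z)) i j : R[i]^o).

Definition forward_infinite_predictor (h : R[i] -> 'M[R[i]]_q) a (k : nat) :
    'M[R[i]]_q :=
  h 0 *m a k.

End farima.

(* Main.v *)
(* Write z = e^{it}, U(z) = (1 - z)^d g(z)^{-1}, c_0 = g(0), and let b(z) be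
   1 - \sum_{1 <= j <= n} phi_{n,j} z^j, so that f = b - c_0 U has the Fourier
   coefficients phi_j - phi_{n,j} for 1 <= j <= n.  The normal equations, and
   the same equations for the infinite predictor, say that f w has no Fourier
   coefficient of index in [1, n].  Let Q be the product of the truncations at
   order N of the power series of (1 - z)^d and of g^{-1}, of degree <= 2N;
   then |U - Q| = O(N^{-d} / max(1, N |1 - z|)).  Comparing b with c_0 Q for
   N = n/2, the extremality of b gives the energy bound
   \int f w f^* = O(1/n).  As w^{-1} = U^* U, the j-th coefficient of f is that
   of f w (U^* U - Q^* Q) as long as 2N < j <= n - 2N, and Cauchy-Schwarz
   bounds it by O(n^{-1/2} N^{-1/2-d}) with N about min(j, n - j) / 2.  Summing
   over j, the left-hand side is O(n^{-d}).  Conversely the partial sums of the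
   coefficients of U up to n are g(1)^{-1} times those of (1 - z)^d, up to
   O(n^{-1-d}), hence of exact order n^{-d}, and tend to 0: the tail on the
   right-hand side is at least a constant times n^{-d}. *)

Require Import Defs.
From mathcomp Require Import ring lra zify measurable_realfun.

Set Implicit Arguments.
Unset Strict Implicit.
Unset Printing Implicit Defensive.

Local Open Scope classical_set_scope.
Local Open Scope ring_scope.
Local Open Scope complex_scope.

(** The weight is singular at z = 1, exactly where U vanishes, and a uniform estimate of U - Q loses
    too much: O(N^{-d}) alone would give an energy O(n^{-2d}) instead of O(1/n). Hence the second
    factor in the bound of the overview, a gain of N |1 - z| away from z = 1. It comes from
    summation by parts, and makes the integral of |U - Q|^2 |1 - z|^{-2d} of order N^{-2d} N^{2d-1}
    = 1/N. Replacing U^* U by the trigonometric polynomial Q^* Q is what exploits the normal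
    equations: frequencies in [-2N, 2N] only shrink the window [1, n] of vanishing coefficients by
    2N at each end. N must then be small for j near 1 or n, and the bounds N^{-1/2-d} still sum to
    O(n^{1/2-d}) because 1/2 + d < 1. Series are handled by real means: the binomial series through
    a differential equation along rays, rational functions by dividing by one linear factor at a
    time, identification of coefficients by Fourier integrals on |z| = 1/2. *)

Local Notation "z ^J" := (conjc z) (at level 1, left associativity, format "z ^J").

(** * Complex numbers *)

Section complex_basics.
Context {R : realType}.
Implicit Types (x y z l : R[i]) (r : R).

Lemma normcR r : normc r%:C = `|r|.
Proof. by rewrite /= expr0n /= addr0 sqrtr_sqr. Qed.

Lemma normc_ge0 z : 0 <= normc z.
Proof. by case: z => a b /=; exact: sqrtr_ge0. Qed.

Lemma normcJ z : normc z^J = normc z.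
Proof. by case: z => a b /=; rewrite sqrrN. Qed.

Lemma normcBC x y : normc (x - y) = normc (y - x).
Proof. by rewrite -normcN opprB. Qed.

Lemma le_normcB x y : normc (x - y) <= normc x + normc y.
Proof. by rewrite (le_trans (le_normcD _ _))// normcN. Qed.

Lemma ler_normc_distD y x z : normc (x - z) <= normc (x - y) + normc (y - z).
Proof. by rewrite (le_trans _ (le_normcD _ _))// addrA subrK. Qed.

Lemma normcX z n : normc (z ^+ n) = normc z ^+ n.
Proof. by elim: n => [|n IH]; [exact: normc1|rewrite !exprS normcM IH]. Qed.

Lemma normc_sum (I : Type) (s : seq I) (P : pred I) (F : I -> R[i]) :
  normc (\sum_(i <- s | P i) F i) <= \sum_(i <- s | P i) normc (F i).
Proof.
elim/big_ind2: _ => [|a b c d ab cd|i _]; rewrite ?normc0//.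
by rewrite (le_trans (le_normcD _ _))// lerD.
Qed.

Lemma ler_abs_Re z : `|complex.Re z| <= normc z.
Proof.
by case: z => a b /=; rewrite -sqrtr_sqr ler_sqrt ?addr_ge0 ?sqr_ge0// lerDl sqr_ge0.
Qed.

Lemma ler_abs_Im z : `|complex.Im z| <= normc z.
Proof.
by case: z => a b /=; rewrite -sqrtr_sqr ler_sqrt ?addr_ge0 ?sqr_ge0// lerDr sqr_ge0.
Qed.

Lemma normc_le_ReIm z : normc z <= `|complex.Re z| + `|complex.Im z|.
Proof.
case: z => a b /=.
rewrite -(@ler_pXn2r _ 2) ?nnegrE ?sqrtr_ge0 ?addr_ge0//.
rewrite sqr_sqrtr ?addr_ge0 ?sqr_ge0// sqrrD !real_normK ?num_real// addrAC lerDl.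
by rewrite mulrn_wge0// mulr_ge0.
Qed.

Lemma normc_sqrE z : normc z ^+ 2 = complex.Re z ^+ 2 + complex.Im z ^+ 2.
Proof. by case: z => a b /=; rewrite sqr_sqrtr// addr_ge0// sqr_ge0. Qed.

Lemma mulc_conj z : z * z^J = (normc z ^+ 2)%:C.
Proof.
rewrite normc_sqrE; case: z => a b; apply/eqP; rewrite eq_complex /=.
by apply/andP; split; apply/eqP; ring.
Qed.

Lemma normc_eq0 z : (normc z == 0) = (z == 0).
Proof. by apply/eqP/eqP => [/eq0_normc//|->]; exact: normc0. Qed.

Lemma normc_gt0 z : (0 < normc z) = (z != 0).
Proof. by rewrite lt_def normc_ge0 andbT normc_eq0. Qed.

Lemma complex_eqP x y : complex.Re x = complex.Re y -> complex.Im x = complex.Im y -> x = y.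
Proof. by case: x y => a b [c d] /= -> ->. Qed.

Lemma Rec_mul x y : complex.Re (x * y) =
  complex.Re x * complex.Re y - complex.Im x * complex.Im y.
Proof. by case: x y => ? ? []. Qed.

Lemma Imc_mul x y : complex.Im (x * y) =
  complex.Re x * complex.Im y + complex.Im x * complex.Re y.
Proof. by case: x y => ? ? []. Qed.

End complex_basics.

Section complex_limits.
Context {R : realType}.
Implicit Types (s : nat -> R[i]) (l : R[i]).

Definition ccvg s l := forall e : R, 0 < e ->
  exists N, forall n, (N <= n)%N -> normc (s n - l) < e.

Lemma ccvgP s l : ((s : nat -> R[i]^o) @ \oo --> (l : R[i]^o)) -> ccvg s l.
Proof.
move=> /cvgrPdist_lt cv e e0.
have e0' : 0 < e%:C :> R[i] by rewrite ltcR.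
have [N _ HN] := cv _ e0'; exists N => n Nn.
by have := HN n Nn; rewrite distrC -ltcR.
Qed.

Lemma ccvg_le s l x (b : R) N : ccvg s l ->
  (forall n, (N <= n)%N -> normc (s n - x) <= b) -> normc (l - x) <= b.
Proof.
move=> cv sb; apply/ler_addgt0Pr => e /cv[M HM].
rewrite (le_trans (ler_normc_distD (s (maxn N M)) _ _))// addrC lerD//.
  by rewrite sb// leq_maxl.
by rewrite normcBC ltW// HM// leq_maxr.
Qed.

Lemma ccvg_unique s l l' : ccvg s l -> ccvg s l' -> l = l'.
Proof.
move=> cl cl'; apply/eqP; rewrite -subr_eq0 -normc_eq0 eq_le normc_ge0 andbT.
apply/ler_addgt0Pr => e /cl'[M HM]; rewrite add0r.
by apply: (ccvg_le cl) => n /HM /ltW.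
Qed.

Lemma ccvg_bounded s l : ccvg s l -> exists M : R, forall n, normc (s n) <= M.
Proof.
move=> /(_ 1 ltr01)[N HN].
exists (\sum_(k < N) normc (s k) + (1 + normc l)) => n.
have S0 : 0 <= \sum_(k < N) normc (s k) by apply: sumr_ge0 => *; exact: normc_ge0.
have [Nn|nN] := leqP N n.
  rewrite -[s n](subrK l) (le_trans (le_normcD _ _))//.
  by rewrite -[leLHS]add0r !lerD// ltW// HN.
rewrite (bigD1 (Ordinal nN))//= -addrA lerDl addr_ge0 ?addr_ge0 ?normc_ge0//.
by apply: sumr_ge0 => *; exact: normc_ge0.
Qed.

End complex_limits.

(** * Binomial coefficients *)

Section binomial.
Context {R : realType}.
Implicit Types (s d : R).

(* The coefficient of z^k in (1 - z)^s *)
Definition bin s (k : nat) : R := \prod_(i < k) ((i%:R - s) / i.+1%:R).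

Lemma bin0 s : bin s 0 = 1. Proof. by rewrite /bin big_ord0. Qed.

Lemma binS s k : k.+1%:R * bin s k.+1 = (k%:R - s) * bin s k.
Proof.
rewrite /bin big_ord_recr/= mulrCA mulrC; congr (_ * _).
by rewrite mulrCA mulfV ?mulr1// pnatr_eq0.
Qed.

Lemma norm_bin_le1 s k : `|s| <= 1 -> `|bin s k| <= 1.
Proof.
move=> s1; rewrite /bin normr_prod prodr_ile1// => i _; rewrite normr_ge0/=.
rewrite normrM normfV normr_nat ler_pdivrMr ?ltr0n// mul1r.
by rewrite (le_trans (ler_normB _ _))// normr_nat -[leRHS]natr1 lerD2l.
Qed.

(** The coefficient of z^n in (1 - z)^(d-1), that is, the n-th partial sum of the coefficients of (1
    - z)^d ([sum_bin]). The product form gives access to its sign and to its order n^{-d}. *)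
Definition binsum d n : R := \prod_(i < n) (1 - d / i.+1%:R).

Lemma binsumS d n : binsum d n.+1 = binsum d n * (1 - d / n.+1%:R).
Proof. by rewrite /binsum big_ord_recr. Qed.

Lemma bin_binsum d k : bin d k.+1 = - (d / k.+1%:R * binsum d k).
Proof.
elim: k => [|k IH].
  rewrite /bin /binsum big_ord_recr !big_ord0/= mul1r mulr1 divr1 sub0r.
  by rewrite divr1.
rewrite /bin big_ord_recr/= -/(bin d k.+1) IH binsumS.
have h1 : (k.+1%:R : R) != 0 by rewrite pnatr_eq0.
have h2 : (k.+2%:R : R) != 0 by rewrite pnatr_eq0.
move: (k.+1%:R : R) (k.+2%:R : R) h1 h2 => x y h1 h2.
by field; rewrite h1 h2.
Qed.

Lemma sum_bin d n : \sum_(k < n.+1) bin d k = binsum d n.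
Proof.
elim: n => [|n IH]; first by rewrite big_ord_recr big_ord0/= add0r bin0 /binsum big_ord0.
by rewrite big_ord_recr/= IH bin_binsum binsumS; ring.
Qed.

(** Young's inequality for the product of t^d and 1, with exponents 1/d and 1/(1-d). *)
Lemma powR_bernoulli d (t : R) : 0 < d < 1 -> 0 <= t -> t `^ d <= 1 + d * (t - 1).
Proof.
move=> /andP[d0 d1] t0.
have := @conjugate_powR R (t `^ d) 1 d^-1 (1 - d)^-1 (powR_ge0 _ _) ler01.
rewrite !invrK -powRrM mulfV ?gt_eqF// powRr1// powR1 mulr1 => H.
have := H; rewrite !invr_gt0 subr_gt0 => /(_ d0 d1).
rewrite subrKC => /(_ erefl); lra.
Qed.

Variable d : R.
Hypothesis d01 : 0 < d < 1.

Lemma binsum_factor_gt0 n : 0 < 1 - d / n.+1%:R.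
Proof.
rewrite subr_gt0 ltr_pdivrMr ?ltr0n// mul1r.
by move/andP: d01 => [_ /lt_le_trans]; apply; rewrite ler1n.
Qed.

Lemma binsum_gt0 n : 0 < binsum d n.
Proof. by rewrite /binsum prodr_gt0// => i _; exact: binsum_factor_gt0. Qed.

(** Induction: Bernoulli's inequality gives (1 + x)^d <= 1 + d x with x = 1/(n+1), and (1 - d x)(1 +
    d x) <= 1. *)
Lemma binsum_ub n : binsum d n <= n.+1%:R `^ (- d).
Proof.
elim: n => [|n IH]; first by rewrite /binsum big_ord0 powR1.
have [d0 d1] := andP d01.
have N0 : 0 < n.+1%:R :> R by rewrite ltr0n.
have := @powR_bernoulli d (n.+2%:R / n.+1%:R) d01 (divr_ge0 (ler0n _ _) (ler0n _ _)).
have -> : n.+2%:R / n.+1%:R = 1 + n.+1%:R^-1 :> R.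
  by rewrite -natr1 mulrDl mulfV ?gt_eqF// mul1r.
rewrite addrAC subrr add0r => B.
rewrite binsumS.
have n2E : n.+2%:R = n.+1%:R * (1 + n.+1%:R^-1) :> R.
  by rewrite mulrDr mulr1 mulfV ?gt_eqF// natr1.
rewrite n2E powRM// ?addr_ge0// ?invr_ge0//.
apply: ler_pM => //; [exact/ltW/binsum_gt0|exact/ltW/binsum_factor_gt0|].
rewrite powRN -[leRHS]mul1r ler_pdivlMr; last by rewrite powR_gt0// addr_gt0// invr_gt0.
apply: le_trans (ler_wpM2l (ltW (binsum_factor_gt0 n)) B) _.
by rewrite -subr_sqr expr1n gerBl sqr_ge0.
Qed.

Lemma binsum_lb n : (1 - d) * n.+1%:R `^ (- d) <= binsum d n.
Proof.
have [d0 d1] := andP d01.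
case: n => [|n]; first by rewrite /binsum big_ord0 powR1 mulr1; lra.
(* The induction proves the sharper bound with the base lowered by one; it starts at
   [binsum d 1 = 1 - d], whence the constant. *)
apply: (@le_trans _ _ ((1 - d) * n.+1%:R `^ (- d))).
  rewrite ler_pM2l ?subr_gt0// !powRN lef_pV2 ?posrE ?powR_gt0 ?ltr0n//.
  by rewrite ge0_ler_powR ?nnegrE ?ler0n ?ler_nat// ltW.
elim: n => [|n IH].
  by rewrite powR1 mulr1 /binsum big_ord_recr big_ord0/= divr1 mul1r.
have N0 : 0 < n.+2%:R :> R by rewrite ltr0n.
have := @powR_bernoulli d (n.+1%:R / n.+2%:R) d01 (divr_ge0 (ler0n _ _) (ler0n _ _)).
have E : n.+1%:R / n.+2%:R = 1 - n.+2%:R^-1 :> R.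
  by rewrite -[n.+2%:R]natr1 -[X in X - _](@mulfV _ n.+2%:R) ?gt_eqF//
     -[in RHS](natr1 n.+1) mulrDl mul1r addrK.
rewrite {2}E addrAC subrr add0r mulrN => B.
have -> : (1 - d) * n.+2%:R `^ (- d) =
   (1 - d) * n.+1%:R `^ (- d) * ((n.+1%:R / n.+2%:R) `^ d).
  rewrite -!mulrA; congr (_ * _).
  rewrite powRM ?invr_ge0// -(powR_inv1 (ltW N0)) -powRrM mulN1r mulrA -powRD.
    by rewrite addNr powRr0 mul1r.
  by rewrite pnatr_eq0 implybT.
by rewrite binsumS ler_pM// ?mulr_ge0 ?powR_ge0// ?subr_ge0 1?ltW//.
Qed.

End binomial.

(** * The binomial series on the closed disk *)

Section real_derivative.
Context {R : realType}.
Implicit Types (f g : R -> R) (t a b : R).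

Lemma der_eq t f a b : is_derive t 1 f a -> a = b -> is_derive t 1 f b.
Proof. by move=> ? <-. Qed.

Lemma derD t f g a b : is_derive t 1 f a -> is_derive t 1 g b ->
  is_derive t 1 (fun x => f x + g x) (a + b).
Proof. by move=> fa gb; exact: (is_deriveD fa gb). Qed.

Lemma derB t f g a b : is_derive t 1 f a -> is_derive t 1 g b ->
  is_derive t 1 (fun x => f x - g x) (a - b).
Proof. by move=> fa gb; exact: (is_deriveB fa gb). Qed.

Lemma derM t f g a b : is_derive t 1 f a -> is_derive t 1 g b ->
  is_derive t 1 (fun x => f x * g x) (f t * b + g t * a).
Proof. by move=> fa gb; exact: (is_deriveM fa gb). Qed.

Lemma derC t c : is_derive t 1 (fun=> c : R) 0.
Proof. exact: is_derive_cst. Qed.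

Lemma derZ t f c a : is_derive t 1 f a -> is_derive t 1 (fun x => c * f x) (c * a).
Proof.
by move=> fa; apply: der_eq (derM (derC t c) fa) _; rewrite mulr0 addr0.
Qed.

Lemma der_comp t f g a b : is_derive (g t) 1 f a -> is_derive t 1 g b ->
  is_derive t 1 (fun x => f (g x)) (a * b).
Proof. by move=> fa gb; exact: (is_derive1_comp fa gb). Qed.

Lemma derV t f a : f t != 0 -> is_derive t 1 f a ->
  is_derive t 1 (fun x => (f x)^-1) (- (f t) ^- 2 * a).
Proof. by move=> f0 fa; exact: (is_deriveV f0 fa). Qed.

End real_derivative.

Section complex_derivative.
Context {R : realType}.
Implicit Types (f g : R -> R[i]) (l m : R[i]) (t : R).

Definition is_cder t f l := is_derive t 1 (fun x => complex.Re (f x)) (complex.Re l) /\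
  is_derive t 1 (fun x => complex.Im (f x)) (complex.Im l).

Lemma is_cder_cst t c : is_cder t (fun=> c) 0.
Proof. by split; apply: is_derive_cst. Qed.

Lemma is_cderD t f g l m : is_cder t f l -> is_cder t g m ->
  is_cder t (fun x => f x + g x) (l + m).
Proof.
by move=> [f1 f2] [g1 g2]; split;
  under eq_fun do rewrite raddfD/=; rewrite raddfD/=; exact: is_deriveD.
Qed.

Lemma is_cderM t f g l m : is_cder t f l -> is_cder t g m ->
  is_cder t (fun x => f x * g x) (f t * m + g t * l).
Proof.
have E1 (a b : R[i]) : complex.Re (a * b) =
   complex.Re a * complex.Re b - complex.Im a * complex.Im b by case: a b => ? ? [].
have E2 (a b : R[i]) : complex.Im (a * b) =
   complex.Re a * complex.Im b + complex.Im a * complex.Re b by case: a b => ? ? [].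
move=> [f1 f2] [g1 g2]; split.
  under eq_fun do rewrite E1.
  apply: (der_eq (derB (derM f1 g1) (derM f2 g2))).
  by rewrite [in RHS]raddfD/= [complex.Re (f t * m)]E1 [complex.Re (g t * l)]E1; ring.
under eq_fun do rewrite E2.
apply: (der_eq (derD (derM f1 g2) (derM f2 g1))).
by rewrite [in RHS]raddfD/= [complex.Im (f t * m)]E2 [complex.Im (g t * l)]E2; ring.
Qed.

Lemma is_cder_real t (h : R -> R) (dh : R) : is_derive t 1 h dh ->
  is_cder t (fun x => (h x)%:C) dh%:C.
Proof. by move=> ?; split => //=; exact: is_derive_cst. Qed.

Lemma is_cder_cis t (h : R -> R) (dh : R) : is_derive t 1 h dh ->
  is_cder t (fun x => cis (h x)) (dh%:C * 'i * cis (h t)).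
Proof.
move=> hd; split => /=.
  by apply: (der_eq (der_comp (is_derive_cos _) hd)); ring.
by apply: (der_eq (der_comp (is_derive_sin _) hd)); ring.
Qed.

Lemma is_cder_sum t (F : nat -> R -> R[i]) (dF : nat -> R[i]) n :
  (forall k, is_cder t (F k) (dF k)) ->
  is_cder t (fun x => \sum_(k < n) F k x) (\sum_(k < n) dF k).
Proof.
move=> H; elim: n => [|n IH].
  by under eq_fun do rewrite big_ord0; rewrite big_ord0; exact: is_cder_cst.
under eq_fun do rewrite big_ord_recr/=.
by rewrite big_ord_recr/=; exact: is_cderD.
Qed.

Lemma is_cder_expr t z n :
  is_cder t (fun x => (x%:C * z) ^+ n) (n%:R * z * (t%:C * z) ^+ n.-1).
Proof.
have D : is_cder t (fun x => x%:C * z) z.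
  have := is_cderM (is_cder_real (@is_derive_id R R t 1)) (is_cder_cst t z).
  by rewrite mulr0 add0r mulr1.
elim: n => [|n IH]; first by rewrite mulr0n !mul0r; exact: is_cder_cst.
under eq_fun do rewrite exprS.
have -> : n.+1%:R * z * (t%:C * z) ^+ n.+1.-1 =
  t%:C * z * (n%:R * z * (t%:C * z) ^+ n.-1) + (t%:C * z) ^+ n * z.
  rewrite /= -natr1; case: n {IH} => [|n] /=; first by rewrite !mul0r mulr0 add0r mul1r expr0; ring.
  by rewrite exprS; ring.
exact: is_cderM.
Qed.

(** The factor 2 pays for applying the mean value theorem to the real and imaginary parts
    separately, at different points. *)
Lemma cder_bound f df (M : R) : (forall t, 0 <= t <= 1 -> is_cder t f (df t)) ->
  (forall t, 0 <= t <= 1 -> normc (df t) <= M) -> normc (f 1 - f 0) <= 2 * M.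
Proof.
move=> fd dM.
have H (h dh : R -> R) : (forall t, 0 <= t <= 1 -> is_derive t 1 h (dh t)) ->
    (forall t, 0 <= t <= 1 -> `|dh t| <= M) -> `|h 1 - h 0| <= M.
  move=> hd hM.
  have h01 (x : R) : x \in `]0, 1[ -> is_derive x 1 h (dh x).
    by move=> xI; apply: hd; rewrite !ltW ?(itvP xI).
  have [|c cI ->] := @MVT R h dh 0 1 ltr01 h01; last first.
    by rewrite subr0 mulr1 hM// !ltW ?(itvP cI).
  apply: derivable_within_continuous => x; rewrite in_itv/= => xI.
  by have [] := hd _ xI.
rewrite (le_trans (normc_le_ReIm _))// mulr_natl mulr2n lerD//.
  rewrite raddfB/=; apply: (H (fun t => complex.Re (f t)) (fun t => complex.Re (df t))) => t /[dup] t01.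
    by move/fd => [].
  by move/dM; apply: le_trans; exact: ler_abs_Re.
rewrite raddfB/=; apply: (H (fun t => complex.Im (f t)) (fun t => complex.Im (df t))) => t /[dup] t01.
  by move/fd => [].
by move/dM; apply: le_trans; exact: ler_abs_Im.
Qed.

End complex_derivative.

Section cpow_theory.
Context {R : realType}.
Implicit Types (z : R[i]) (s t : R).

Lemma cisD (x y : R) : cis (x + y) = cis x * cis y.
Proof. by rewrite /cis cosD sinD; apply: complex_eqP => /=; ring. Qed.

Lemma cis0 : cis 0 = 1 :> R[i].
Proof. by rewrite /cis cos0 sin0. Qed.

Lemma normc_cis (x : R) : normc (cis x) = 1.
Proof. by rewrite /= cos2Dsin2 sqrtr1. Qed.

Lemma cisN (x : R) : cis (- x) = (cis x)^J.
Proof. by rewrite /cis cosN sinN. Qed.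

Lemma normc_cpow z s : normc (cpow z s) = normc z `^ s.
Proof. by rewrite normcM normcR normc_cis mulr1 ger0_norm// powR_ge0. Qed.

Lemma cpowVN z s : z != 0 -> cpow z (- s) * cpow z s = 1.
Proof.
rewrite -normc_gt0 => z0.
rewrite /cpow mulrACA -rmorphM -cisD mulNr addNr cis0 mulr1 /=.
by rewrite powRN mulVf// gt_eqF// powR_gt0.
Qed.

(** The definition by [acos] switches formula on the real axis, where 1 - t z may lie, and cannot be
    differentiated there directly; on the right half-plane [atan] is a smooth substitute. *)
Lemma carg_atan (x y : R) : 0 < x -> carg (x +i* y) = atan (y / x).
Proof.
move=> x0.
have E : x / normc (x +i* y) = cos (atan (y / x)).
  have -> : normc (x +i* y) = x * Num.sqrt (1 + (y / x) ^+ 2).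
    have /= <- := gtr0_norm x0; rewrite -sqrtr_sqr -sqrtrM ?sqr_ge0// sqrtr_sqr gtr0_norm//.
    by congr Num.sqrt; field; rewrite gt_eqF.
  by rewrite cos_atan invfM mulrA mulfV ?gt_eqF// mul1r.
rewrite /carg E /=.
have [l u] : - (pi / 2) < atan (y / x) /\ atan (y / x) < pi / 2.
  by split; [exact: atan_gtNpi2|exact: atan_ltpi2].
have p0 := @pi_gt0 R.
have [y0|y0] := leP 0 y.
  have a0 : 0 <= atan (y / x) by rewrite -atan0 le_atan// divr_ge0// ltW.
  by rewrite cosK// in_itv/=; lra.
have a0 : atan (y / x) <= 0 by rewrite -atan0 le_atan// mulr_le0_ge0 ?invr_ge0// ltW.
by rewrite cosKN ?opprK//; lra.
Qed.

Lemma normc_powRE (x y : R) s : 0 < x ->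
  normc (x +i* y) `^ s = expR (s * (ln (x ^+ 2 + y ^+ 2) / 2)).
Proof.
move=> x0; have n0 : 0 < normc (x +i* y).
  by rewrite normc_gt0 eq_complex /= gt_eqF.
rewrite /powR gt_eqF//; congr (expR (_ * _)) => /=.
by rewrite -powR12_sqrt ?addr_ge0 ?sqr_ge0// ln_powR mulrC.
Qed.

Section ray.
Variables (z : R[i]) (s : R).
Hypotheses (z1 : normc z <= 1) (zN1 : z != 1).

(** [|z| <= 1] and [z != 1] force Re z < 1, so the whole segment 1 - t z stays in the right
    half-plane, where [carg_atan] applies. *)
Lemma ray_gt0 t : 0 <= t <= 1 -> 0 < 1 - t * complex.Re z.
Proof.
move=> /andP[t0 t1].
have : complex.Re z < 1.
  have := normc_sqrE z; have : normc z ^+ 2 <= 1 by rewrite exprn_ile1// normc_ge0.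
  rewrite ltNge => H H'; apply/negP => H2; move/eqP: zN1; apply.
  have h3 := sqr_ge0 (complex.Im z).
  have h4 : complex.Re z = 1 by nra.
  apply: complex_eqP => //=; apply/eqP; rewrite -sqrf_eq0; apply/eqP; nra.
have [a0|a0] := leP (complex.Re z) 0 => az; last by nra.
by rewrite (lt_le_trans ltr01)// lerDl oppr_ge0 mulr_ge0_le0.
Qed.

Lemma is_cder_ray t : 0 <= t <= 1 ->
  is_cder t (fun x => cpow (1 - x%:C * z) s) (- s%:C * z / (1 - t%:C * z) * cpow (1 - t%:C * z) s).
Proof.
move=> t01; have x0 := ray_gt0 t01.
set a := complex.Re z in x0; pose b := complex.Im z.
have E x : 1 - x%:C * z = (1 - x * a) +i* (- (x * b)).
  by rewrite /a /b; case: z => u v; apply: complex_eqP => /=; ring.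
pose q x := (1 - x * a) ^+ 2 + (x * b) ^+ 2.
pose G x : R[i] := (expR (s * (ln (q x) / 2)))%:C * cis (s * atan (- (x * b) / (1 - x * a))).
have q0 : 0 < q t by rewrite /q ltr_pwDl ?exprn_gt0// sqr_ge0.
have GE x : 0 < 1 - x * a -> cpow (1 - x%:C * z) s = G x.
  move=> xa; rewrite E /cpow carg_atan// normc_powRE// /G /q.
  by rewrite sqrrN.
have dlin : is_derive t 1 (fun x : R => 1 - x * a) (- a).
  by apply: (der_eq (derB (derC t 1) (derM (is_derive_id t 1) (derC t a)))); rewrite /=; ring.
have dm : is_derive t 1 (fun x : R => - (x * b)) (- b).
  have := derB (derC t 0) (derM (is_derive_id t 1) (derC t b)).
  under eq_fun do rewrite sub0r.
  by move/der_eq; apply => /=; ring.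
have dq : is_derive t 1 q (- 2 * a * (1 - t * a) + 2 * t * b ^+ 2).
  have := derD (derM dlin dlin) (derM (derM (is_derive_id t 1) (derC t b)) (derM (is_derive_id t 1) (derC t b))).
  by move/der_eq; apply => /=; ring.
have dL : is_derive t 1 (fun x => s * (ln (q x) / 2)) (s * (- a * (1 - t * a) + t * b ^+ 2) / q t).
  have := derZ s (derM (der_comp (is_derive1_ln q0) dq) (derC t 2^-1)).
  by move/der_eq; apply => /=; field; rewrite gt_eqF.
have dT : is_derive t 1 (fun x => s * atan (- (x * b) / (1 - x * a))) (- s * b / q t).
  have xN0 : 1 - t * a != 0 by rewrite gt_eqF.
  have := derZ s (der_comp (is_derive1_atan _) (derM dm (derV (f := fun x => 1 - x * a) xN0 dlin))).
  move/der_eq; apply => /=.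
  have : q t != 0 by rewrite gt_eqF.
  rewrite /q => qN0.
  field; rewrite xN0/=.
  by rewrite qN0.
have dA : is_derive t 1 (fun x => expR (s * (ln (q x) / 2)))
     (expR (s * (ln (q t) / 2)) * (s * (- a * (1 - t * a) + t * b ^+ 2) / q t)).
  exact: (der_comp (is_derive_expR _) dL).
have dG := is_cderM (is_cder_real dA) (is_cder_cis dT).
(* [cpow] agrees with the smooth expression [G] only where 1 - x Re z > 0; this is an open
   condition, so the derivatives at t agree. *)
have nG : \forall x \near t, 0 < 1 - x * a.
  have : {for t, continuous (fun x : R => 1 - x * a)}.
    by apply/differentiable_continuous/derivable1_diffP; case: dlin.
  by move=> /cvgr_gt; apply.
have [dG1 dG2] : is_cder t G (- s%:C * z / (1 - t%:C * z) * G t).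
  rewrite (_ : - s%:C * z / _ * _ = (expR (s * (ln (q t) / 2)))%:C *
    ((- s * b / q t)%:C * 'i * cis (s * atan (- (t * b) / (1 - t * a)))) +
    cis (s * atan (- (t * b) / (1 - t * a))) *
    (expR (s * (ln (q t) / 2)) * (s * (- a * (1 - t * a) + t * b ^+ 2) / q t))%:C)//.
  rewrite /G rmorphM/=; set A := (expR _)%:C; set c := cis _.
  rewrite (_ : - s%:C * z / (1 - t%:C * z) =
     (- s * b / q t)%:C * 'i + (s * (- a * (1 - t * a) + t * b ^+ 2) / q t)%:C).
    by ring.
  rewrite E; have -> : z = a +i* b by rewrite /a /b; case: (z).
  have q0' : (1 - t * a) ^+ 2 + (- (t * b)) ^+ 2 != 0.
    by rewrite sqrrN; rewrite gt_eqF.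
  have q0'' : q t != 0 by rewrite gt_eqF.
  apply: complex_eqP => /=; move: q0' q0''; rewrite /q => q0' q0''; field;
    by rewrite ?q0' ?q0''.
split; rewrite GE//.
  by apply: near_eq_is_derive dG1; near do rewrite GE//.
by apply: near_eq_is_derive dG2; near do rewrite GE//.
Unshelve. all: end_near. Qed.

(** Combines |1 - z| <= |1 - t z| + (1 - t)|z| with (1 - t)|z| <= 1 - t|z| <= |1 - t z|. *)
Lemma normc_ray_ge t : 0 <= t <= 1 -> normc (1 - z) / 2 <= normc (1 - t%:C * z).
Proof.
move=> /andP[t0 t1].
have H1 : normc (1 - z) <= normc (1 - t%:C * z) + (1 - t) * normc z.
  apply: le_trans (ler_normc_distD (t%:C * z) _ _) _; rewrite lerD2l.
  have -> : t%:C * z - z = - ((1 - t)%:C * z) by rewrite rmorphB/= rmorph1; ring.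
  by rewrite normcN normcM normcR ger0_norm// subr_ge0.
have H2 : 1 - t * normc z <= normc (1 - t%:C * z).
  rewrite lerBlDr; apply: (@le_trans _ _ (normc ((1 - t%:C * z) + t%:C * z))).
    by rewrite subrK normc1.
  by rewrite (le_trans (le_normcD _ _))// lerD2l normcM normcR ger0_norm.
by rewrite ler_pdivrMr// mulr_natr mulr2n; move: (normc_ge0 z) z1 H1 H2; nra.
Qed.

End ray.

Definition psum (e : nat -> R[i]) (z : R[i]) n := \sum_(k < n) e k * z ^+ k.

Definition binc (s : R) k : R[i] := (bin s k)%:C.

(* The residual of the partial sums in (1 - w) y' + s y = 0, solved by (1 - w)^s *)
Lemma binomial_ode s w N :
  (1 - w) * (\sum_(k < N.+1) binc s k * (k%:R * w ^+ k.-1)) + s%:C * psum (binc s) w N.+1 =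
  (s - N%:R)%:C * binc s N * w ^+ N.
Proof.
elim: N => [|N IH].
  rewrite /psum !big_ord_recr !big_ord0/= mulr0n mul0r mulr0 !add0r !mulr0 add0r subr0.
  by rewrite mulrA.
have H : (s - N%:R)%:C * binc s N = - (N.+1%:R * binc s N.+1).
  have : (N.+1%:R : R[i]) * (bin s N.+1)%:C = ((N%:R - s) * bin s N)%:C.
    by rewrite -binS rmorphM/= rmorph_nat.
  by rewrite /binc => ->; rewrite -rmorphM/= -rmorphN/= -mulNr opprB.
rewrite H in IH.
rewrite /psum !(big_ord_recr N.+1)/= -/(psum _ _ _).
set A := \sum_(k < _) _ in IH *; set B := psum _ _ _ in IH *.
set b := binc s N.+1 in IH *.
have -> : (1 - w) * (A + b * (N.+1%:R * w ^+ N)) + s%:C * (B + b * w ^+ N.+1) =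
   ((1 - w) * A + s%:C * B) + (1 - w) * b * N.+1%:R * w ^+ N + s%:C * b * w ^+ N.+1.
  by ring.
rewrite IH rmorphB/= rmorph_nat exprS; ring.
Qed.

(* Differentiate the quotient of the partial sum by (1 - t z)^s in t, on [0, 1]. *)
Lemma binomial_approx z s : -1 < s -> normc z <= 1 -> z != 1 ->
  exists C : R, forall N, normc (psum (binc s) z N.+1 - cpow (1 - z) s) <=
    C * (N.+1%:R * `|bin s N| * normc z ^+ N).
Proof.
move=> s1 z1 zN1.
have m0 : 0 < normc (1 - z) / 2 by rewrite divr_gt0// normc_gt0 subr_eq0 eq_sym.
(* 2 comes from [cder_bound]; (|s| + 1)(N + 1) bounds |s - N|; the power of |1 - z| / 2 bounds |1 -
   t z|^{-s-1} by [normc_ray_ge], as s > -1; the last factor comes from multiplying the quotient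
   back by (1 - z)^s. *)
exists (2 * (`|s| + 1) * (normc (1 - z) / 2) `^ (- s - 1) * normc (1 - z) `^ s) => N.
pose F (t : R) := psum (binc s) (t%:C * z) N.+1 * cpow (1 - t%:C * z) (- s).
pose dF (t : R) := cpow (1 - t%:C * z) (- s) * z / (1 - t%:C * z) *
  ((s - N%:R)%:C * binc s N * (t%:C * z) ^+ N).
have tN0 (t : R) : 0 <= t <= 1 -> 1 - t%:C * z != 0.
  by move=> t01; rewrite -normc_gt0 (lt_le_trans m0)// normc_ray_ge.
have Fd t : 0 <= t <= 1 -> is_cder t F (dF t).
  move=> t01.
  have D1 : is_cder t (fun x => psum (binc s) (x%:C * z) N.+1)
      (\sum_(k < N.+1) binc s k * (k%:R * z * (t%:C * z) ^+ k.-1)).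
    apply: (is_cder_sum (F := fun k x => binc s k * (x%:C * z) ^+ k)
      (dF := fun k => binc s k * (k%:R * z * (t%:C * z) ^+ k.-1))) => k.
    have := is_cderM (is_cder_cst t (binc s k)) (is_cder_expr t z k).
    by rewrite mulr0 addr0.
  have := is_cderM D1 (is_cder_ray (- s) z1 zN1 t01).
  rewrite rmorphN/= opprK.
  set D := _ + _; suff -> : D = dF t by [].
  rewrite /D /dF -binomial_ode.
  have -> : \sum_(k < N.+1) binc s k * (k%:R * z * (t%:C * z) ^+ k.-1) =
     z * \sum_(k < N.+1) binc s k * (k%:R * (t%:C * z) ^+ k.-1).
    by rewrite mulr_sumr; apply: eq_bigr => k _; ring.
  by field; exact: tN0.
have dFM t : 0 <= t <= 1 -> normc (dF t) <= (normc (1 - z) / 2) `^ (- s - 1) *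
    ((`|s| + 1) * (N.+1%:R * `|bin s N| * normc z ^+ N)).
  move=> t01; have r0 := tN0 _ t01; rewrite -normc_gt0 in r0.
  have [t0 t1] := andP t01.
  rewrite /dF normcM; apply: ler_pM; rewrite ?normc_ge0//.
    rewrite normcM normcV normcM normc_cpow mulrAC.
    rewrite -powR_inv1 ?normc_ge0// -powRD; last by rewrite (gt_eqF r0) implybT.
    rewrite (le_trans (ler_piMr _ z1)) ?powR_ge0//.
    have -> : - s - 1 = - (s + 1) by ring.
    rewrite !powRN lef_pV2 ?posrE ?powR_gt0//.
    apply: ge0_ler_powR; rewrite ?nnegrE ?normc_ge0 ?(ltW m0)//; first by lra.
    exact: normc_ray_ge.
  rewrite 2!normcM !normcR normcX normcM normcR (ger0_norm t0) mulrA.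
  rewrite ler_pM ?mulr_ge0 ?exprn_ge0 ?mulr_ge0 ?normc_ge0//.
    rewrite mulrA ler_wpM2r// (le_trans (ler_normB _ _))// normr_nat.
    rewrite -natr1; have : 0 <= N%:R :> R by []. move: (normr_ge0 s) => h h'; nra.
  by rewrite lerXn2r ?nnegrE ?mulr_ge0 ?normc_ge0// ler_piMl// normc_ge0.
have := cder_bound Fd dFM.
rewrite /F !rmorph1 !rmorph0 !mul1r !mul0r subr0.
have -> : psum (binc s) 0 N.+1 = 1.
  rewrite /psum big_ord_recl /= expr0 mulr1 big1 ?addr0 ?/binc ?bin0// => i _.
  by rewrite /bump/= add1n exprS mul0r mulr0.
have -> : cpow 1 (- s) = 1 :> R[i].
  by rewrite /cpow /carg normc1 powR1 divr1 /= lexx acos1 mulr0 cis0 mulr1.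
rewrite mulr1 => H.
have z1' : 1 - z != 0 by rewrite subr_eq0 eq_sym.
have -> : psum (binc s) z N.+1 - cpow (1 - z) s =
  (psum (binc s) z N.+1 * cpow (1 - z) (- s) - 1) * cpow (1 - z) s.
  by rewrite mulrBl -mulrA cpowVN// mulr1 mul1r.
rewrite normcM normc_cpow mulrAC ler_wpM2r ?powR_ge0//.
by apply: le_trans H _; rewrite le_eqVlt; apply/orP; left; apply/eqP; ring.
Qed.

End cpow_theory.

(** * Elementary bounds for geometric and power sequences *)

Section real_sequences.
Context {R : realType}.

(** Each of the N + 1 terms of the geometric sum is at least y^N. *)
Lemma natmul_expr_bound (y : R) N : 0 <= y < 1 -> N.+1%:R * y ^+ N <= (1 - y)^-1.
Proof.
move=> /andP[y0 y1].
rewrite -[leRHS]mul1r ler_pdivlMr ?subr_gt0//.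
apply: (@le_trans _ _ ((\sum_(k < N.+1) y ^+ k) * (1 - y))).
  rewrite ler_wpM2r ?subr_ge0 ?(ltW y1)//.
  rewrite -[N.+1 in leLHS]card_ord -sum1_card natr_sum mulr_suml ler_sum// => k _.
  by rewrite mul1r ler_wiXn2l// ?ltW// -ltnS.
by rewrite mulrC -[X in X * _]opprB mulNr -subrX1 opprB lerBlDr lerDl exprn_ge0.
Qed.

Lemma natpow_expr_bound (y : R) p : 0 < y < 1 ->
  exists C : R, forall N, N.+1%:R ^+ p * y ^+ N <= C.
Proof.
move=> /andP[y0 y1]; case: p => [|p].
  by exists 1 => N; rewrite mul1r exprn_ile1// ltW.
(* Apply the linear bound to the (p+1)-th root of y and raise it to the power p + 1. *)
pose x := y `^ (p.+1%:R^-1).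
have xE : x ^+ p.+1 = y.
  by rewrite -powR_mulrn ?powR_ge0// -powRrM mulVf ?pnatr_eq0// powRr1// ltW.
have x01 : 0 <= x < 1.
  rewrite powR_ge0/= ltNge; apply/negP => x1.
  by have := exprn_ege1 p.+1 x1; rewrite xE leNgt y1.
exists ((1 - x)^-1 ^+ p.+1) => N.
rewrite -xE -exprM mulnC exprM -exprMn lerXn2r ?nnegrE ?natmul_expr_bound//.
  by rewrite mulr_ge0// exprn_ge0//; case/andP: x01.
by rewrite invr_ge0 subr_ge0 ltW//; case/andP: x01.
Qed.

Lemma expr_lt_eps (y e : R) : 0 <= y < 1 -> 0 < e -> exists N, forall n, (N <= n)%N -> y ^+ n < e.
Proof.
move=> y01 e0; have [y0 y1] := andP y01.
have B0 : 0 < (1 - y)^-1 by rewrite invr_gt0 subr_gt0.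
exists (Num.truncn ((1 - y)^-1 / e)).+1 => n Nn.
have := natmul_expr_bound n y01.
have : (1 - y)^-1 / e < n.+1%:R.
  apply: lt_le_trans (truncnS_gt _) _.
  by rewrite ler_nat ltnW// ltnS.
rewrite ltr_pdivrMr// => H H2; have := le_lt_trans H2 H.
by rewrite ltr_pM2l// ltr0n.
Qed.

Lemma powRN_lt_eps (d e : R) : 0 < d -> 0 < e ->
  exists N, forall n, (N <= n)%N -> n.+1%:R `^ (- d) < e.
Proof.
move=> d0 e0; exists (Num.truncn ((e^-1) `^ d^-1)).+1 => n Nn.
have : e^-1 `^ d^-1 < n.+1%:R.
  apply: lt_le_trans (truncnS_gt _) _.
  by rewrite ler_nat ltnW// ltnS.
move=> H; rewrite powRN -[ltRHS]invrK ltf_pV2 ?posrE ?invr_gt0 ?powR_gt0 ?ltr0n//.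
have -> : e^-1 = (e^-1 `^ d^-1) `^ d.
  by rewrite -powRrM mulVf ?gt_eqF// powRr1// invr_ge0 ltW.
by rewrite gt0_ltr_powR// ?nnegrE ?powR_ge0.
Qed.

(** The induction carries the sharper bound 2 - 1/n, from 1/(n+1)^2 <= 1/n - 1/(n+1). *)
Lemma sum_inv_sqr n : \sum_(k < n) (k.+1%:R ^+ 2)^-1 <= 2 :> R.
Proof.
case: n => [|n]; first by rewrite big_ord0.
suff: \sum_(k < n.+1) (k.+1%:R ^+ 2)^-1 <= 2 - n.+1%:R^-1 :> R.
  by move=> /le_trans; apply; rewrite gerBl invr_ge0.
elim: n => [|n IH]; first by rewrite big_ord_recr big_ord0/= expr1n invr1; lra.
rewrite big_ord_recr/=; apply: le_trans (lerD IH (lexx _)) _.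
have n0 : 0 < n.+1%:R :> R by rewrite ltr0n.
have -> : n.+2%:R = n.+1%:R + 1 :> R by rewrite natr1.
move: (n.+1%:R : R) n0 => x x0.
rewrite -subr_ge0.
have -> : 2 - (x + 1)^-1 - (2 - x^-1 + ((x + 1) ^+ 2)^-1) = (x * (x + 1) ^+ 2)^-1.
  by field; rewrite !gt_eqF// addr_gt0.
by rewrite invr_ge0 mulr_ge0 ?sqr_ge0// ltW.
Qed.

End real_sequences.

(** * Tails of the binomial series, uniformly and away from z = 1 *)

Section power_series.
Context {R : realType}.
Implicit Types (e : nat -> R[i]) (z : R[i]).

Lemma psumS e z n : psum e z n.+1 = psum e z n + e n * z ^+ n.
Proof. by rewrite /psum big_ord_recr. Qed.

Lemma psumB e z n m : (n <= m)%N -> psum e z m - psum e z n = \sum_(n <= k < m) e k * z ^+ k.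
Proof.
by move=> nm; rewrite /psum -!(big_mkord xpredT (fun k => e k * z ^+ k))
  (big_cat_nat (leq0n n) nm)/= addrAC subrr add0r.
Qed.

Section binomial_tail.
Variable d : R.
Hypothesis d01 : 0 < d < 1.

Lemma normc_binc k : normc (binc d k) = `|bin d k|.
Proof. exact: normcR. Qed.

Lemma abs_binS k : `|bin d k.+1| = d / k.+1%:R * binsum d k.
Proof.
rewrite bin_binsum normrN ger0_norm// mulr_ge0 ?divr_ge0 ?(ltW (binsum_gt0 d01 k))//.
by case/andP: d01 => /ltW.
Qed.

(** For k >= 1 the coefficients are negative, so their absolute values are the successive decrements
    of [binsum]. *)
Lemma sum_abs_bin n m : (n <= m)%N ->
  \sum_(n.+1 <= k < m.+1) `|bin d k| = binsum d n - binsum d m.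
Proof.
elim: m => [|m IH]; first by rewrite leqn0 => /eqP ->; rewrite big_geq// subrr.
rewrite leq_eqVlt => /orP[/eqP->|nm]; first by rewrite big_geq// subrr.
rewrite big_nat_recr//=.
by rewrite IH// abs_binS binsumS; ring.
Qed.

Lemma psum_bin_tail1 z n m : normc z <= 1 -> (n <= m)%N ->
  normc (psum (binc d) z m.+1 - psum (binc d) z n.+1) <= binsum d n.
Proof.
move=> z1 nm; rewrite psumB ?ltnS// (le_trans (normc_sum _ _ _))//.
apply: (@le_trans _ _ (\sum_(n.+1 <= k < m.+1) `|bin d k|)).
  apply: ler_sum => k _; rewrite normcM normc_binc normcX ler_piMr//.
  by rewrite exprn_ile1 ?normc_ge0.
by rewrite sum_abs_bin// gerBl ltW// binsum_gt0.
Qed.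

Lemma abs_bin_decr k : `|bin d k.+2| <= `|bin d k.+1|.
Proof.
have [d0 d1] := andP d01.
rewrite !abs_binS binsumS; apply: ler_pM.
- by rewrite divr_ge0// ltW.
- by rewrite mulr_ge0 ?ltW ?binsum_gt0 ?binsum_factor_gt0.
- by rewrite ler_pM2l// lef_pV2 ?posrE ?ltr0n// ler_nat.
- by rewrite ler_piMr ?(ltW (binsum_gt0 d01 k))// gerBl divr_ge0// ltW.
Qed.

(** Summation by parts: after multiplication by 1 - z the coefficients become the increments of
    [bin], of constant sign, and their absolute values telescope. *)
Lemma psum_bin_tail2 z n m : normc z <= 1 -> (n <= m)%N ->
  normc (1 - z) * normc (psum (binc d) z m.+1 - psum (binc d) z n.+1) <= 2 * `|bin d n.+1|.
Proof.
move=> z1 nm; rewrite psumB ?ltnS// -normcM.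
have zn k : normc z ^+ k <= 1 by rewrite exprn_ile1 ?normc_ge0.
have [->|nm'] := eqVneq n m; first by rewrite big_geq// mulr0 normc0 mulr_ge0.
have {nm nm'} nm : (n < m)%N by rewrite ltn_neqAle nm' nm.
(* The boundary term at m is kept inside the modulus; the spare [- |bin d m|] on the right pays for
   removing it, and for the next increment. *)
suff: normc ((1 - z) * (\sum_(n.+1 <= k < m.+1) binc d k * z ^+ k) + binc d m * z ^+ m.+1)
   <= 2 * `|bin d n.+1| - `|bin d m|.
  move=> H; have -> : (1 - z) * (\sum_(n.+1 <= k < m.+1) binc d k * z ^+ k) =
    ((1 - z) * (\sum_(n.+1 <= k < m.+1) binc d k * z ^+ k) + binc d m * z ^+ m.+1) -
    binc d m * z ^+ m.+1 by rewrite addrK.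
  rewrite (le_trans (le_normcB _ _))// -lerBrDr (le_trans H)// lerD2l lerN2.
  by rewrite normcM normc_binc normcX ler_piMr.
elim: m nm => // m IH; rewrite ltnS leq_eqVlt => /orP[/eqP <-|nm].
  rewrite big_nat1.
  have -> : (1 - z) * (binc d n.+1 * z ^+ n.+1) + binc d n.+1 * z ^+ n.+2 = binc d n.+1 * z ^+ n.+1.
    by rewrite [z ^+ n.+2]exprS; ring.
  by rewrite normcM normc_binc normcX mulr_natl mulr2n addrK ler_piMr.
rewrite big_nat_recr ?ltnS//=; last by rewrite ltnW.
have -> : (1 - z) * (\sum_(n.+1 <= i < m.+1) binc d i * z ^+ i + binc d m.+1 * z ^+ m.+1) +
   binc d m.+1 * z ^+ m.+2 =
   ((1 - z) * (\sum_(n.+1 <= i < m.+1) binc d i * z ^+ i) + binc d m * z ^+ m.+1) +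
   (bin d m.+1 - bin d m)%:C * z ^+ m.+1.
  by rewrite rmorphB/= -/(binc _ _) -/(binc _ _) [z ^+ m.+2]exprS; ring.
rewrite (le_trans (le_normcD _ _))// (le_trans (lerD (IH nm) (lexx _)))//.
rewrite -addrA lerD2l normcM normcX normcR -lerBrDl opprK addrC.
rewrite (le_trans (ler_piMr _ (zn _)))//.
case: m {IH} nm => // m nm.
have h k : bin d k.+1 = - `|bin d k.+1| by rewrite abs_binS bin_binsum.
have -> : - bin d m.+1 + bin d m.+2 = `|bin d m.+1| - `|bin d m.+2|.
  by rewrite {1}(h m) {1}(h m.+1) opprK.
by rewrite ger0_norm ?subr_ge0 ?abs_bin_decr// addrC.
Qed.

(* Order of magnitude of the tail after z^N of the series of (1 - z)^d *)
Definition gauge N z : R := N.+1%:R `^ (- d) / Num.max 1 (N.+1%:R * normc (1 - z)).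

Lemma gauge_ge0 N z : 0 <= gauge N z.
Proof. by rewrite divr_ge0 ?powR_ge0// le_max ler01. Qed.

Lemma le_gaugeP N z x : 0 <= x -> x <= N.+1%:R `^ (- d) ->
  x * (N.+1%:R * normc (1 - z)) <= N.+1%:R `^ (- d) -> x <= gauge N z.
Proof.
move=> x0 h1 h2; rewrite /gauge ler_pdivlMr ?lt_max ?ltr01//.
by rewrite maxr_pMr// mulr1 ge_max h1.
Qed.

Lemma psum_bin_gauge z n m : normc z <= 1 -> (n <= m)%N ->
  normc (psum (binc d) z m.+1 - psum (binc d) z n.+1) <= 2 * gauge n z.
Proof.
move=> z1 nm; rewrite mulrC -ler_pdivrMr//.
have H0 := normc_ge0 (psum (binc d) z m.+1 - psum (binc d) z n.+1).
apply: le_gaugeP; first by rewrite divr_ge0.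
  rewrite ler_pdivrMr// (le_trans (psum_bin_tail1 z1 nm))// (le_trans (binsum_ub d01 n))//.
  by rewrite ler_peMr ?powR_ge0// ler1n.
have := psum_bin_tail2 z1 nm; rewrite abs_binS => H.
have B := binsum_ub d01 n; have B0 := binsum_gt0 d01 n.
have [d0 d1] := andP d01.
have n0 : 0 < n.+1%:R :> R by rewrite ltr0n.
apply: (@le_trans _ _ (d * binsum d n)); last by nra.
have -> : d * binsum d n = n.+1%:R * ((2 * (d / n.+1%:R * binsum d n)) / 2).
  by field; rewrite gt_eqF.
by rewrite mulrCA ler_wpM2l// mulrAC ler_wpM2r// mulrC.
Qed.

(** At z = 1 the partial sums are [binsum], which tends to 0 = 0^d. Elsewhere the error in
    [binomial_approx] is of order (n+1)|bin d n| = O(n^{-d}), even on the circle. *)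
Lemma psum_bin_cvg z : normc z <= 1 -> ccvg (psum (binc d) z) (cpow (1 - z) d).
Proof.
move=> z1; have [d0 d1] := andP d01.
have [zE|zN1] := eqVneq z 1.
  rewrite zE subrr => e e0.
  have [N HN] := powRN_lt_eps d0 e0; exists N.+1 => -[//|n] Nn.
  have -> : cpow 0 d = 0 :> R[i].
    by rewrite /cpow normc0 powR0 ?gt_eqF// mul0r.
  have -> : psum (binc d) 1 n.+1 = (binsum d n)%:C.
    rewrite -sum_bin rmorph_sum/= /psum; apply: eq_bigr => k _.
    by rewrite expr1n mulr1.
  rewrite subr0 normcR ger0_norm ?(ltW (binsum_gt0 d01 _))//.
  by rewrite (le_lt_trans (binsum_ub d01 n))// HN.
have d1' : -1 < d by lra.
have [C HC] := binomial_approx d1' z1 zN1 => e e0.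
have C0 : 0 < 2 * (1 + `|C|) by rewrite mulr_gt0// ltr_pwDl.
have [N HN] := powRN_lt_eps d0 (divr_gt0 e0 C0); exists N.+2 => -[//|[//|n]] Nn.
rewrite (le_lt_trans (HC _))//.
apply: (@le_lt_trans _ _ ((2 * (1 + `|C|)) * n.+1%:R `^ (- d))); last first.
  by rewrite mulrC -ltr_pdivlMr// HN// ltnW.
have n0 : 0 < n.+1%:R :> R by rewrite ltr0n.
have B := binsum_ub d01 n; have B0 := binsum_gt0 d01 n.
have H1 : n.+2%:R * `|bin d n.+1| <= 2 * n.+1%:R `^ (- d).
  rewrite abs_binS.
  have -> : n.+2%:R * (d / n.+1%:R * binsum d n) = (n.+2%:R / n.+1%:R) * (d * binsum d n).
    by ring.
  apply: ler_pM; rewrite ?divr_ge0 ?mulr_ge0 ?(ltW B0) ?(ltW d0)//.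
    by rewrite ler_pdivrMr// -natrM ler_nat; clear; lia.
  by rewrite (le_trans _ B)// ler_piMl ?(ltW B0)// ltW.
have H2 : normc z ^+ n.+1 <= 1 by rewrite exprn_ile1 ?normc_ge0.
have H3 : 0 <= n.+2%:R * `|bin d n.+1| by rewrite mulr_ge0.
have H4 : n.+2%:R * `|bin d n.+1| * normc z ^+ n.+1 <= 2 * n.+1%:R `^ (- d).
  by rewrite (le_trans _ H1)// ler_piMr.
have H5 : 0 <= n.+2%:R * `|bin d n.+1| * normc z ^+ n.+1.
  by rewrite mulr_ge0// exprn_ge0// normc_ge0.
have H6 := ler_norm C; have H7 := normr_ge0 C.
nra.
Qed.

Lemma cpow_gauge z n : normc z <= 1 ->
  normc (cpow (1 - z) d - psum (binc d) z n.+1) <= 2 * gauge n z.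
Proof.
move=> z1; apply: (ccvg_le (N := n.+1) (psum_bin_cvg z1)) => -[//|m] nm.
exact: psum_bin_gauge.
Qed.

End binomial_tail.

Lemma psum_binN_cvg (d : R) z : 0 < d < 1 -> normc z < 1 ->
  ccvg (psum (binc (- d)) z) (cpow (1 - z) (- d)).
Proof.
move=> /andP[d0 d1] z1.
have zN1 : z != 1 by apply: contraTneq z1 => ->; rewrite normc1 ltxx.
have d1' : -1 < - d by lra.
have [C HC] := binomial_approx d1' (ltW z1) zN1 => e e0.
(* The geometric factor |z|^n is split as y^n y^n: one half absorbs the factor n + 1, the other
   tends to 0. *)
pose y := Num.sqrt (normc z).
have y0 : 0 <= y by rewrite sqrtr_ge0.
have y2 : normc z = y * y by rewrite -expr2 sqr_sqrtr ?normc_ge0.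
have y1 : y < 1 by rewrite ltNge; apply/negP => y1; move: z1; rewrite y2; nra.
have y01 : 0 <= y < 1 by rewrite y0.
have C0 : 0 < (1 + `|C|) * (1 - y)^-1 by rewrite mulr_gt0// ?ltr_pwDl// invr_gt0 subr_gt0.
have [N HN] := expr_lt_eps y01 (divr_gt0 e0 C0); exists N.+1 => -[//|n] Nn.
rewrite (le_lt_trans (HC _))//.
apply: (@le_lt_trans _ _ ((1 + `|C|) * (1 - y)^-1 * y ^+ n)); last first.
  by rewrite mulrC -ltr_pdivlMr// HN.
have B : `|bin (- d) n| <= 1 by rewrite norm_bin_le1// normrN ger0_norm ltW.
have H1 := natmul_expr_bound n y01.
have H3 : 0 <= y ^+ n by rewrite exprn_ge0.
rewrite y2 exprMn -!mulrA.
have -> : C * (n.+1%:R * (`|bin (- d) n| * (y ^+ n * y ^+ n))) =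
  C * `|bin (- d) n| * (n.+1%:R * y ^+ n) * y ^+ n by ring.
rewrite [leRHS]mulrA ler_wpM2r//.
apply: (@le_trans _ _ ((1 + `|C|) * (n.+1%:R * y ^+ n))); last first.
  by rewrite ler_wpM2l// addr_ge0.
rewrite ler_wpM2r ?mulr_ge0//.
have := ler_norm C; have := normr_ge0 C; have := normr_ge0 (bin (- d) n).
move: B; set b := `|bin _ _|; set c := `|C| => *; nra.
Qed.

End power_series.

(** * Rational functions without poles on the closed disk *)

Section rational.
Context {R : realType}.
Implicit Types (f : R[i] -> R[i]) (e : nat -> R[i]) (z : R[i]).

Notation rat_disk := (@rational_on_closed_disk R).

Lemma rational_cst (c : R[i]) : rat_disk (fun=> c).
Proof.
exists c%:P, 1; split=> z _; first by rewrite hornerC oner_eq0.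
by rewrite !hornerC divr1.
Qed.

Lemma rationalD f g : rat_disk f -> rat_disk g -> rat_disk (fun z => f z + g z).
Proof.
move=> [n1 [d1 [H1 E1]]] [n2 [d2 [H2 E2]]].
exists (n1 * d2 + n2 * d1), (d1 * d2); split=> z zD.
  by rewrite hornerM mulf_neq0 ?H1 ?H2.
by rewrite E1// E2// hornerD !hornerM; field; rewrite H1 ?H2.
Qed.

Lemma rationalM f g : rat_disk f -> rat_disk g -> rat_disk (fun z => f z * g z).
Proof.
move=> [n1 [d1 [H1 E1]]] [n2 [d2 [H2 E2]]].
exists (n1 * n2), (d1 * d2); split=> z zD.
  by rewrite hornerM mulf_neq0 ?H1 ?H2.
by rewrite E1// E2// !hornerM; field; rewrite H1 ?H2.
Qed.

Lemma rationalV f : rat_disk f -> (forall z, closed_disk z -> f z != 0) ->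
  rat_disk (fun z => (f z)^-1).
Proof.
move=> [n [d [H E]]] f0; exists d, n; split=> z zD.
  by have := f0 z zD; rewrite E// mulf_eq0 negb_or => /andP[].
by rewrite E// invf_div.
Qed.

Lemma rational_sum (I : Type) (s : seq I) (P : pred I) (F : I -> R[i] -> R[i]) :
  (forall i, rat_disk (F i)) -> rat_disk (fun z => \sum_(i <- s | P i) F i z).
Proof.
move=> FP; elim: s => [|i s IH].
  by under eq_fun do rewrite big_nil; exact: rational_cst.
under eq_fun do rewrite big_cons.
by case: (P i) => //; exact: rationalD.
Qed.

Lemma rational_prod (I : Type) (s : seq I) (P : pred I) (F : I -> R[i] -> R[i]) :
  (forall i, rat_disk (F i)) -> rat_disk (fun z => \prod_(i <- s | P i) F i z).
Proof.
move=> FP; elim: s => [|i s IH].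
  by under eq_fun do rewrite big_nil; exact: rational_cst.
under eq_fun do rewrite big_cons.
by case: (P i) => //; exact: rationalM.
Qed.

Lemma rational_det n (M : R[i] -> 'M[R[i]]_n) :
  (forall i j, rat_disk (fun z => M z i j)) -> rat_disk (fun z => \det (M z)).
Proof.
move=> H; rewrite /determinant; apply: rational_sum => s.
by apply: rationalM; [exact: rational_cst|exact: rational_prod].
Qed.

Lemma rational_invmx n (M : R[i] -> 'M[R[i]]_n) :
  (forall i j, rat_disk (fun z => M z i j)) ->
  (forall z, closed_disk z -> \det (M z) != 0) ->
  forall i j, rat_disk (fun z => invmx (M z) i j).
Proof.
move=> H D i j.
have [nu [de [H1 E1]]] : rat_disk (fun z => (\det (M z))^-1 * cofactor (M z) j i).
  apply: rationalM; first by apply: rationalV => //; exact: rational_det.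
  rewrite /cofactor; apply: rationalM; first exact: rational_cst.
  apply: rational_det => k l.
  by under eq_fun do rewrite !mxE; exact: H.
exists nu, de; split=> // z zD; rewrite -E1// /invmx unitmxE unitfE D//.
by rewrite !mxE.
Qed.

Definition expdec e := exists C rho : R, 0 < rho < 1 /\ forall k, normc (e k) <= C * rho ^+ k.

(** Stands for analyticity on a neighbourhood of the closed disk: exponential decay of the
    coefficients replaces a radius of convergence above 1. *)
Definition analytic_on_disk f := exists2 e, expdec e &
  forall z, normc z <= 1 -> ccvg (psum e z) (f z).

Lemma analytic_poly (p : {poly R[i]}) : analytic_on_disk (fun z => p.[z]).
Proof.
exists (fun k => p`_k).
  (* A finite sequence decays at any rate; 2^(size p) compensates the ratio 1/2 on the nonzero
     coefficients. *)
  exists (2 ^+ size p * (\sum_(k < size p) normc p`_k)), 2^-1.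
  split; first by lra.
  have S0 : 0 <= \sum_(k < size p) normc p`_k by apply: sumr_ge0 => *; exact: normc_ge0.
  move=> k; have [kp|pk] := ltnP k (size p); last first.
    by rewrite nth_default// normc0 !mulr_ge0 ?exprn_ge0 ?invr_ge0.
  rewrite mulrAC exprVn -expfB//.
  apply: (@le_trans _ _ (\sum_(k < size p) normc p`_k)).
    rewrite (bigD1 (Ordinal kp))//= lerDl.
    by apply: sumr_ge0 => *; exact: normc_ge0.
  by rewrite ler_peMl// exprn_ege1// ler1n.
move=> z z1 e0 e0_gt0; exists (size p) => n pn.
suff -> : psum (fun k => p`_k) z n = p.[z] by rewrite subrr normc0.
rewrite horner_coef /psum -!(big_mkord xpredT (fun k => p`_k * z ^+ k)).
rewrite (big_cat_nat (leq0n _) pn)/= [X in _ + X]big_nat [X in _ + X]big1 ?addr0// => k /andP[pk _].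
by rewrite nth_default// mul0r.
Qed.

(** The quotient's coefficients obey a linear recursion that divides by w at each step; |w| > 1
    makes it contract, so exponential decay survives at a slightly worse rate. *)
Lemma analytic_div f w : 1 < normc w -> analytic_on_disk f ->
  analytic_on_disk (fun z => f z / (z - w)).
Proof.
move=> w1 [e [C [rho [/andP[r0 r1] eC]]] ef].
(* Obtained by comparing coefficients in (z - w) sum e'_k z^k = sum e_k z^k. *)
pose fix e' k := if k is k'.+1 then (e' k' - e k) / w else - e k / w.
have w0 : w != 0 by rewrite -normc_gt0 (lt_trans _ w1).
have nw0 : 0 < normc w by rewrite normc_gt0.
(* 2 / (1 + |w|) lies strictly between 1/|w| and 1; the rate has to exceed 1/|w|. *)
pose sg := Num.max rho (2 / (1 + normc w)).
have sg0 : 0 < sg by rewrite lt_max r0.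
have sg1 : sg < 1.
  by rewrite gt_max r1/= ltr_pdivrMr ?addr_gt0// mul1r -[X in X < _]addrC; lra.
have rsg : rho <= sg by rewrite le_max lexx.
have wsg : 0 < normc w - sg^-1.
  rewrite subr_gt0 -(ltf_pV2) ?posrE ?invr_gt0// invrK lt_max; apply/orP; right.
  rewrite -[_^-1]mul1r ltr_pdivrMr// mulrAC ltr_pdivlMr ?addr_gt0//; lra.
have C0 : 0 <= C by have := le_trans (normc_ge0 _) (eC 0%N); rewrite expr0 mulr1.
(* The solution of C' |w| = C' / sg + C, which closes the induction on the coefficients. *)
pose C' := C / (normc w - sg^-1).
have C'0 : 0 <= C' by rewrite divr_ge0// ltW.
have e'C k : normc (e' k) <= C' * sg ^+ k.
  have ek j : normc (e j) <= C * sg ^+ j.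
    by rewrite (le_trans (eC j))// ler_wpM2l// lerXn2r ?nnegrE ?(ltW r0) ?(ltW sg0).
  have CE : C = C' * normc w - C' / sg.
    by rewrite -mulrBr /C' mulfVK ?gt_eqF.
  elim: k => [|k IH] /=.
    rewrite normcM normcV normcN ler_pdivrMr// (le_trans (ek 0%N))// expr0 !mulr1 CE.
    by rewrite gerBl divr_ge0// ltW.
  rewrite normcM normcV ler_pdivrMr// (le_trans (le_normcB _ _))//.
  rewrite (le_trans (lerD IH (ek _)))// exprS {1}CE.
  rewrite le_eqVlt; apply/orP; left; apply/eqP; field; by rewrite gt_eqF.
exists e'; first by exists C', sg; rewrite sg0 sg1.
move=> z z1.
have zw : z - w != 0.
  by rewrite subr_eq0; apply: contraTneq z1 => ->; rewrite -ltNge.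
have nzw : 0 < normc (z - w) by rewrite normc_gt0.
have PS n : (z - w) * psum e' z n.+1 = psum e z n.+1 + e' n * z ^+ n.+1.
  elim: n => [|n IH].
    rewrite !psumS /psum !big_ord0 !add0r expr0 expr1 /=; field; exact: w0.
  rewrite psumS mulrDr IH [in RHS]psumS /= [z ^+ n.+2]exprS; field; exact: w0.
move=> eps eps0.
have C'1 : 0 < C' + 1 by rewrite ltr_wpDl.
have h0 : 0 < eps * normc (z - w) / 2 by rewrite divr_gt0// mulr_gt0.
have [N1 H1] := ef z z1 _ h0.
have sg01 : 0 <= sg < 1 by rewrite ltW.
have [N2 H2] := expr_lt_eps sg01 (divr_gt0 h0 C'1).
exists (maxn N1 N2).+1 => -[//|n] /[!ltnS]; rewrite geq_max => /andP[n1 n2].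
have -> : psum e' z n.+1 - f z / (z - w) =
   ((psum e z n.+1 - f z) + e' n * z ^+ n.+1) / (z - w).
  by rewrite addrAC -PS; field; exact: zw.
rewrite normcM normcV ltr_pdivrMr// (le_lt_trans (le_normcD _ _))//.
rewrite [ltRHS]splitr ltrD// ?H1 ?(leqW n1)//.
rewrite normcM normcX (le_lt_trans (ler_piMr _ _)) ?normc_ge0 ?exprn_ile1 ?normc_ge0//.
rewrite (le_lt_trans (e'C n))//.
have := H2 n n2; rewrite ltr_pdivlMr// => /(le_lt_trans _); apply.
by rewrite mulrC ler_wpM2l ?exprn_ge0 ?(ltW sg0)// lerDl.
Qed.

Lemma analytic_scale f c : analytic_on_disk f -> analytic_on_disk (fun z => f z * c).
Proof.
move=> [e [C [rho [r01 eC]]] ef]; exists (fun k => e k * c).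
  exists (C * normc c), rho; split=> // k.
  by rewrite normcM mulrAC ler_wpM2r ?normc_ge0.
move=> z z1 eps eps0.
have c0 : 0 < normc c + 1 by rewrite ltr_wpDl ?normc_ge0.
have [N HN] := ef z z1 _ (divr_gt0 eps0 c0); exists N => n Nn.
have -> : psum (fun k => e k * c) z n - f z * c = (psum e z n - f z) * c.
  rewrite mulrBl /psum mulr_suml; congr (_ - _).
  by apply: eq_bigr => k _; rewrite mulrAC.
rewrite normcM; have := HN n Nn; rewrite ltr_pdivlMr// => /(le_lt_trans _); apply.
by rewrite ler_wpM2l ?normc_ge0// lerDl.
Qed.

(** The denominator splits into linear factors whose roots all lie outside the closed disk, and
    [analytic_div] removes them one at a time. *)
Lemma analytic_rational f : rat_disk f -> analytic_on_disk f.
Proof.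
move=> [nu [de [H E]]].
suff [e ed ec] : analytic_on_disk (fun z => nu.[z] / de.[z]).
  by exists e => // z z1; rewrite E//; exact: ec.
have [r dE] := closed_field_poly_normal de.
have lc0 : lead_coef de != 0.
  rewrite lead_coef_eq0; apply/eqP => d0; have := H 0.
  by rewrite d0 horner0 eqxx /closed_disk/= expr0n /= addr0 sqrtr0 ler01 => /(_ isT).
have r1 w : w \in r -> 1 < normc w.
  move=> wr; rewrite ltNge; apply/negP => /(H w).
  rewrite dE hornerZ horner_prod (big_rem w)//= hornerXsubC subrr mul0r mulr0.
  by rewrite eqxx.
have A : analytic_on_disk (fun z => nu.[z] / \prod_(w <- r) (z - w)).
  elim: r r1 {dE} => [|w r IH] r1.
    under eq_fun do rewrite big_nil divr1; exact: analytic_poly.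
  have -> : (fun z => nu.[z] / \prod_(w0 <- w :: r) (z - w0)) =
      (fun z => (nu.[z] / \prod_(w0 <- r) (z - w0)) / (z - w)).
    by apply/funext => z; rewrite big_cons invfM mulrA mulrAC.
  apply: analytic_div; first by rewrite r1// mem_head.
  by apply: IH => v vr; rewrite r1// in_cons vr orbT.
have [e ed ec] := analytic_scale (lead_coef de)^-1 A; exists e => // z z1.
have -> : nu.[z] / de.[z] = nu.[z] / \prod_(w <- r) (z - w) / lead_coef de.
  rewrite {1}dE hornerZ horner_prod invfM mulrA mulrAC; congr (_ / _ / _).
  by apply: eq_bigr => w _; rewrite hornerXsubC.
exact: ec.
Qed.

End rational.

(** * Weighted integrals over the circle *)

Section unit_circle.
Context {R : realType}.

Lemma cos_sqr_pi4 : cos (pi / 4) ^+ 2 = 2^-1 :> R.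
Proof.
have := @cos_mulr2n R (pi / 4).
have -> : (pi / 4) *+ 2 = pi / 2 :> R by rewrite -mulr_natr; field.
rewrite cos_pihalf -mulr_natr; lra.
Qed.

Lemma sin_sqr_pi4 : sin (pi / 4) ^+ 2 = 2^-1 :> R.
Proof. by have := @cos2Dsin2 R (pi / 4); rewrite cos_sqr_pi4; lra. Qed.

(** Crude but sufficient: up to pi/4 the mean value theorem with cos >= cos(pi/4), beyond it
    monotonicity and sin(pi/4) >= 1/2 >= pi/8. *)
Lemma sin_lower_bound (x : R) : 0 <= x <= pi / 2 -> x / 4 <= sin x.
Proof.
move=> /andP[x0 x2]; have p0 := @pi_gt0 R; have /andP[_ p2] := @pihalf_02 R.
have [x4|x4] := leP x (pi / 4).
  move: x0; rewrite le_eqVlt => /predU1P[<-|x0]; first by rewrite sin0 mul0r.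
  have [|c cI] := @MVT R sin cos 0 x x0 (fun y _ => is_derive_sin y).
    by apply: derivable_within_continuous => y _; exact: ex_derive.
  rewrite sin0 !subr0 => ->; rewrite mulrC ler_wpM2r// ?(ltW x0)//.
  have c4 : cos (pi / 4) <= cos c.
    have [c0 c1] : 0 < c /\ c < x by split; rewrite (itvP cI).
    by rewrite leNgt ltr_cos ?in_itv/= -?leNgt; lra.
  have h0 : 0 <= cos (pi / 4 : R) by apply: cos_ge0_pihalf; lra.
  have := cos_sqr_pi4; move: h0 c4; set a := cos _; set b := cos _ => *; nra.
apply: (@le_trans _ _ (sin (pi / 4))).
  have h0 : 0 <= sin (pi / 4 : R) by apply: sin_ge0_pi; lra.
  have := sin_sqr_pi4; move: h0; set a := sin _ => h0 h1; nra.
by rewrite leNgt ltr_sin ?in_itv/= -?leNgt; lra.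
Qed.

Lemma normc_1Bcis (t : R) : normc (1 - cis t) = 2 * `|sin (t / 2)|.
Proof.
suff H (y : R) : normc (1 - cis (y *+ 2)) = 2 * `|sin y|.
  by rewrite -H -[_ *+ 2]mulr_natr mulfVK.
rewrite -[RHS]ger0_norm ?mulr_ge0// -sqrtr_sqr /=; congr Num.sqrt.
have := @cos2Dsin2 R y; rewrite cos_mulr2n sin_mulr2n.
move: (cos y) (sin y) => c u h.
rewrite [RHS]exprMn real_normK ?num_real//.
have -> : (0 - c * u *+ 2) ^+ 2 = 4 * c ^+ 2 * u ^+ 2 by ring.
have -> : c ^+ 2 = 1 - u ^+ 2 by rewrite -h addrK.
ring.
Qed.

Lemma normc_1Bcis_ge (t : R) : - pi <= t <= pi -> `|t| / 4 <= normc (1 - cis t).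
Proof.
move=> tp; rewrite normc_1Bcis.
have H (x : R) : 0 <= x <= pi -> x / 4 <= 2 * `|sin (x / 2)|.
  move=> xp; have : x / 2 / 4 <= sin (x / 2) by apply: sin_lower_bound; lra.
  by have := ler_norm (sin (x / 2)); lra.
have [t0|t0] := leP 0 t; first by rewrite ger0_norm ?H//; lra.
by have := H (- t); rewrite [- t / 2]mulNr sinN normrN (ltr0_norm t0); apply; lra.
Qed.

Lemma normc_1Bcis_le2 (t : R) : normc (1 - cis t) <= 2.
Proof. by rewrite (le_trans (le_normcB _ _))// normc1 normc_cis; lra. Qed.

End unit_circle.

(** * The integral of a power singularity with a cut-off at scale 1/M *)

Section power_integral.
Context {R : realType}.
Notation mu := (@lebesgue_measure R).
Implicit Types M t e b : R.
Variables (s : R).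
Hypothesis s01 : 0 <= s < 1.

(** The derivative in t of (t / (1 + M t))^(1-s). For M, t > 0 it equals (1 - s) t^{-s} (1 + M
    t)^{s-2}, so it dominates a multiple of t^{-s} / max(1, M t)^2, while its primitive is explicit
    and at most M^{s-1}. *)
Definition mobpow (M t : R) : R := (1 - s) * (t / (1 + M * t)) `^ (- s) * (1 + M * t) ^- 2.
Let F (M t : R) : R := (t / (1 + M * t)) `^ (1 - s).

Let s1_ge0 : 0 <= 1 - s.
Proof. by case/andP: s01 => _ /ltW; rewrite subr_ge0. Qed.

Let is_derive_inv M t : 0 < M -> 0 < t ->
  is_derive t 1 (fun x => (1 + M * x)^-1) (- (1 + M * t) ^- 2 * M).
Proof.
move=> M0 t0; have q0 : 1 + M * t != 0 by rewrite gt_eqF// addr_gt0// mulr_gt0.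
have dl := derD (derC t 1) (derZ M (is_derive_id t 1)).
have := derV (f := fun x => 1 + M * x) q0 dl.
by move/der_eq; apply; rewrite add0r mulr1.
Qed.

Let is_derive_F M t : 0 < M -> 0 < t -> is_derive t 1 (F M) (mobpow M t).
Proof.
move=> M0 t0.
have q0 : 0 < 1 + M * t by rewrite addr_gt0// mulr_gt0.
have x0 : 0 < t / (1 + M * t) by rewrite divr_gt0.
have D1 : is_derive t 1 (fun t : R => t / (1 + M * t)) ((1 + M * t) ^- 2).
  have := derM (is_derive_id t 1) (is_derive_inv M0 t0).
  by move/der_eq; apply => /=; field; rewrite gt_eqF.
have D2 : is_derive (t / (1 + M * t)) 1 (fun x : R => x `^ (1 - s)) ((1 - s) * (t / (1 + M * t)) `^ (- s)).
  apply: DeriveDef.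
    by apply: derivable_powR; rewrite in_itv/= x0.
  rewrite -derive1E powR_derive1 ?in_itv/= ?x0//.
  by congr (_ * _ `^ _); ring.
exact: (der_comp (g := fun t => t / (1 + M * t)) D2 D1).
Qed.

Let f_cont M t : 0 < M -> 0 < t -> {for t, continuous (mobpow M)}.
Proof.
move=> M0 t0.
have q0 : 0 < 1 + M * t by rewrite addr_gt0// mulr_gt0.
have x0 : 0 < t / (1 + M * t) by rewrite divr_gt0.
have D2 : is_derive (t / (1 + M * t)) 1 (fun x : R => x `^ (- s)) ('D_1 (fun x : R => x `^ (- s)) (t / (1 + M * t))).
  by apply/derivableP/derivable_powR; rewrite in_itv/= x0.
have D3 := is_derive_inv M0 t0.
have D1 := derM (is_derive_id t 1) D3.
have -> : mobpow M = (fun t => ((1 - s) * (t / (1 + M * t)) `^ (- s)) * ((1 + M * t)^-1 * (1 + M * t)^-1)).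
  by apply/funext => x; rewrite /mobpow expr2 invfM.
have [+ _] := derM (derZ (1 - s) (der_comp (g := fun t => t / (1 + M * t)) D2 D1)) (derM D3 D3).
by move=> /derivable1_diffP/differentiable_continuous.
Qed.

Lemma mobpow_ge0 M t : 0 < M -> 0 <= mobpow M t.
Proof. by move=> M0; rewrite mulr_ge0 ?mulr_ge0 ?powR_ge0 ?invr_ge0 ?sqr_ge0. Qed.

Let F_le M t : 0 < M -> 0 < t -> F M t <= M `^ (s - 1).
Proof.
move=> M0 t0; have q0 : 0 < 1 + M * t by rewrite addr_gt0// mulr_gt0.
have -> : M `^ (s - 1) = M^-1 `^ (1 - s).
  rewrite -powR_inv1 ?(ltW M0)// -powRrM; congr (_ `^ _); ring.
apply: ge0_ler_powR; rewrite ?nnegrE ?invr_ge0 ?divr_ge0 ?(ltW q0) ?(ltW t0) ?(ltW M0)//.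
by rewrite ler_pdivrMr// -ler_pdivrMl ?invr_gt0// invrK lerDr.
Qed.

Let int_pos M e b : 0 < M -> 0 < e -> e < b ->
  (\int[mu]_(t in `[e, b]) (mobpow M t)%:E <= (M `^ (s - 1))%:E)%E.
Proof.
move=> M0 e0 eb.
have cF x : 0 < x -> {for x, continuous (F M)}.
  by move=> x0; apply/differentiable_continuous/derivable1_diffP; have [] := is_derive_F M0 x0.
rewrite (@continuous_FTC2 R _ (F M) e b eb).
- rewrite -EFinB lee_fin (le_trans _ (F_le M0 (lt_trans e0 eb)))// gerBl powR_ge0//.
- apply: continuous_in_subspaceT => x; rewrite inE/= in_itv/= => /andP[ex _].
  by apply: f_cont => //; rewrite (lt_le_trans e0).
- split.
  + move=> x; rewrite in_itv/= => /andP[ex _].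
    by have [] := is_derive_F M0 (lt_trans e0 ex).
  + by apply: cvg_at_right_filter; exact: cF.
  + by apply: cvg_at_left_filter; apply: cF; rewrite (lt_trans e0).
- move=> x; rewrite in_itv/= => /andP[ex _].
  by rewrite derive1E; have [_ ->] := is_derive_F M0 (lt_trans e0 ex).
Qed.

Let int_neg M e b : 0 < M -> 0 < e -> e < b ->
  (\int[mu]_(t in `[(- b)%R, (- e)%R]) (mobpow M `|t|)%:E <= (M `^ (s - 1))%:E)%E.
Proof.
move=> M0 e0 eb.
rewrite (integration_by_substitution_oppr (G := fun t => mobpow M `|t|)) ?(ltW eb)//.
  apply: le_trans _ (int_pos M0 e0 eb).
  rewrite le_eqVlt; apply/orP; left; apply/eqP; apply: eq_integral => t.
  rewrite inE/= in_itv/= => /andP[et _].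
  by rewrite normrN gtr0_norm// (lt_le_trans e0).
apply: continuous_in_subspaceT => x; rewrite inE/= in_itv/= => /andP[_ xe].
have x0 : 0 < `|x| by rewrite normr_gt0; lra.
apply: (@continuous_comp _ _ _ (fun x : R => `|x|) (mobpow M)); first exact: norm_continuous.
exact: f_cont.
Qed.

Lemma measurable_mobpow M : 0 < M -> measurable_fun [set: R] (fun t : R => mobpow M `|t|).
Proof.
move=> M0.
rewrite /mobpow.
have c1 : continuous (fun t : R => (1 + M * `|t|)^-1).
  move=> t; apply: cvgV.
    by rewrite gt_eqF// ltr_pwDl// mulr_ge0// ltW.
  by apply: cvgD; [exact: cvg_cst|apply: cvgM; [exact: cvg_cst|exact: cvg_norm]].
have m1 := continuous_measurable_fun c1.
apply: measurable_funM; last first.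
  have -> : (fun t : R => (1 + M * `|t|) ^- 2) = (fun t => (1 + M * `|t|)^-1 ^+ 2).
    by apply/funext => t; rewrite exprVn.
  exact: measurable_funX.
apply: measurable_funM; first exact: measurable_cst.
apply: (measurableT_comp (measurable_powR _)).
by apply: measurable_funM => //; exact: measurableT_comp.
Qed.

Lemma integral_power M : 0 < M ->
  (\int[mu]_(t in `[(- pi)%R, pi] `\ 0%R) (mobpow M `|t|)%:E <= (2 * M `^ (s - 1))%:E)%E.
Proof.
move=> M0; have p1 : 1 < pi :> R by have := @pihalf_ge1 R; lra.
have /measurable_EFinP mf := measurable_mobpow M0.
(* Compact sets exhausting [-pi, pi] minus 0: the fundamental theorem of calculus applies on each
   side of the singularity, and monotone convergence gives the limit. *)
pose G n : set R := `[(- pi)%R, (- (n.+1%:R)^-1)%R] `|` `[(n.+1%:R)^-1, pi].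
have e0 n : 0 < (n.+1%:R)^-1 :> R by rewrite invr_gt0 ltr0n.
have e1 n : (n.+1%:R)^-1 < pi :> R.
  by rewrite (le_lt_trans _ p1)// invf_le1// ?ltr0n// ler1n.
have GE : \bigcup_n G n = `[(- pi)%R, pi] `\ 0%R.
  apply/seteqP; split => [x [n _] [] /=|x [/=]]; rewrite ?in_itv/= => /andP[xa xb].
  - have x0 : x < 0 by rewrite (le_lt_trans xb)// oppr_lt0.
    split; first by rewrite xa ltW// (lt_trans x0)// pi_gt0.
    by move=> {}x0; move: xb; rewrite x0 leNgt oppr_lt0 e0.
  - have x0 : 0 < x by rewrite (lt_le_trans _ xa).
    split; first by rewrite xb andbT ltW// (lt_trans _ x0)// oppr_lt0 pi_gt0.
    by move=> {}x0; move: xa; rewrite x0 leNgt e0.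
  move=> /eqP x0; have ax : 0 < `|x| by rewrite normr_gt0.
  have [n xn] : exists n, (n.+1%:R)^-1 <= `|x|.
    exists (Num.truncn (`|x|^-1)).
    by rewrite -[leRHS]invrK lef_pV2 ?posrE ?invr_gt0// ltW// truncnS_gt.
  exists n => //; rewrite /G/= !in_itv/=.
  have [x00|x00] := leP 0 x.
    by right; rewrite xb andbT -(ger0_norm x00).
  by left; rewrite xa/= lerNr -(ltr0_norm x00).
rewrite -GE.
have mG n : measurable (G n) by apply: measurableU; exact: measurable_itv.
have cv : (\int[mu]_(x in G i) (mobpow M `|x|)%:E @[i --> \oo] -->
    \int[mu]_(x in \bigcup_i G i) (mobpow M `|x|)%:E)%E.
  apply: ge0_nondecreasing_set_cvg_integral => //.
  - move=> n m nm; apply/subsetPset => x.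
    have le : (m.+1%:R)^-1 <= (n.+1%:R)^-1 :> R.
      by rewrite lef_pV2 ?posrE ?ltr0n// ler_nat.
    rewrite /G /= !in_itv /= => -[/andP[a b]|/andP[a b]]; [left|right].
      by rewrite a (le_trans b)// lerN2.
    by rewrite b (le_trans le).
  - by move=> i; apply: measurable_funS mf.
  - by move=> i x _; rewrite lee_fin mobpow_ge0.
rewrite -(cvg_lim (@ereal_hausdorff R) cv).
apply: lime_le; first by apply/cvg_ex; eexists; exact: cv.
apply: nearW => n; rewrite ge0_integral_setU//.
- rewrite mulr_natl mulr2n EFinD; apply: leeD; first exact: int_neg.
  apply: le_trans _ (int_pos M0 (e0 n) (e1 n)).
  rewrite le_eqVlt; apply/orP; left; apply/eqP; apply: eq_integral => t.
  rewrite inE/= in_itv/= => /andP[a _]; rewrite ger0_norm//.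
  by rewrite (le_trans _ a)// ltW.
- exact: measurable_funS mf.
- by move=> x _; rewrite lee_fin mobpow_ge0.
- apply/disj_setPLR => x /=; rewrite !in_itv/= => /andP[_ a] /andP[b _].
  by have := le_trans b a; rewrite leNgt (lt_trans _ (e0 n))// oppr_lt0.
Qed.

End power_integral.

Section circle_weight.
Context {R : realType}.
Notation mu := (@lebesgue_measure R).
Implicit Types (s t : R).

(* |1 - e^{it}|^{-s}; at t = 0 this is 0 if s != 0. *)
Definition cweight s t : R := normc (1 - cis t) `^ (- s).

Lemma cweight_ge0 s t : 0 <= cweight s t.
Proof. exact: powR_ge0. Qed.

Lemma measurable_normc_1Bcis : measurable_fun [set: R] (fun t : R => normc (1 - cis t)).
Proof.
under eq_fun do rewrite normc_1Bcis.
apply: measurable_funM => //.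
apply: measurableT_comp => //; apply: measurableT_comp.
  exact: (continuous_measurable_fun (@continuous_sin R)).
exact: measurable_funM.
Qed.

Lemma measurable_cweight s : measurable_fun [set: R] (cweight s).
Proof. exact: (measurableT_comp (measurable_powR _) measurable_normc_1Bcis). Qed.

(** The square of [gauge] on the circle, without its factor (N+1)^{-2d}, times the weight; the
    applications take [s] to be 2d or 0. *)
Definition cgauge2 s N t : R := cweight s t / Num.max 1 (N.+1%:R * normc (1 - cis t)) ^+ 2.

Lemma measurable_cgauge2 s N : measurable_fun [set: R] (cgauge2 s N).
Proof.
apply: measurable_funM; first exact: measurable_cweight.
have -> : (fun t : R => (Num.max 1 (N.+1%:R * normc (1 - cis t)) ^+ 2)^-1) =
    (fun t => (Num.max 1 (N.+1%:R * normc (1 - cis t))) `^ (- 2%:R)).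
  apply/funext => t; rewrite powR_invn// le_max ler01//.
apply: (measurableT_comp (measurable_powR _)).
apply: measurable_maxr => //.
by apply: measurable_funM => //; exact: measurable_normc_1Bcis.
Qed.

Lemma cgauge2_ge0 s N t : 0 <= cgauge2 s N t.
Proof. by rewrite divr_ge0 ?cweight_ge0// sqr_ge0. Qed.

Lemma integral_cgauge2 s : 0 <= s < 1 -> exists C : R, 0 < C /\ forall N,
  (\int[mu]_(t in `[(- pi)%R, pi]) (cgauge2 s N t)%:E <= (C * N.+1%:R `^ (s - 1))%:E)%E.
Proof.
move=> s01; have [s0 s1] := andP s01.
have s1' : 0 < 1 - s by rewrite subr_gt0.
have c1 : 0 < 4 * 4 `^ s / (1 - s) :> R by rewrite divr_gt0// mulr_gt0// powR_gt0.
exists (4 * 4 `^ s / (1 - s) * (2 * 4^-1 `^ (s - 1))).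
split; first by rewrite mulr_gt0// mulr_gt0// powR_gt0.
(* The 1/4 is that of [normc_1Bcis_ge], so that M |t| <= (N + 1)|1 - e^{it}|. *)
move=> N; pose M : R := N.+1%:R * 4^-1.
have M0 : 0 < M by rewrite mulr_gt0// invr_gt0.
have If := integral_power s01 M0.
have mD : measurable (`[(- pi)%R, pi] : set R) by exact: measurable_itv.
have mg := measurable_cgauge2 s N.
have -> : (\int[mu]_(t in `[(- pi)%R, pi]) (cgauge2 s N t)%:E =
   \int[mu]_(t in `[(- pi)%R, pi] `\ 0%R) (cgauge2 s N t)%:E)%E.
  rewrite integral_setD1//; first exact: measurableD.
  by apply/measurable_EFinP; exact: measurable_funS mg.
apply: (@le_trans _ _ ((4 * 4 `^ s / (1 - s))%:E * (2 * M `^ (s - 1))%:E)%E); last first.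
  rewrite -EFinM lee_fin -!mulrA !ler_pM2l// ?powR_gt0 ?invr_gt0//.
  by rewrite powRM ?invr_ge0// mulrC.
apply: le_trans _ (lee_wpmul2l _ If); last by rewrite lee_fin ltW.
have mD0 : measurable (`[(- pi)%R, pi] `\ 0%R : set R) by exact: measurableD.
have mf := measurable_mobpow s M0.
rewrite -ge0_integralZl_EFin//; [|by move=> x _; rewrite lee_fin mobpow_ge0| |by rewrite ltW]; last first.
  by apply/measurable_EFinP; exact: measurable_funS mf.
apply: ge0_le_integral => //.
- by move=> x _; rewrite lee_fin cgauge2_ge0.
- by apply/measurable_EFinP; exact: measurable_funS mg.
- apply/measurable_EFinP; apply: measurable_funM => //; exact: measurable_funS mf.
move=> t [/= + /eqP t0]; rewrite in_itv/= => tpi; rewrite lee_fin.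
have at0 : 0 < `|t| by rewrite normr_gt0.
have rt := normc_1Bcis_ge tpi; set r := normc _ in rt.
have r0 : 0 < r by rewrite (lt_le_trans _ rt)// divr_gt0.
have MtE : M * `|t| <= N.+1%:R * r by rewrite /M mulrAC -mulrA ler_pM2l.
have q0 : 0 < 1 + M * `|t| by rewrite addr_gt0// mulr_gt0.
rewrite /cgauge2 /cweight -/r /mobpow.
have -> : 4 * 4 `^ s / (1 - s) * ((1 - s) * (`|t| / (1 + M * `|t|)) `^ (- s) / (1 + M * `|t|) ^+ 2)
  = (4 `^ s * (`|t| / (1 + M * `|t|)) `^ (- s)) * (4 / (1 + M * `|t|) ^+ 2).
  by field; rewrite !gt_eqF.
apply: ler_pM; rewrite ?powR_ge0 ?invr_ge0 ?sqr_ge0//.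
  have H : (`|t| / (1 + M * `|t|)) / 4 <= r.
    by rewrite (le_trans _ rt)// ler_pM2r// ler_pdivrMr// ler_peMr ?(ltW at0)// lerDl mulr_ge0 ?(ltW M0)//.
  have H0 : 0 < `|t| / (1 + M * `|t|) by rewrite divr_gt0.
  move: H H0; set y := `|t| / _ => H H0.
  have -> : 4 `^ s * y `^ (- s) = (y / 4) `^ (- s).
    rewrite [RHS]powRM ?(ltW H0) ?invr_ge0// [RHS]mulrC; congr (_ * _).
    by rewrite -powR_inv1// -powRrM mulN1r opprK.
  rewrite !powRN lef_pV2 ?posrE ?powR_gt0 ?divr_gt0//.
  by apply: ge0_ler_powR => //; rewrite nnegrE ltW// divr_gt0.
rewrite -[4]invrK -invfM lef_pV2 ?posrE ?exprn_gt0 ?lt_max ?ltr01// ?mulr_gt0 ?exprn_gt0 ?invr_gt0//.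
have -> : 4^-1 * (1 + M * `|t|) ^+ 2 = ((1 + M * `|t|) / 2) ^+ 2 by field.
rewrite lerXn2r ?nnegrE ?le_max ?ler01 ?divr_ge0 ?(ltW q0)//.
apply/orP; have [h|/ltW h] := leP (N.+1%:R * r) 1; [left|right].
  by rewrite ler_pdivrMr// mul1r [2]mulr2n lerD// (le_trans MtE).
by rewrite ler_pdivrMr// mulr_natr mulr2n lerD.
Qed.

End circle_weight.

Section circle_integral.
Context {R : realType}.
Notation mu := (@lebesgue_measure R).
Notation D := (`[(- pi)%R, pi%R]%classic : set R).
Implicit Types (s t : R) (h k r : R -> R) (f g : R -> R[i]).

Definition rint h : R := Rintegral mu D h.

Definition rintegrable h := mu.-integrable D (EFin \o h).

Let mD : measurable D.
Proof. exact: measurable_itv. Qed.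

Lemma rintegrable_le h k : measurable_fun [set: R] h ->
  (forall t, D t -> `|h t| <= k t) -> rintegrable k -> rintegrable h.
Proof.
move=> mh hk; apply: le_integrable => //.
  by apply/measurable_EFinP; exact: measurable_funS mh.
by move=> t Dt /=; rewrite lee_fin (le_trans (hk t Dt))// ler_norm.
Qed.

Lemma rintegrableD h k : rintegrable h -> rintegrable k -> rintegrable (fun t => h t + k t).
Proof. by move=> ih ik; apply: eq_integrable (integrableD _ ih ik) => //. Qed.

Lemma rintegrableZ a h : rintegrable h -> rintegrable (fun t => a * h t).
Proof. by move=> ih; apply: eq_integrable (integrableZl _ a ih) => //. Qed.

Lemma rintD h k : rintegrable h -> rintegrable k ->
  rint (fun t => h t + k t) = rint h + rint k.
Proof. exact: RintegralD. Qed.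

Lemma rintZ a h : rintegrable h -> rint (fun t => a * h t) = a * rint h.
Proof. exact: RintegralZl. Qed.

Lemma le_rint h k : rintegrable h -> rintegrable k ->
  (forall t, D t -> h t <= k t) -> rint h <= rint k.
Proof. exact: le_Rintegral. Qed.

Lemma rint_le_bound h (A : R) : rintegrable h ->
  (\int[mu]_(t in D) (h t)%:E <= A%:E)%E -> rint h <= A.
Proof.
move=> ih hA; rewrite -lee_fin /rint /Rintegral fineK//.
exact: integrable_fin_num.
Qed.

Lemma rintegrable_cgauge2 s N : 0 <= s < 1 -> rintegrable (cgauge2 s N).
Proof.
move=> s01; have [C [_ HC]] := integral_cgauge2 s01.
apply/integrableP; split.
  by apply/measurable_EFinP; exact: measurable_funS (measurable_cgauge2 s N).
under eq_integral do rewrite /= ger0_norm ?cgauge2_ge0//.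
by rewrite (le_lt_trans (HC N))// ltry.
Qed.

Lemma rint_cgauge2 s : 0 <= s < 1 -> exists C : R, 0 < C /\
  forall N, rint (cgauge2 s N) <= C * N.+1%:R `^ (s - 1).
Proof.
move=> s01; have [C [C0 HC]] := integral_cgauge2 s01; exists C; split => // N.
by apply: rint_le_bound => //; exact: rintegrable_cgauge2.
Qed.

(** For N = 0 the maximum in the denominator is at most 2, so integrability of the weight follows
    from that of [cgauge2]. *)
Lemma cweight_le_cgauge2 s t : cweight s t <= 4 * cgauge2 s 0 t.
Proof.
rewrite /cgauge2 mul1r mulrCA ler_peMr ?cweight_ge0//.
have h : 1 <= Num.max 1 (normc (1 - cis t)) by rewrite le_max lexx.
have h' : Num.max 1 (normc (1 - cis t)) <= 2.
  by rewrite ge_max normc_1Bcis_le2 andbT; lra.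
by rewrite ler_pdivlMr ?exprn_gt0 ?(lt_le_trans ltr01)// mul1r; nra.
Qed.

Lemma rintegrable_cweight s : 0 <= s < 1 -> rintegrable (cweight s).
Proof.
move=> s01; apply: (rintegrable_le (k := fun t => 4 * cgauge2 s 0 t)).
- exact: measurable_cweight.
- by move=> t _; rewrite ger0_norm ?cweight_ge0// cweight_le_cgauge2.
- exact/rintegrableZ/rintegrable_cgauge2.
Qed.

Definition bounded_measurable r := measurable_fun [set: R] r /\ exists C, forall t, `|r t| <= C.

Definition wint s r := rint (fun t => r t * cweight s t).

Section weight.
Variable s : R.
Hypothesis s01 : 0 <= s < 1.

Lemma wintegrable r : bounded_measurable r -> rintegrable (fun t => r t * cweight s t).
Proof.
move=> [mr [C rC]]; apply: (rintegrable_le (k := fun t => C * cweight s t)).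
- by apply: measurable_funM => //; exact: measurable_cweight.
- by move=> t _; rewrite normrM [X in _ * X]ger0_norm ?cweight_ge0// ler_wpM2r ?cweight_ge0.
- exact/rintegrableZ/rintegrable_cweight.
Qed.

Lemma bounded_measurableD h k : bounded_measurable h -> bounded_measurable k ->
  bounded_measurable (fun t => h t + k t).
Proof.
move=> [mh [A hA]] [mk [B kB]]; split; first exact: measurable_funD.
by exists (A + B) => t; rewrite (le_trans (ler_normD _ _))// lerD.
Qed.

Lemma bounded_measurableM h k : bounded_measurable h -> bounded_measurable k ->
  bounded_measurable (fun t => h t * k t).
Proof.
move=> [mh [A hA]] [mk [B kB]]; split; first exact: measurable_funM.
by exists (A * B) => t; rewrite normrM ler_pM.
Qed.

Lemma bounded_measurable_cst a : bounded_measurable (fun=> a : R).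
Proof. by split; [exact: measurable_cst|exists `|a|]. Qed.

Lemma wintD h k : bounded_measurable h -> bounded_measurable k ->
  wint s (fun t => h t + k t) = wint s h + wint s k.
Proof.
move=> bh bk; rewrite /wint -rintD; [|exact: wintegrable..].
by under eq_fun do rewrite mulrDl.
Qed.

Lemma wintZ a h : bounded_measurable h -> wint s (fun t => a * h t) = a * wint s h.
Proof.
move=> bh; rewrite /wint -rintZ; last exact: wintegrable.
by under eq_fun do rewrite -mulrA.
Qed.

Lemma le_wint h k : bounded_measurable h -> bounded_measurable k ->
  (forall t, h t <= k t) -> wint s h <= wint s k.
Proof.
move=> bh bk hk; apply: le_rint; [exact: wintegrable..|] => t _.
by rewrite ler_wpM2r ?cweight_ge0.
Qed.

End weight.

Definition cbounded f := bounded_measurable (fun t => complex.Re (f t)) /\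
  bounded_measurable (fun t => complex.Im (f t)).

Lemma cboundedP f : cmeasurable f -> (exists C, forall t, normc (f t) <= C) -> cbounded f.
Proof.
move=> [m1 m2] [C fC]; split; split => //; exists C => t.
  by rewrite (le_trans (ler_abs_Re _)).
by rewrite (le_trans (ler_abs_Im _)).
Qed.

Lemma cbounded_ex f : cbounded f -> exists C, forall t, normc (f t) <= C.
Proof.
move=> [[_ [A fA]] [_ [B fB]]]; exists (A + B) => t.
by rewrite (le_trans (normc_le_ReIm _))// lerD.
Qed.

Lemma cbounded_cst c : cbounded (fun=> c).
Proof. by split; exact: bounded_measurable_cst. Qed.

Lemma cboundedD f g : cbounded f -> cbounded g -> cbounded (fun t => f t + g t).
Proof.
by move=> [f1 f2] [g1 g2]; split; under eq_fun do rewrite raddfD/=; exact: bounded_measurableD.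
Qed.

Lemma cboundedM f g : cbounded f -> cbounded g -> cbounded (fun t => f t * g t).
Proof.
move=> [f1 f2] [g1 g2]; split.
  under eq_fun do rewrite Rec_mul -mulN1r.
  apply: bounded_measurableD; first exact: bounded_measurableM.
  by apply: bounded_measurableM; [exact: bounded_measurable_cst|exact: bounded_measurableM].
under eq_fun do rewrite Imc_mul.
by apply: bounded_measurableD; exact: bounded_measurableM.
Qed.

Lemma cboundedN f : cbounded f -> cbounded (fun t => - f t).
Proof.
move=> cf; under eq_fun do rewrite -mulN1r.
by apply: cboundedM => //; exact: cbounded_cst.
Qed.

Lemma cboundedB f g : cbounded f -> cbounded g -> cbounded (fun t => f t - g t).
Proof. by move=> cf cg; apply: cboundedD => //; exact: cboundedN. Qed.

Lemma cboundedJ f : cbounded f -> cbounded (fun t => (f t)^J).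
Proof.
move=> [f1 f2]; split.
  by rewrite (_ : (fun t => _) = fun t => complex.Re (f t))//; apply/funext => t; case: (f t).
rewrite (_ : (fun t => _) = fun t => -1 * complex.Im (f t)).
  by apply: bounded_measurableM => //; exact: bounded_measurable_cst.
by apply/funext => t; rewrite mulN1r; case: (f t).
Qed.

Lemma cbounded_sum (I : Type) (l : seq I) (P : pred I) (F : I -> R -> R[i]) :
  (forall i, cbounded (F i)) -> cbounded (fun t => \sum_(i <- l | P i) F i t).
Proof.
move=> H; elim: l => [|i l IH].
  by under eq_fun do rewrite big_nil; exact: cbounded_cst.
under eq_fun do rewrite big_cons.
by case: (P i) => //; exact: cboundedD.
Qed.

Lemma cbounded_normc f : cbounded f -> bounded_measurable (fun t => normc (f t)).
Proof.
move=> cf; split; last first.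
  have [C HC] := cbounded_ex cf; exists C => t; by rewrite ger0_norm ?normc_ge0.
have -> : (fun t => normc (f t)) = (fun t => Num.sqrt (complex.Re (f t) ^+ 2 + complex.Im (f t) ^+ 2)).
  by apply/funext => t; case: (f t).
case: cf => [[m1 _] [m2 _]].
apply: (@measurableT_comp _ _ _ _ _ _ (@Num.sqrt R)).
  exact: (continuous_measurable_fun (@sqrt_continuous R)).
by apply: measurable_funD; exact: measurable_funX.
Qed.

Lemma cbounded_real r : bounded_measurable r -> cbounded (fun t => (r t)%:C).
Proof. by move=> br; split => //=; exact: bounded_measurable_cst. Qed.

Lemma cbounded_lim (F : nat -> R -> R[i]) f : (forall n, cbounded (F n)) ->
  (forall t, ccvg (F^~ t) (f t)) -> (exists C, forall t, normc (f t) <= C) -> cbounded f.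
Proof.
move=> bF Ff fC; apply: cboundedP => //; split.
  apply: (@measurable_fun_cvg _ _ _ _ (fun n t => complex.Re (F n t))).
    by move=> n; have [[]] := bF n.
  move=> t _; apply/cvgrPdist_lt => e e0; have [N HN] := Ff t e e0.
  exists N => // n /= Nn; rewrite distrC -raddfB/=.
  by rewrite (le_lt_trans (ler_abs_Re _))// HN.
apply: (@measurable_fun_cvg _ _ _ _ (fun n t => complex.Im (F n t))).
  by move=> n; have [_ []] := bF n.
move=> t _; apply/cvgrPdist_lt => e e0; have [N HN] := Ff t e e0.
exists N => // n /= Nn; rewrite distrC -raddfB/=.
by rewrite (le_lt_trans (ler_abs_Im _))// HN.
Qed.

(** [s = 0] gives the plain integral, and [s = 2 * d] the one against the singular factor of the
    density; neither carries the 1 / (2 pi). *)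
Definition wcint s f : R[i] :=
  cintegral mu D (fun t => f t * (cweight s t)%:C).

Lemma wcintE s f : wcint s f =
  (wint s (fun t => complex.Re (f t)) +i* wint s (fun t => complex.Im (f t))).
Proof.
by rewrite /wcint /cintegral /wint /rint; congr Complex;
  apply: eq_Rintegral => t _; case: (f t) => a b /=; ring.
Qed.

Section cweight.
Variable s : R.
Hypothesis s01 : 0 <= s < 1.

Lemma wcintD f g : cbounded f -> cbounded g ->
  wcint s (fun t => f t + g t) = wcint s f + wcint s g.
Proof.
move=> [f1 f2] [g1 g2]; rewrite !wcintE; apply: complex_eqP => /=.
  by rewrite -wintD//; congr wint; apply/funext => t; rewrite raddfD.
by rewrite -wintD//; congr wint; apply/funext => t; rewrite raddfD.
Qed.

Lemma wcintZ c f : cbounded f -> wcint s (fun t => c * f t) = c * wcint s f.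
Proof.
move=> [f1 f2]; rewrite !wcintE; apply: complex_eqP => /=; rewrite ?Rec_mul ?Imc_mul/=.
  rewrite -mulNr -!wintZ// -wintD//.
    by congr wint; apply/funext => t; rewrite Rec_mul mulNr.
  by apply: bounded_measurableM => //; exact: bounded_measurable_cst.
  by apply: bounded_measurableM => //; exact: bounded_measurable_cst.
rewrite -!wintZ// -wintD//.
  by congr wint; apply/funext => t; rewrite Imc_mul.
by apply: bounded_measurableM => //; exact: bounded_measurable_cst.
by apply: bounded_measurableM => //; exact: bounded_measurable_cst.
Qed.

Lemma wcintB f g : cbounded f -> cbounded g ->
  wcint s (fun t => f t - g t) = wcint s f - wcint s g.
Proof.
move=> bf bg; rewrite -[- wcint s g]mulN1r -wcintZ// -wcintD//.
  by congr wcint; apply/funext => t; rewrite mulN1r.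
by apply: cboundedM => //; exact: cbounded_cst.
Qed.

Lemma wcint0 : wcint s (fun=> 0) = 0.
Proof.
rewrite -[RHS](mul0r (wcint s (fun=> 0))) -wcintZ; last exact: cbounded_cst.
by congr wcint; apply/funext => t; rewrite mul0r.
Qed.

Lemma wcint_sum (I : Type) (l : seq I) (P : pred I) (F : I -> R -> R[i]) :
  (forall i, cbounded (F i)) ->
  wcint s (fun t => \sum_(i <- l | P i) F i t) = \sum_(i <- l | P i) wcint s (F i).
Proof.
move=> H; elim: l => [|i l IH].
  rewrite big_nil -[RHS]wcint0; congr wcint; apply/funext => t; exact: big_nil.
rewrite big_cons -IH; case: ifPn => Pi.
  rewrite -wcintD//; last exact: cbounded_sum.
  by congr wcint; apply/funext => t; rewrite big_cons Pi.
by congr wcint; apply/funext => t; rewrite big_cons (negbTE Pi).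
Qed.

Lemma wcintJ f : cbounded f -> wcint s (fun t => (f t)^J) = (wcint s f)^J.
Proof.
move=> [f1 f2]; rewrite !wcintE; apply: complex_eqP => /=.
  by congr wint; apply/funext => t; case: (f t).
rewrite -mulN1r -wintZ//.
by congr wint; apply/funext => t; rewrite mulN1r; case: (f t).
Qed.

Lemma wcint_real r : wcint s (fun t => (r t)%:C) = (wint s r)%:C.
Proof.
rewrite wcintE /=; congr Complex; rewrite /wint /rint.
rewrite (_ : (fun t => _) = fun=> 0); first by rewrite Rintegral_cst// mul0r.
by apply/funext => t /=; rewrite mul0r.
Qed.

Lemma normc_wcint f r : cbounded f -> bounded_measurable r ->
  (forall t, normc (f t) <= r t) -> normc (wcint s f) <= 2 * wint s r.
Proof.
have H h : bounded_measurable h -> bounded_measurable r ->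
    (forall t, `|h t| <= r t) -> `|wint s h| <= wint s r.
  move=> bh br hr; rewrite ler_norml; apply/andP; split.
    rewrite -mulN1r -wintZ//; apply: le_wint => //.
      by apply: bounded_measurableM => //; exact: bounded_measurable_cst.
    by move=> t; rewrite mulN1r lerNl (le_trans _ (hr t))// -normrN ler_norm.
  by apply: le_wint => // t; rewrite (le_trans _ (hr t))// ler_norm.
move=> [f1 f2] br fr; rewrite (le_trans (normc_le_ReIm _))// mulr_natl mulr2n.
rewrite wcintE/= lerD// H// => t; rewrite (le_trans _ (fr t))//.
  exact: ler_abs_Re.
exact: ler_abs_Im.
Qed.

Lemma wint_ge0 r : bounded_measurable r -> (forall t, 0 <= r t) -> 0 <= wint s r.
Proof.
by move=> br r0; apply: Rintegral_ge0 => t _; rewrite mulr_ge0// cweight_ge0.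
Qed.

(* AM-GM with the weights that balance A and B *)
Lemma wcint_cauchy f h k (A B : R) : cbounded f -> bounded_measurable h -> bounded_measurable k ->
  (forall t, normc (f t) <= h t * k t) -> 0 < A -> 0 < B ->
  wint s (fun t => h t ^+ 2) <= A -> wint s (fun t => k t ^+ 2) <= B ->
  normc (wcint s f) <= 2 * Num.sqrt (A * B).
Proof.
move=> bf bh bk fhk A0 B0 hA kB.
pose l := Num.sqrt (B / A).
have BA0 : 0 < B / A by rewrite divr_gt0.
have l0 : 0 < l by rewrite sqrtr_gt0.
have l2 : l ^+ 2 = B / A by rewrite sqr_sqrtr// ltW.
have bh2 : bounded_measurable (fun t => h t ^+ 2) by under eq_fun do rewrite expr2; exact: bounded_measurableM.
have bk2 : bounded_measurable (fun t => k t ^+ 2) by under eq_fun do rewrite expr2; exact: bounded_measurableM.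
have bZ a r : bounded_measurable r -> bounded_measurable (fun t => a * r t).
  by move=> br; apply: bounded_measurableM => //; exact: bounded_measurable_cst.
have br : bounded_measurable (fun t => l / 2 * h t ^+ 2 + (l^-1 / 2) * k t ^+ 2).
  by apply: bounded_measurableD; exact: bZ.
apply: (le_trans (normc_wcint bf br _)).
  move=> t; rewrite (le_trans (fhk t))// -subr_ge0.
  have -> : l / 2 * h t ^+ 2 + l^-1 / 2 * k t ^+ 2 - h t * k t = (l * h t - k t) ^+ 2 / (2 * l).
    by field; rewrite gt_eqF.
  by rewrite divr_ge0 ?sqr_ge0// mulr_ge0// ltW.
rewrite ler_pM2l// wintD ?wintZ//; [|exact: bZ..].
apply: (@le_trans _ _ (l / 2 * A + l^-1 / 2 * B)).
  by rewrite lerD// ler_wpM2l// divr_ge0// ?invr_ge0 ltW.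
have E : Num.sqrt (A * B) = l * A.
  have -> : A * B = (l * A) ^+ 2 by rewrite exprMn l2; field; rewrite gt_eqF.
  by rewrite sqrtr_sqr gtr0_norm// mulr_gt0.
rewrite E; have -> : l^-1 / 2 * B = l / 2 * A.
  have -> : B = l ^+ 2 * A by rewrite l2; field; rewrite gt_eqF.
  by field; rewrite gt_eqF.
lra.
Qed.

End cweight.

End circle_integral.

(** * Fourier coefficients *)

Section fourier.
Context {R : realType}.
Notation mu := (@lebesgue_measure R).
Notation D := (`[(- pi)%R, pi%R]%classic : set R).
Implicit Types (s t : R) (e : nat -> R[i]) (f g E : R -> R[i]) (i j : int).

Definition zpow j t : R[i] := cis (j%:~R * t).

Lemma zpowD i j t : zpow (i + j) t = zpow i t * zpow j t.
Proof. by rewrite /zpow -cisD -mulrDl intrD. Qed.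

Lemma zpowN j t : zpow (- j) t = (zpow j t)^J.
Proof. by rewrite /zpow -cisN mulrNz mulNr. Qed.

Lemma zpow0 t : zpow 0 t = 1.
Proof. by rewrite /zpow mul0r cis0. Qed.

Lemma cis_expr t n : cis t ^+ n = zpow n%:Z t.
Proof.
elim: n => [|n IH]; first by rewrite expr0 zpow0.
by rewrite exprS IH -[n.+1]add1n PoszD zpowD [zpow 1 t]/zpow mul1r.
Qed.

Lemma normc_zpow j t : normc (zpow j t) = 1.
Proof. exact: normc_cis. Qed.

Lemma cbounded_zpow j : cbounded (zpow j).
Proof.
apply: cboundedP; last by exists 1 => t; rewrite normc_zpow.
split => /=.
  apply: (@measurableT_comp _ _ _ _ _ _ (@cos R)).
    exact: (continuous_measurable_fun (@continuous_cos R)).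
  exact: measurable_funM.
apply: (@measurableT_comp _ _ _ _ _ _ (@sin R)).
  exact: (continuous_measurable_fun (@continuous_sin R)).
exact: measurable_funM.
Qed.

Lemma cbounded_psum e n : cbounded (fun t => psum e (cis t) n).
Proof.
rewrite /psum; apply: (@cbounded_sum _ _ _ _ (fun (k : 'I_n) t => e k * cis t ^+ k)) => k.
apply: cboundedM; first exact: cbounded_cst.
by under eq_fun do rewrite cis_expr; exact: cbounded_zpow.
Qed.

Lemma cweight0 t : cweight 0 t = 1.
Proof. by rewrite /cweight oppr0 powRr0. Qed.

Let zero01 : 0 <= (0 : R) < 1.
Proof. by rewrite lexx ltr01. Qed.

Lemma wcint_zpow j : wcint 0 (zpow j) = if j == 0 then (2 * pi)%:C else 0.
Proof.
have [->|j0] := eqVneq j 0.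
  have -> : zpow 0 = fun=> (1%R)%:C by apply/funext => t; exact: zpow0.
  rewrite wcint_real /wint /rint; congr (_%:C).
  under eq_Rintegral do rewrite cweight0 mulr1.
  rewrite Rintegral_cst// mul1r.
  have := @lebesgue_measure_itv R `[(- pi)%R, pi%R].
  by rewrite /= lte_fin gtrN ?pi_gt0// => ->; rewrite -EFinB/=; ring.
have jR : j%:~R != 0 :> R by rewrite intr_eq0.
have H (F F' : R -> R) : (forall t, is_derive t 1 F (F' t)) -> continuous F' ->
    F (- pi) = F pi -> rint (fun t => F' t * cweight 0 t) = 0.
  move=> dF cF' Fpi.
  have pp : - pi < pi :> R by have := @pi_gt0 R; lra.
  have cF : continuous F.
    by move=> x; apply/differentiable_continuous/derivable1_diffP; case: (dF x).
  rewrite /rint; under eq_Rintegral do rewrite cweight0 mulr1.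
  rewrite /Rintegral (continuous_FTC2 (F := F) pp).
  - by rewrite Fpi -EFinB/= subrr.
  - exact: continuous_subspaceT.
  - split; [by move=> x _; case: (dF x)|apply: cvg_at_right_filter; exact: cF|apply: cvg_at_left_filter; exact: cF].
  - by move=> x _; rewrite derive1E; case: (dF x).
have dl t : is_derive t 1 (fun t => j%:~R * t : R) j%:~R.
  by have := derZ (j%:~R) (is_derive_id t 1); rewrite mulr1.
have sinj : sin (j%:~R * pi) = 0 :> R.
  have sn (n : nat) : sin (n%:R * pi) = 0 :> R.
    elim: n => [|n IH]; first by rewrite mul0r sin0.
    by rewrite -natr1 mulrDl mul1r sinDpi IH oppr0.
  case: (j) => n; first exact: sn.
  by rewrite NegzE mulrNz mulNr sinN (sn n.+1) oppr0.
rewrite wcintE; apply: complex_eqP => /=.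
  apply: (H (fun t => (j%:~R)^-1 * sin (j%:~R * t))).
  - move=> t; apply: (der_eq (derZ _ (der_comp (is_derive_sin _) (dl t)))).
    by field.
  - move=> t; apply: continuous_comp; last exact: continuous_cos.
    by apply: cvgM; [exact: cvg_cst|exact: cvg_id].
  - by rewrite mulrN sinN sinj oppr0.
apply: (H (fun t => - (j%:~R)^-1 * cos (j%:~R * t))).
- move=> t; apply: (der_eq (derZ _ (der_comp (is_derive_cos _) (dl t)))).
  by field.
- move=> t; apply: continuous_comp; last exact: continuous_sin.
  by apply: cvgM; [exact: cvg_cst|exact: cvg_id].
- by rewrite mulrN cosN.
Qed.

(** Uniform convergence lets a series be integrated term by term against the weight, of which only
    the total mass then matters. *)
Definition usum e E := forall eps : R, 0 < eps -> exists N, forall n, (N <= n)%N ->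
  forall t, normc (psum e (cis t) n - E t) < eps.

Lemma usum_ccvg e E t : usum e E -> ccvg (psum e (cis t)) (E t).
Proof. by move=> H eps /H[N HN]; exists N => n Nn; exact: HN. Qed.

Lemma usum_cbounded e E : usum e E -> cbounded E.
Proof.
move=> eE; apply: (cbounded_lim (F := fun n t => psum e (cis t) n)).
- by move=> n; exact: cbounded_psum.
- by move=> t; exact: usum_ccvg.
have [N /(_ N (leqnn N)) HN] := eE 1 ltr01.
have [C HC] := cbounded_ex (cbounded_psum e N); exists (C + 1) => t.
have -> : E t = psum e (cis t) N - (psum e (cis t) N - E t) by ring.
by rewrite (le_trans (le_normcB _ _))// lerD// ltW.
Qed.

Lemma geometric_tail e (l : R[i]) (C rho : R) t n : 0 < rho < 1 ->
  (forall k, normc (e k) <= C * rho ^+ k) -> ccvg (psum e (cis t)) l ->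
  normc (l - psum e (cis t) n) <= C * rho ^+ n / (1 - rho).
Proof.
move=> /andP[r0 r1] eC ce.
have C0 : 0 <= C by have := le_trans (normc_ge0 _) (eC 0%N); rewrite expr0 mulr1.
have q0 : 0 < 1 - rho by rewrite subr_gt0.
apply: (ccvg_le (N := n) ce) => m nm.
rewrite psumB// (le_trans (normc_sum _ _ _))//.
apply: (@le_trans _ _ (\sum_(n <= k < m) C * rho ^+ k)).
  by apply: ler_sum => k _; rewrite normcM normcX normc_cis expr1n mulr1.
rewrite ler_pdivlMr// -(subnKC nm); elim: (m - n)%N => [|p IH].
  by rewrite addn0 big_geq// mul0r mulr_ge0// exprn_ge0// ltW.
rewrite addnS big_nat_recr ?leq_addr//=.
suff : (\sum_(n <= i < n + p) C * rho ^+ i) * (1 - rho) <= C * rho ^+ n - C * rho ^+ (n + p).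
  move=> H; rewrite mulrDl (le_trans (lerD H (lexx _)))// -addrA gerDl.
  rewrite mulrBr mulr1 addrA addNr add0r oppr_le0 !mulr_ge0// ?exprn_ge0// ltW//.
elim: p {IH} => [|p IH]; first by rewrite addn0 big_geq// mul0r subrr.
rewrite addnS big_nat_recr ?leq_addr//= mulrDl (le_trans (lerD IH (lexx _)))//.
by rewrite exprS le_eqVlt; apply/orP; left; apply/eqP; ring.
Qed.

Lemma usum_geometric e E (C rho : R) : 0 < rho < 1 ->
  (forall k, normc (e k) <= C * rho ^+ k) ->
  (forall t, ccvg (psum e (cis t)) (E t)) -> usum e E.
Proof.
move=> r01 eC ce eps eps0; have [r0 r1] := andP r01.
have C0 : 0 <= C by have := le_trans (normc_ge0 _) (eC 0%N); rewrite expr0 mulr1.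
have q0 : 0 < 1 - rho by rewrite subr_gt0.
have K0 : 0 < (C + 1) / (1 - rho) by rewrite divr_gt0// ltr_wpDl.
have r01' : 0 <= rho < 1 by rewrite ltW.
have [N HN] := expr_lt_eps r01' (divr_gt0 eps0 K0); exists N => n Nn t.
rewrite normcBC (le_lt_trans (geometric_tail n r01 eC (ce t)))//.
apply: (@le_lt_trans _ _ (rho ^+ n * ((C + 1) / (1 - rho)))).
  rewrite mulrA ler_pM2r ?invr_gt0// mulrC ler_wpM2l ?exprn_ge0 ?(ltW r0)//.
  by rewrite lerDl.
by rewrite -ltr_pdivlMr// HN.
Qed.

Section series.
Variable s : R.
Hypothesis s01 : 0 <= s < 1.

Lemma wint_cweight_ge0 : 0 <= wint s (fun=> 1).
Proof. by apply: wint_ge0 => //; exact: bounded_measurable_cst. Qed.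

Lemma wcint_series e E f : usum e E -> cbounded f ->
  ccvg (fun N => \sum_(k < N) e k * wcint s (fun t => zpow k%:Z t * f t))
    (wcint s (fun t => E t * f t)).
Proof.
move=> eE bf eps eps0; have bE := usum_cbounded eE.
have [M HM] := cbounded_ex bf.
have M0 : 0 <= M by rewrite (le_trans _ (HM 0))// normc_ge0.
have w0 := wint_cweight_ge0.
pose K := 2 * (M * wint s (fun=> 1)) + 1.
have K0 : 0 < K by rewrite ltr_wpDl// mulr_ge0// mulr_ge0.
have [N HN] := eE _ (divr_gt0 eps0 K0); exists N => n Nn.
have E1 : \sum_(k < n) e k * wcint s (fun t => zpow k%:Z t * f t) =
    wcint s (fun t => psum e (cis t) n * f t).
  have bk (k : nat) : cbounded (fun t => zpow k%:Z t * f t).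
    by apply: cboundedM => //; exact: cbounded_zpow.
  rewrite (eq_bigr (fun k : 'I_n => wcint s (fun t => e k * (zpow k%:Z t * f t)))); last first.
    by move=> k _; rewrite wcintZ.
  rewrite -(@wcint_sum R s s01 _ _ _ (fun (k : 'I_n) t => e k * (zpow k%:Z t * f t))); last first.
    by move=> k; apply: cboundedM => //; exact: cbounded_cst.
  congr wcint; apply/funext => t; rewrite /psum mulr_suml.
  by apply: eq_bigr => k _; rewrite cis_expr mulrA.
rewrite E1 -wcintB//; [|by apply: cboundedM => //; exact: cbounded_psum|exact: cboundedM].
apply: (@le_lt_trans _ _ (2 * wint s (fun=> (eps / K * M) * 1))).
  apply: normc_wcint => //.
  - by apply: cboundedB; apply: cboundedM => //; exact: cbounded_psum.
  - exact: bounded_measurable_cst.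
  by move=> t; rewrite -mulrBl normcM mulr1 ler_pM ?normc_ge0// ltW// HN.
rewrite (wintZ s01 _ (bounded_measurable_cst 1)).
have -> : 2 * (eps / K * M * wint s (fun=> 1)) = eps / K * (K - 1) by rewrite /K; ring.
by rewrite mulrBr mulr1 mulfVK ?gt_eqF// ltrBlDr ltrDl divr_gt0.
Qed.

End series.

Lemma fourier_coef e E j : usum e E ->
  wcint 0 (fun t => E t * zpow (- j) t) = if j is Posz n then (2 * pi)%:C * e n else 0.
Proof.
move=> eE; have cv := wcint_series zero01 eE (cbounded_zpow (- j)).
apply: (ccvg_unique cv) => eps eps0.
have H (k : nat) : wcint 0 (fun t => zpow k%:Z t * zpow (- j) t) =
    if k%:Z == j then (2 * pi)%:C else 0.
  by under eq_fun do rewrite -zpowD; rewrite wcint_zpow subr_eq0.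
case: j H cv => [m|m] H cv; last first.
  by exists 0%N => n _; rewrite big1 ?subrr ?normc0// => k _; rewrite H mulr0.
exists m.+1 => n mn; rewrite (bigD1 (Ordinal mn))//= H eqxx big1.
  by rewrite addr0 mulrC subrr normc0.
move=> k km; rewrite H eqz_nat -[m]/(val (Ordinal mn)) (inj_eq val_inj).
by rewrite (negbTE km) mulr0.
Qed.

Lemma fourier_coefM e E e' E' (n : nat) : usum e E -> usum e' E' ->
  wcint 0 (fun t => E' t * E t * zpow (- n%:Z) t) =
    (2 * pi)%:C * \sum_(k < n.+1) e' k * e (n - k)%N.
Proof.
move=> eE eE'; have bE := usum_cbounded eE.
have bf : cbounded (fun t => E t * zpow (- n%:Z) t).
  by apply: cboundedM => //; exact: cbounded_zpow.
have cv := wcint_series zero01 eE' bf.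
have -> : wcint 0 (fun t => E' t * E t * zpow (- n%:Z) t) =
   wcint 0 (fun t => E' t * (E t * zpow (- n%:Z) t)).
  by congr wcint; apply/funext => t; rewrite mulrA.
apply: (ccvg_unique cv) => eps eps0; exists n.+1 => m nm.
have H (k : nat) : wcint 0 (fun t => zpow k%:Z t * (E t * zpow (- n%:Z) t)) =
    if (k <= n)%N then (2 * pi)%:C * e (n - k)%N else 0.
  have -> : (fun t => zpow k%:Z t * (E t * zpow (- n%:Z) t)) =
      (fun t => E t * zpow (- (n%:Z - k%:Z)) t).
    by apply/funext => t; rewrite opprB zpowD; ring.
  rewrite (fourier_coef _ eE); case: leqP => kn; first by rewrite subzn.
  by have -> : n%:Z - k%:Z = Negz (k - n).-1 by lia.
rewrite -(big_mkord xpredT (fun k => e' k * wcint 0 (fun t => zpow k%:Z t * (E t * zpow (- n%:Z) t)))).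
rewrite (big_cat_nat (leq0n _) nm)/= big_mkord.
rewrite [X in _ + X - _]big_nat [X in _ + X - _]big1 ?addr0; last first.
  by move=> k /andP[nk _]; rewrite H leqNgt nk mulr0.
rewrite mulr_sumr (eq_bigr (fun k : 'I_n.+1 => (2 * pi)%:C * (e' k * e (n - k)%N))) ?subrr ?normc0//.
by move=> k _; rewrite H -ltnS ltn_ord mulrCA.
Qed.

End fourier.

(** * Windows of vanishing frequencies under multiplication *)

Section spectrum.
Context {R : realType}.
Variable s : R.
Hypothesis s01 : 0 <= s < 1.
Implicit Types (H F G : R -> R[i]) (a b k lo hi : int).

Definition ann H a b := forall k, a <= k <= b -> wcint s (fun t => H t * zpow (- k) t) = 0.

(* The product with F shifts frequencies by at least lo and at most hi. *)
Definition spec lo hi F := cbounded F /\ forall H a b, cbounded H ->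
  ann H a b -> ann (fun t => H t * F t) (a + hi) (b + lo).

Lemma spec_cbounded lo hi F : spec lo hi F -> cbounded F.
Proof. by case. Qed.

Lemma spec_widen lo hi lo' hi' F : lo' <= lo -> hi <= hi' -> spec lo hi F -> spec lo' hi' F.
Proof.
move=> l h [bF sF]; split => // H a b bH aH k /andP[k1 k2].
by apply: (sF H a b bH aH); apply/andP; split; lia.
Qed.

(** Immediate because [spec] speaks of the action on every window of vanishing coefficients: two
    multiplications compose, without Fourier expansion of F or G. *)
Lemma specM lo hi lo' hi' F G : spec lo hi F -> spec lo' hi' G ->
  spec (lo + lo') (hi + hi') (fun t => F t * G t).
Proof.
move=> [bF sF] [bG sG]; split; first exact: cboundedM.
move=> H a b bH aH k kk.
have := sG _ _ _ (cboundedM bH bF) (sF _ _ _ bH aH) k.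
rewrite -!addrA => /(_ kk) <-.
by congr wcint; apply/funext => t; rewrite !mulrA.
Qed.

Lemma specD lo hi F G : spec lo hi F -> spec lo hi G -> spec lo hi (fun t => F t + G t).
Proof.
move=> [bF sF] [bG sG]; split; first exact: cboundedD.
move=> H a b bH aH k kk.
have bz := cbounded_zpow (- k) : cbounded (zpow (- k) : R -> R[i]).
under eq_fun do rewrite mulrDr mulrDl.
rewrite wcintD//; last first.
- by apply: cboundedM => //; exact: cboundedM.
- by apply: cboundedM => //; exact: cboundedM.
by rewrite (sF _ _ _ bH aH k kk) (sG _ _ _ bH aH k kk) addr0.
Qed.

Lemma specZ lo hi c F : spec lo hi F -> spec lo hi (fun t => c * F t).
Proof.
move=> [bF sF]; have bc := cbounded_cst c; split; first exact: cboundedM.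
move=> H a b bH aH k kk.
have bz := cbounded_zpow (- k) : cbounded (zpow (- k) : R -> R[i]).
have -> : (fun t => H t * (c * F t) * zpow (- k) t) = fun t => c * (H t * F t * zpow (- k) t).
  by apply/funext => t; ring.
rewrite wcintZ//; last by apply: cboundedM => //; exact: cboundedM.
by rewrite (sF _ _ _ bH aH k kk) mulr0.
Qed.

Lemma spec0 lo hi : spec lo hi (fun=> 0).
Proof.
split; first exact: cbounded_cst.
move=> H a b bH aH k kk; under eq_fun do rewrite mulr0 mul0r.
exact: wcint0.
Qed.

Lemma spec_sum lo hi (I : Type) (l : seq I) (P : pred I) (F : I -> R -> R[i]) :
  (forall i, P i -> spec lo hi (F i)) -> spec lo hi (fun t => \sum_(i <- l | P i) F i t).
Proof.
move=> HF; elim: l => [|i l IH].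
  by under eq_fun do rewrite big_nil; exact: spec0.
under eq_fun do rewrite big_cons.
by case: (boolP (P i)) => // Pi; apply: specD => //; exact: HF.
Qed.

Lemma spec_zpow m : spec m m (zpow m).
Proof.
split; first exact: cbounded_zpow.
move=> H a b bH aH k /andP[k1 k2].
rewrite -(aH (k - m)); last by apply/andP; split; lia.
by congr wcint; apply/funext => t; rewrite -mulrA -zpowD; congr (_ * zpow _ _); ring.
Qed.

Lemma spec_psum e (lo hi : nat) : (forall k : nat, (k < lo)%N -> e k = 0) ->
  spec lo%:Z hi%:Z (fun t => psum e (cis t) hi.+1).
Proof.
move=> e0; rewrite /psum; apply: (@spec_sum _ _ _ _ _ (fun (k : 'I_hi.+1) t => e k * cis t ^+ k)) => k _.
under eq_fun do rewrite cis_expr.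
have [kl|lk] := ltnP k lo.
  by under eq_fun do rewrite e0// mul0r; exact: spec0.
apply: specZ; apply: spec_widen (spec_zpow k) => //.
by rewrite lez_nat -ltnS ltn_ord.
Qed.

Lemma spec_psumJ e (lo hi : nat) : (forall k : nat, (k < lo)%N -> e k = 0) ->
  spec (- hi%:Z) (- lo%:Z) (fun t => (psum e (cis t) hi.+1)^J).
Proof.
move=> e0; under eq_fun do rewrite /psum rmorph_sum/=.
apply: (@spec_sum _ _ _ _ _ (fun (k : 'I_hi.+1) t => (e k * cis t ^+ k)^J)) => k _.
have -> : (fun t => (e k * cis t ^+ k)^J) = fun t => (e k)^J * zpow (- k%:Z) t.
  by apply/funext => t; rewrite cis_expr zpowN rmorphM.
have [kl|lk] := ltnP k lo.
  by under eq_fun do rewrite e0// rmorph0 mul0r; exact: spec0.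
apply: specZ; apply: spec_widen (spec_zpow _); rewrite lerN2 lez_nat//.
by rewrite -ltnS ltn_ord.
Qed.

End spectrum.

(** * The boundary function (1 - z)^d and its orthogonality relations *)

Section binomial_symbol.
Context {R : realType}.
Notation mu := (@lebesgue_measure R).
Notation D := (`[(- pi)%R, pi%R]%classic : set R).
Variable d : R.
Hypothesis d01 : 0 < d < 2^-1.

Let d1 : 0 < d < 1. Proof. by case/andP: d01 => -> /lt_trans; apply; lra. Qed.
Let dd : 0 <= 2 * d < 1. Proof. by case/andP: d01 => ? ?; apply/andP; split; lra. Qed.
Let zero01 : 0 <= (0 : R) < 1. Proof. by rewrite lexx ltr01. Qed.

Definition usym (t : R) : R[i] := cpow (1 - cis t) d.

Lemma normc_usym t : normc (usym t) = normc (1 - cis t) `^ d.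
Proof. exact: normc_cpow. Qed.

Lemma gauge_le N (z : R[i]) : gauge d N z <= N.+1%:R `^ (- d).
Proof.
by rewrite ler_pdivrMr ?lt_max ?ltr01// ler_peMr ?powR_ge0// le_max lexx.
Qed.

Lemma usum_usym : usum (binc d) usym.
Proof.
move=> eps eps0; have [d0 _] := andP d01.
have [N HN] := powRN_lt_eps d0 (divr_gt0 eps0 (ltr0Sn R 1)).
exists N.+1 => -[//|n] Nn t; rewrite normcBC.
have := cpow_gauge d1 n (z := cis t); rewrite normc_cis => /(_ (lexx _)).
move=> /le_lt_trans; apply; rewrite mulrC -ltr_pdivlMr//.
by rewrite (le_lt_trans (gauge_le _ _))// HN.
Qed.

Lemma cbounded_usym : cbounded usym.
Proof. exact: usum_cbounded usum_usym. Qed.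

Lemma usym_weight_eq1 t : normc (1 - cis t) != 0 -> normc (usym t) ^+ 2 * cweight (2 * d) t = 1.
Proof.
move=> r0; rewrite normc_usym /cweight.
rewrite -powR_mulrn ?powR_ge0// -powRrM [d * _]mulrC powRN mulfV// gt_eqF//.
by rewrite powR_gt0// lt_def r0 normc_ge0.
Qed.

Lemma usym_weight_le1 t : normc (usym t) ^+ 2 * cweight (2 * d) t <= 1.
Proof.
have [r0|/usym_weight_eq1->//] := eqVneq (normc (1 - cis t)) 0.
rewrite /cweight r0 powR0 ?mulr0//.
by rewrite oppr_eq0 mulf_neq0// gt_eqF//; case/andP: d01.
Qed.

(** |usym|^2 and the weight are inverse to each other except at t = 0, where the weight is 0 by the
    convention on powers of 0; that point is removed from the domain. *)
Lemma wcint_cancel (f : R -> R[i]) : cbounded f ->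
  wcint (2 * d) (fun t => usym t * (usym t)^J * f t) = wcint 0 f.
Proof.
move=> [f1 f2]; rewrite !wcintE.
have H (h : R -> R) : bounded_measurable h ->
    wint (2 * d) (fun t => normc (usym t) ^+ 2 * h t) = wint 0 h.
  move=> bh; have bu := cbounded_normc cbounded_usym.
  have bhu : bounded_measurable (fun t => normc (usym t) ^+ 2 * h t).
    apply: bounded_measurableM => //.
    by under eq_fun do rewrite expr2; exact: bounded_measurableM.
  have i1 := wintegrable dd bhu; have i2 := wintegrable zero01 bh.
  have S k : rintegrable k ->
      (\int[mu]_(t in D) (k t)%:E = \int[mu]_(t in D `\ 0%R) (k t)%:E)%E.
    move=> ik; rewrite integral_setD1//; first exact: measurableD.
    by apply: measurable_funS (measurable_int _ ik) => //; exact: subDsetl.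
  rewrite /wint /rint /Rintegral; congr fine; rewrite (S _ i1) (S _ i2).
  apply: eq_integral => t; rewrite inE/= in_itv/= => -[tpi t0].
  congr EFin; rewrite mulrAC usym_weight_eq1 ?mul1r ?cweight0 ?mulr1//.
  rewrite gt_eqF// (lt_le_trans _ (normc_1Bcis_ge tpi))//.
  by rewrite divr_gt0// normr_gt0; exact/eqP.
have E t : usym t * (usym t)^J = (normc (usym t) ^+ 2)%:C by exact: mulc_conj.
apply: complex_eqP => /=; rewrite -H//; congr wint; apply/funext => t; rewrite E;
    move: (normc (usym t) ^+ 2) => a.
  by rewrite Rec_mul /= mul0r subr0.
by rewrite Imc_mul /= mul0r addr0.
Qed.

Lemma psum_scale (e : nat -> R[i]) (r z : R[i]) n :
  psum (fun k => e k * r ^+ k) z n = psum e (r * z) n.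
Proof. by rewrite /psum; apply: eq_bigr => k _; rewrite exprMn mulrA. Qed.

(** Both functions are compared with their partial sums, with an error uniform in r; the partial
    sums differ by at most (N+1)^2 (1 - r) since |bin d k| <= 1. Thus N can be fixed first and r
    taken close to 1 afterwards. *)
Lemma usym_radial (r : R) N t : 0 <= r <= 1 ->
  normc (cpow (1 - r%:C * cis t) d - usym t) <= 4 * N.+1%:R `^ (- d) + N.+1%:R ^+ 2 * (1 - r).
Proof.
move=> /andP[r0 r1].
have nr : normc (r%:C * cis t) <= 1 by rewrite normcM normcR normc_cis mulr1 ger0_norm.
have n1 : normc (cis t) <= 1 :> R by rewrite normc_cis.
have G1 := le_trans (cpow_gauge d1 N nr) (ler_wpM2l (ler0n R 2) (gauge_le N _)).
have G2 := le_trans (cpow_gauge d1 N n1) (ler_wpM2l (ler0n R 2) (gauge_le N _)).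
have G3 : normc (psum (binc d) (r%:C * cis t) N.+1 - psum (binc d) (cis t) N.+1) <=
    N.+1%:R ^+ 2 * (1 - r).
  rewrite /psum -sumrB (le_trans (normc_sum _ _ _))//.
  apply: (@le_trans _ _ (\sum_(k < N.+1) N.+1%:R * (1 - r))); last first.
    by rewrite sumr_const card_ord -[leLHS]mulr_natl mulrA -expr2.
  apply: ler_sum => k _; rewrite -mulrBr exprMn -rmorphXn/=.
  rewrite -[X in _ - X]mul1r -mulrBl 2!normcM normcX normc_cis expr1n mulr1.
  have -> : (r ^+ k)%:C - 1 = (r ^+ k - 1)%:C by rewrite rmorphB.
  rewrite normc_binc normcR.
  have b1 : `|bin d k| <= 1.
    by rewrite norm_bin_le1// ger0_norm ltW//; case/andP: d1.
  rewrite (le_trans (ler_piMl _ b1))// -normrN opprB ger0_norm ?subr_ge0 ?exprn_ile1//.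
  rewrite -opprB subrX1 -mulNr opprB mulrC ler_wpM2r ?subr_ge0//.
  apply: (@le_trans _ _ (\sum_(i < k) 1)).
    by apply: ler_sum => i _; rewrite exprn_ile1.
  by rewrite sumr_const card_ord ler_nat ltnW.
have -> : cpow (1 - r%:C * cis t) d - usym t =
  (cpow (1 - r%:C * cis t) d - psum (binc d) (r%:C * cis t) N.+1) +
  (psum (binc d) (r%:C * cis t) N.+1 - psum (binc d) (cis t) N.+1) -
  (usym t - psum (binc d) (cis t) N.+1) by ring.
have normc3 (x y z : R[i]) : normc (x + y - z) <= normc x + normc y + normc z.
  by rewrite (le_trans (le_normcB _ _))// lerD2r le_normcD.
apply: (le_trans (normc3 _ _ _)); apply: le_trans (lerD (lerD G1 G3) G2) _.
by rewrite le_eqVlt; apply/orP; left; apply/eqP; ring.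
Qed.

(* Off z = 1, |1 - z|^{-2d} times the conjugate of (1 - z)^d is (1 - z)^{-d},
   whose Fourier coefficients of negative index vanish; approximate it by
   (1 - r z)^{-d} with r < 1. *)
Lemma usym_orth0 (k : nat) : (0 < k)%N ->
  wcint (2 * d) (fun t => (usym t)^J * zpow k%:Z t) = 0.
Proof.
move=> k0; have [d0 d2] := andP d01.
have bu := cbounded_usym; have buJ := cboundedJ bu; have bz := cbounded_zpow k%:Z : cbounded (zpow k%:Z : R -> R[i]).
have w0 := wint_cweight_ge0 (2 * d).
have K0 : 0 < 4 * wint (2 * d) (fun=> 1) + 1 by rewrite ltr_wpDl// mulr_ge0.
apply/eqP; rewrite -normc_eq0 eq_le normc_ge0 andbT.
apply/ler_addgt0Pr => e e0; rewrite add0r.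
pose e' := e / (4 * wint (2 * d) (fun=> 1) + 1).
have e'0 : 0 < e' by rewrite divr_gt0.
have [N /(_ N (leqnn N)) HN] := powRN_lt_eps d0 (divr_gt0 e'0 (ltr0Sn R 7)).
have Np : 0 < N.+1%:R ^+ 2 :> R by rewrite exprn_gt0.
(* x = 1 - r: N makes the first term of [usym_radial] smaller than e'/2, this choice of x takes care
   of the second, and x <= 1/2 keeps r positive. *)
pose x : R := Num.min 2^-1 (e' / (2 * N.+1%:R ^+ 2)).
have x0 : 0 < x by rewrite lt_min invr_gt0 ltr0n divr_gt0// mulr_gt0.
have x1 : x <= 2^-1 by rewrite ge_min lexx.
have xe : N.+1%:R ^+ 2 * x <= e' / 2.
  rewrite mulrC -ler_pdivlMr//; apply: (@le_trans _ _ (e' / (2 * N.+1%:R ^+ 2))).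
    by rewrite ge_min lexx orbT.
  by rewrite invfM mulrA.
pose r := 1 - x.
have r01 : 0 < r < 1 by apply/andP; rewrite /r; split; lra.
have r01' : 0 <= r <= 1 by case/andP: r01 => /ltW -> /ltW ->.
have nr t : normc (r%:C * cis t) < 1.
  by rewrite normcM normcR normc_cis mulr1 ger0_norm; case/andP: r01 => // /ltW.
pose v t := cpow (1 - r%:C * cis t) (- d).
have uv : usum (fun j => binc (- d) j * r%:C ^+ j) v.
  apply: (usum_geometric (C := 1) r01).
    move=> j; rewrite normcM normcX !normcR (ger0_norm (x := r)) ?ler_wpM2r ?exprn_ge0//.
    - by case/andP: r01'.
    - by rewrite norm_bin_le1// normrN ger0_norm ltW//; case/andP: d1.
    - by case/andP: r01'.
  by move=> t eps eps0; have [M HM] := psum_binN_cvg d1 (nr t) eps0; exists M => n /HM; rewrite psum_scale.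
have bv := usum_cbounded uv.
have I0 : wcint (2 * d) (fun t => usym t * (usym t)^J * (v t * zpow k%:Z t)) = 0.
  rewrite wcint_cancel; last exact: cboundedM.
  have := fourier_coef (- k%:Z) uv; rewrite opprK => ->.
  by case: k k0 {bz}.
have -> : wcint (2 * d) (fun t => (usym t)^J * zpow k%:Z t) =
    wcint (2 * d) (fun t => (usym t)^J * zpow k%:Z t - usym t * (usym t)^J * (v t * zpow k%:Z t)).
  rewrite wcintB//; first by rewrite I0 subr0.
    exact: cboundedM.
  by apply: cboundedM; exact: cboundedM.
(* With u = (1 - z)^d, the difference factors as conj(u) v ((1 - r z)^d - u) z^k. The first two
   factors contribute at most 2, because |1 - z| <= 2 |1 - r z|, and the third at most e'. *)
have bd : normc (wcint (2 * d) (fun t => (usym t)^J * zpow k%:Z t - usym t * (usym t)^J * (v t * zpow k%:Z t)))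
   <= 2 * wint (2 * d) (fun=> (2 * e') * 1).
  apply: normc_wcint => //.
  - by apply: cboundedB; [exact: cboundedM|apply: cboundedM; exact: cboundedM].
  - exact: bounded_measurable_cst.
  move=> t; rewrite mulr1.
  have rN0 : 1 - r%:C * cis t != 0.
    by rewrite subr_eq0 eq_sym; apply: contraTneq (nr t) => ->; rewrite normc1 ltxx.
  have vE : cpow (1 - r%:C * cis t) d * v t = 1 by rewrite mulrC /v cpowVN.
  have -> : (usym t)^J * zpow k%:Z t - usym t * (usym t)^J * (v t * zpow k%:Z t) =
     (usym t)^J * v t * (cpow (1 - r%:C * cis t) d - usym t) * zpow k%:Z t.
    have K (a b c y z : R[i]) : c * b = 1 -> y * z - a * y * (b * z) = y * b * (c - a) * z.
      move=> cb; have -> : y * b * (c - a) * z = (c * b) * (y * z) - a * y * (b * z) by ring.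
      by rewrite cb mul1r.
    exact: K.
  rewrite normcM normc_zpow mulr1 normcM; apply: ler_pM; rewrite ?normc_ge0//.
    rewrite normcM normcJ normc_usym /v normc_cpow.
    set p := normc (1 - cis t); set p' := normc (1 - _).
    have p'0 : 0 < p' by rewrite normc_gt0.
    have pp : p <= 2 * p'.
      have := @normc_ray_ge R (cis t); rewrite normc_cis => /(_ (lexx _) r r01').
      by rewrite ler_pdivrMr// mulrC.
    rewrite powRN ler_pdivrMr ?powR_gt0//.
    apply: (@le_trans _ _ ((2 * p') `^ d)).
      by apply: ge0_ler_powR; rewrite ?nnegrE ?normc_ge0 ?mulr_ge0 ?(ltW d0) ?(ltW p'0).
    rewrite powRM ?(ltW p'0)// ler_wpM2r ?powR_ge0//.
    by rewrite -[leRHS](powRr1 (ler0n R 2)) ler_powR ?ler1n//; lra.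
  rewrite (le_trans (usym_radial N t r01'))//.
  have -> : 1 - r = x by rewrite /r; ring.
  by move: HN; rewrite ltr_pdivlMr//; move: xe; set a := _ `^ _; lra.
apply: (le_trans bd); rewrite (wintZ dd _ (bounded_measurable_cst 1)).
have -> : 2 * (2 * e' * wint (2 * d) (fun=> 1)) = e' * (4 * wint (2 * d) (fun=> 1)) by ring.
rewrite /e' mulrAC ler_pdivrMr// ler_wpM2l ?(ltW e0)//.
by rewrite lerDl.
Qed.

(** Each power z^j in the series of G raises the frequency to j + k > 0, where [usym_orth0] applies;
    uniform convergence does the rest. *)
Lemma usym_orth (e : nat -> R[i]) (G : R -> R[i]) (k : nat) : (0 < k)%N -> usum e G ->
  wcint (2 * d) (fun t => G t * ((usym t)^J * zpow k%:Z t)) = 0.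
Proof.
move=> k0 eG.
have bf : cbounded (fun t => (usym t)^J * zpow k%:Z t).
  by apply: cboundedM; [apply: cboundedJ; exact: cbounded_usym|exact: cbounded_zpow].
apply: (ccvg_unique (wcint_series dd eG bf)) => eps eps0; exists 0%N => n _.
rewrite big1 ?subrr ?normc0// => j _.
rewrite (_ : wcint _ _ = 0) ?mulr0// -(@usym_orth0 (j + k)) ?addn_gt0 ?k0 ?orbT//.
by congr wcint; apply/funext => t; rewrite PoszD zpowD; ring.
Qed.

End binomial_symbol.

Lemma mxBE (V : zmodType) m n (A B : 'M[V]_(m, n)) i j : (A - B) i j = A i j - B i j.
Proof. by rewrite !mxE. Qed.

Lemma mxNE (V : zmodType) m n (A : 'M[V]_(m, n)) i j : (- A) i j = - A i j.
Proof. by rewrite !mxE. Qed.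

(** * Matrix-valued functions *)

Section matrix_functions.
Context {R : realType}.
Local Notation C := R[i].

Lemma adjmxE m n (A : 'M[C]_(m, n)) i j : adjmx A i j = (A j i)^J.
Proof. by rewrite !mxE. Qed.

Lemma adjmxM m n p (A : 'M[C]_(m, n)) (B : 'M[C]_(n, p)) :
  adjmx (A *m B) = adjmx B *m adjmx A.
Proof. by rewrite /adjmx trmx_mul map_mxM. Qed.

Lemma adjmx1 n : adjmx 1%:M = 1%:M :> 'M[C]_n.
Proof. by rewrite /adjmx trmx1 map_mx1. Qed.

Lemma adjmxB m n (A B : 'M[C]_(m, n)) : adjmx (A - B) = adjmx A - adjmx B.
Proof. by apply/matrixP => i j; rewrite !mxE rmorphB. Qed.

Lemma adjmxZ m n (a : C) (A : 'M[C]_(m, n)) : adjmx (a *: A) = a^J *: adjmx A.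
Proof. by apply/matrixP => i j; rewrite !mxE rmorphM. Qed.

Definition mbounded m n (M : R -> 'M[C]_(m, n)) := forall i j, cbounded (fun t => M t i j).

Lemma mboundedM m n p (A : R -> 'M[C]_(m, n)) (B : R -> 'M[C]_(n, p)) :
  mbounded A -> mbounded B -> mbounded (fun t => A t *m B t).
Proof.
move=> bA bB i j; under eq_fun do rewrite mxE.
by apply: (@cbounded_sum R _ _ _ (fun k t => A t i k * B t k j)) => k; exact: cboundedM.
Qed.

Lemma mboundedB m n (A B : R -> 'M[C]_(m, n)) :
  mbounded A -> mbounded B -> mbounded (fun t => A t - B t).
Proof. by move=> bA bB i j; under eq_fun do rewrite !mxE; exact: cboundedB. Qed.

Lemma mbounded_cst m n (A : 'M[C]_(m, n)) : mbounded (fun=> A).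
Proof. by move=> i j; exact: cbounded_cst. Qed.

Lemma mbounded_adj m n (A : R -> 'M[C]_(m, n)) : mbounded A -> mbounded (fun t => adjmx (A t)).
Proof. by move=> bA i j; under eq_fun do rewrite adjmxE; exact: cboundedJ. Qed.

Lemma mboundedZ m n (a : R -> C) (A : R -> 'M[C]_(m, n)) :
  cbounded a -> mbounded A -> mbounded (fun t => a t *: A t).
Proof. by move=> ba bA i j; under eq_fun do rewrite mxE; exact: cboundedM. Qed.

Lemma mbounded_ex m n (A : R -> 'M[C]_(m, n)) : mbounded A ->
  exists2 K : R, 0 <= K & forall t i j, normc (A t i j) <= K.
Proof.
move=> bA.
have /choice[K HK] : forall i : 'I_m, exists K, forall (j : 'I_n) t, normc (A t i j) <= K.
  move=> i.
  have /choice[K HK] : forall j : 'I_n, exists K, forall t, normc (A t i j) <= K.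
    by move=> j; exact: cbounded_ex.
  exists (\sum_j `|K j|) => j t.
  rewrite (le_trans (HK j t))// (le_trans (ler_norm _))//.
  by rewrite (bigD1 j)//= lerDl sumr_ge0.
exists (\sum_i `|K i|); first exact: sumr_ge0.
move=> t i j; rewrite (le_trans (HK i j t))// (le_trans (ler_norm _))//.
by rewrite (bigD1 i)//= lerDl sumr_ge0.
Qed.

Definition mle m n (A : 'M[C]_(m, n)) (r : R) := forall i j, normc (A i j) <= r.

Lemma mleM m n p (A : 'M[C]_(m, n)) (B : 'M[C]_(n, p)) a b :
  mle A a -> mle B b -> mle (A *m B) (n%:R * (a * b)).
Proof.
move=> Aa Bb i j; rewrite mxE (le_trans (normc_sum _ _ _))//.
apply: (@le_trans _ _ (\sum_(k < n) a * b)).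
  by apply: ler_sum => k _; rewrite normcM ler_pM// normc_ge0.
by rewrite sumr_const card_ord mulr_natl.
Qed.

Lemma mleD m n (A B : 'M[C]_(m, n)) a b : mle A a -> mle B b -> mle (A + B) (a + b).
Proof. by move=> Aa Bb i j; rewrite mxE (le_trans (le_normcD _ _))// lerD. Qed.

Lemma mleB m n (A B : 'M[C]_(m, n)) a b : mle A a -> mle B b -> mle (A - B) (a + b).
Proof. by move=> Aa Bb i j; rewrite !mxE (le_trans (le_normcB _ _))// lerD. Qed.

Lemma mle_adj m n (A : 'M[C]_(m, n)) a : mle A a -> mle (adjmx A) a.
Proof. by move=> Aa i j; rewrite adjmxE normcJ. Qed.

Section weight.
Variable s : R.
Hypothesis s01 : 0 <= s < 1.
Implicit Types (a b lo hi : int).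

Definition mann m n (H : R -> 'M[C]_(m, n)) a b := forall i j, ann s (fun t => H t i j) a b.

Definition mspec m n lo hi (M : R -> 'M[C]_(m, n)) := forall i j, spec s lo hi (fun t => M t i j).

Lemma mspecM m n p lo hi lo' hi' (A : R -> 'M[C]_(m, n)) (B : R -> 'M[C]_(n, p)) :
  mspec lo hi A -> mspec lo' hi' B -> mspec (lo + lo') (hi + hi') (fun t => A t *m B t).
Proof.
move=> sA sB i j; under eq_fun do rewrite mxE.
by apply: (@spec_sum R s s01 _ _ _ _ _ (fun k t => A t i k * B t k j)) => k _; exact: specM.
Qed.

Lemma mannM m n p lo hi a b (H : R -> 'M[C]_(m, n)) (A : R -> 'M[C]_(n, p)) :
  mbounded H -> mann H a b -> mspec lo hi A ->
  mann (fun t => H t *m A t) (a + hi) (b + lo).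
Proof.
move=> bH aH sA i j k kk.
under eq_fun do rewrite mxE mulr_suml.
rewrite (@wcint_sum R s s01 _ _ _ (fun c t => H t i c * A t c j * zpow (- k) t)).
  by rewrite big1// => c _; have [_ sF] := sA c j; exact: (sF _ a b).
move=> c; apply: cboundedM; last exact: cbounded_zpow.
by apply: cboundedM => //; exact: spec_cbounded (sA c j).
Qed.

End weight.

End matrix_functions.

(** * Weighted integrals of the gauge *)

Section gauge_integrals.
Context {R : realType}.
Variable d : R.
Hypothesis d01 : 0 < d < 2^-1.

Let dd : 0 <= 2 * d < 1. Proof. by case/andP: d01 => ? ?; apply/andP; split; lra. Qed.
Let zero01 : 0 <= (0 : R) < 1. Proof. by rewrite lexx ltr01. Qed.

Definition cgauge N (t : R) : R := gauge d N (cis t).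

Lemma cgauge_ge0 N t : 0 <= cgauge N t.
Proof. exact: gauge_ge0. Qed.

Lemma cgauge_sqr s N t : cgauge N t ^+ 2 * cweight s t = N.+1%:R `^ (- (2 * d)) * cgauge2 s N t.
Proof.
rewrite /cgauge /gauge exprMn exprVn /cgauge2 -powR_mulrn ?powR_ge0// -powRrM.
have -> : - d * 2%:R = - (2 * d) by ring.
by rewrite mulrAC -mulrA.
Qed.

Lemma bounded_measurable_cgauge N : bounded_measurable (cgauge N).
Proof.
split.
  have -> : cgauge N = fun t => N.+1%:R `^ (- d) * Num.sqrt (cgauge2 0 N t).
    apply/funext => t; rewrite /cgauge /gauge /cgauge2 cweight0 mul1r -exprVn sqrtr_sqr ger0_norm//.
    by rewrite invr_ge0 le_max ler01.
  apply: measurable_funM => //.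
  apply: (@measurableT_comp _ _ _ _ _ _ (@Num.sqrt R)); last exact: measurable_cgauge2.
  exact: (continuous_measurable_fun (@sqrt_continuous R)).
exists (N.+1%:R `^ (- d)) => t; rewrite ger0_norm ?cgauge_ge0//.
exact: gauge_le.
Qed.

Let bounded_measurable_cgauge_sqr N : bounded_measurable (fun t => cgauge N t ^+ 2).
Proof.
under eq_fun do rewrite expr2.
by apply: bounded_measurableM; exact: bounded_measurable_cgauge.
Qed.

Lemma wint_cgauge_sqr : exists2 K : R, 0 < K &
  forall N, wint (2 * d) (fun t => cgauge N t ^+ 2) <= K / N.+1%:R.
Proof.
have [K [K0 HK]] := rint_cgauge2 dd; exists K => // N.
rewrite /wint; under eq_fun do rewrite cgauge_sqr.
rewrite rintZ; last exact: rintegrable_cgauge2.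
apply: le_trans (ler_wpM2l (powR_ge0 _ _) (HK N)) _.
rewrite mulrCA -powRD; last by rewrite pnatr_eq0 implybT.
by rewrite addrA addNr add0r powR_inv1.
Qed.

(** The integrand is the square of the bound for U^* U - Q^* Q. In its first term |u|^2 times the
    weight is at most 1, leaving the unweighted integral of gauge^2, of order N^{-2d-1}; in the
    second, gauge^4 is at most N^{-2d} gauge^2, whose weighted integral is of order 1/N. *)
Lemma wint_cgauge_mixed : exists2 K : R, 0 < K & forall N,
  wint (2 * d) (fun t => (normc (usym d t) * cgauge N t + cgauge N t ^+ 2) ^+ 2) <=
  K * N.+1%:R `^ (- (1 + 2 * d)).
Proof.
have [K1 [K10 HK1]] := rint_cgauge2 dd; have [K2 [K20 HK2]] := rint_cgauge2 zero01.
exists (2 * (K1 + K2)); first by rewrite mulr_gt0// addr_gt0.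
move=> N; have bu := cbounded_normc (cbounded_usym d01).
have bg := bounded_measurable_cgauge N; have bg2 := bounded_measurable_cgauge_sqr N.
have bS : bounded_measurable (fun t => (normc (usym d t) * cgauge N t + cgauge N t ^+ 2) ^+ 2).
  have b1 : bounded_measurable (fun t => normc (usym d t) * cgauge N t + cgauge N t ^+ 2).
    by apply: bounded_measurableD => //; exact: bounded_measurableM.
  by under eq_fun do rewrite expr2; exact: bounded_measurableM.
pose P := N.+1%:R `^ (- (2 * d)) : R.
pose k t := 2 * P * cgauge2 0 N t + 2 * (P * P) * cgauge2 (2 * d) N t.
have i1 := rintegrable_cgauge2 N zero01; have i2 := rintegrable_cgauge2 N dd.
have ik : rintegrable k by apply: rintegrableD; exact: rintegrableZ.
have P0 : 0 <= P by exact: powR_ge0.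
apply: (@le_trans _ _ (rint k)).
  apply: le_rint => //; first exact: wintegrable.
  move=> t _; rewrite /k.
  have c0 : cgauge N t ^+ 2 = P * cgauge2 0 N t by rewrite -cgauge_sqr cweight0 mulr1.
  have c1 := cgauge_sqr (2 * d) N t; rewrite -/P in c1.
  have cP : cgauge N t ^+ 2 <= P.
    rewrite /P (_ : - (2 * d) = - d * 2%:R); last by ring.
    rewrite powRrM powR_mulrn ?powR_ge0// lerXn2r ?nnegrE ?cgauge_ge0 ?powR_ge0//.
    exact: gauge_le.
  have g0 := cgauge_ge0 N t; have w0 := cweight_ge0 (2 * d) t.
  have uw := usym_weight_le1 d01 t.
  rewrite -mulrA -c0 -[2 * (P * P) * _]mulrA -[P * P * _]mulrA -c1.
  have n0 := normc_ge0 (usym d t).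
  move: cP g0 w0 uw n0; move: (normc _) (cgauge N t) (cweight _ _) => x m W cP m0 W0 uw x0.
  apply: (@le_trans _ _ (2 * (x ^+ 2 * W) * m ^+ 2 + 2 * (m ^+ 2 * (m ^+ 2 * W)))).
    rewrite -subr_ge0.
    have -> : 2 * (x ^+ 2 * W) * m ^+ 2 + 2 * (m ^+ 2 * (m ^+ 2 * W)) - (x * m + m ^+ 2) ^+ 2 * W =
      (x * m - m ^+ 2) ^+ 2 * W by ring.
    by rewrite mulr_ge0// sqr_ge0.
  apply: lerD.
    by rewrite -[leRHS]mulr1 mulrAC ler_wpM2l// mulr_ge0// sqr_ge0.
  by rewrite ler_wpM2l// ler_wpM2r// mulr_ge0// sqr_ge0.
rewrite /k rintD; [|exact: rintegrableZ..].
rewrite !rintZ//.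
have E1 : P * N.+1%:R `^ (0 - 1) = N.+1%:R `^ (- (1 + 2 * d)).
  rewrite -powRD; last by rewrite pnatr_eq0 implybT.
  by congr (_ `^ _); ring.
have E2 : P * P * N.+1%:R `^ (2 * d - 1) = N.+1%:R `^ (- (1 + 2 * d)).
  rewrite -mulrA -!powRD; [|by rewrite pnatr_eq0 implybT..].
  by congr (_ `^ _); ring.
have H1 := ler_wpM2l (mulr_ge0 (ler0n R 2) P0) (HK2 N).
have H2 := ler_wpM2l (mulr_ge0 (ler0n R 2) (mulr_ge0 P0 P0)) (HK1 N).
apply: (le_trans (lerD H1 H2)).
rewrite le_eqVlt; apply/orP; left; apply/eqP.
have -> : 2 * P * (K2 * N.+1%:R `^ (0 - 1)) = 2 * K2 * (P * N.+1%:R `^ (0 - 1)) by ring.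
have -> : 2 * (P * P) * (K1 * N.+1%:R `^ (2 * d - 1)) = 2 * K1 * (P * P * N.+1%:R `^ (2 * d - 1)) by ring.
by rewrite E1 E2; ring.
Qed.

End gauge_integrals.

(** * The prediction error *)

Section baxter.
Context {R : realType}.
Local Notation C := R[i].
Variables (d : R) (q : nat) (G B : R -> 'M[C]_q) (Gc Bc : 'I_q -> 'I_q -> nat -> C) (c0 : 'M[C]_q).
Hypotheses (d01 : 0 < d < 2^-1) (GB : forall t, G t *m B t = 1%:M) (BG : forall t, B t *m G t = 1%:M).
Hypotheses (HB : forall i j, usum (Bc i j) (fun t => B t i j)) (HBd : forall i j, expdec (Bc i j)).
Hypotheses (HG : forall i j, usum (Gc i j) (fun t => G t i j)).
Hypothesis c0B : c0 *m (\matrix_(i, j) Bc i j 0) = 1%:M.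

Let dd : 0 <= 2 * d < 1. Proof. by case/andP: d01 => ? ?; apply/andP; split; lra. Qed.
Let d1 : 0 < d < 1. Proof. by case/andP: d01 => -> /lt_trans; apply; lra. Qed.
Let zero01 : 0 <= (0 : R) < 1. Proof. by rewrite lexx ltr01. Qed.

Let bB : mbounded B. Proof. by move=> i j; exact: usum_cbounded (HB i j). Qed.
Let bG : mbounded G. Proof. by move=> i j; exact: usum_cbounded (HG i j). Qed.
Let bu := cbounded_usym d01.

(** The function U of the overview, with [B] for g^{-1}. Its two factors are truncated separately
    below: [B] has an exponentially small tail, so the error of [truncQ] is governed by the binomial
    series. *)
Definition symU t : 'M[C]_q := usym d t *: B t.
Definition truncP N t : C := psum (binc d) (cis t) N.+1.
Definition truncB N t : 'M[C]_q := \matrix_(i, j) psum (Bc i j) (cis t) N.+1.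
Definition truncQ N t : 'M[C]_q := truncP N t *: truncB N t.

Let bU : mbounded symU. Proof. exact: mboundedZ. Qed.

Let bQ N : mbounded (truncQ N).
Proof.
apply: mboundedZ; first exact: cbounded_psum.
by move=> i j; under eq_fun do rewrite mxE; exact: cbounded_psum.
Qed.

Lemma truncB_tail : exists2 K : R, 0 <= K &
  forall N t, mle (B t - truncB N t) (K / N.+1%:R ^+ 2).
Proof.
have H i j : exists K : R, 0 <= K /\ forall N t, normc ((B t - truncB N t) i j) <= K / N.+1%:R ^+ 2.
  have [K [rho [r01 eK]]] := HBd i j.
  have [M HM] := natpow_expr_bound 2 r01.
  have K0 : 0 <= K by have := le_trans (normc_ge0 _) (eK 0%N); rewrite expr0 mulr1.
  have M0 : 0 <= M by have := HM 0%N; rewrite expr0 mulr1 expr1n => /(le_trans ler01).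
  have [r0 r1] := andP r01.
  have r2 : 0 < 1 - rho by rewrite subr_gt0.
  exists (K * M / (1 - rho)); split; first by rewrite divr_ge0// ?mulr_ge0// ltW.
  move=> N t; rewrite !mxE.
  apply: (le_trans (geometric_tail N.+1 r01 eK (usum_ccvg t (HB i j)))).
  have N2 : 0 < N.+1%:R ^+ 2 :> R by rewrite exprn_gt0.
  rewrite ler_pdivlMr// mulrAC ler_pM2r ?invr_gt0// -mulrA ler_wpM2l// mulrC.
  apply: le_trans (HM N.+1); rewrite ler_wpM2r ?exprn_ge0 ?(ltW r0)//.
  by rewrite lerXn2r ?nnegrE ?ler0n// ler_nat.
have /choice[K HK] : forall i : 'I_q, exists K : R, 0 <= K /\ forall N t j, normc ((B t - truncB N t) i j) <= K / N.+1%:R ^+ 2.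
  move=> i; have /choice[K HK] := H i.
  exists (\sum_j K j); split; first by apply: sumr_ge0 => j _; have [] := HK j.
  move=> N t j; have [_ h] := HK j; rewrite (le_trans (h N t))//.
  rewrite ler_wpM2r ?invr_ge0 ?exprn_ge0// (bigD1 j)//= lerDl sumr_ge0// => k _.
  by have [] := HK k.
exists (\sum_i K i); first by apply: sumr_ge0 => j _; have [] := HK j.
move=> N t i j; have [_ h] := HK i; rewrite (le_trans (h N t j))//.
rewrite ler_wpM2r ?invr_ge0 ?exprn_ge0// (bigD1 i)//= lerDl sumr_ge0// => k _.
by have [] := HK k.
Qed.

(** As d < 1, the gauge is at least (N+1)^{-1} / (2 (N+1)); the tail of [B] is thereby absorbed into
    it. *)
Lemma inv_sqr_le_cgauge N t : (N.+1%:R ^+ 2)^-1 <= 2 * cgauge d N t.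
Proof.
rewrite /cgauge /gauge mulrA ler_pdivlMr ?lt_max ?ltr01//.
have N0 : 0 < N.+1%:R :> R by rewrite ltr0n.
have N1 : 1 <= N.+1%:R :> R by rewrite ler1n.
apply: (@le_trans _ _ ((N.+1%:R ^+ 2)^-1 * (2 * N.+1%:R))).
  rewrite ler_wpM2l ?invr_ge0 ?exprn_ge0// ge_max.
  apply/andP; split; first by lra.
  by rewrite mulrC ler_wpM2r ?ler0n// normc_1Bcis_le2.
rewrite mulrCA ler_wpM2l// expr2 invfM -mulrA mulVf ?gt_eqF// mulr1.
rewrite -[leLHS](powR_inv1 (ltW N0)) ler_powR// lerN2.
by case/andP: d1 => _ /ltW.
Qed.

Lemma truncQ_gauge : exists2 K : R, 0 <= K &
  forall N t, mle (symU t - truncQ N t) (K * cgauge d N t).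
Proof.
have [K1 K10 HK1] := mbounded_ex bB.
have [K2 K20 HK2] := truncB_tail.
(* From U - Q = (u - P) B + P (B - B_N): 2 is the constant of [cpow_gauge], 4 bounds |P|, and K2 * 2
   expresses the tail of [B] by the gauge. *)
exists (2 * K1 + 4 * (K2 * 2)); first by rewrite addr_ge0// !mulr_ge0.
move=> N t i j.
have nc : normc (cis t) <= 1 :> R by rewrite normc_cis.
have G1 := cpow_gauge d1 N nc.
have g0 := cgauge_ge0 d N t.
have P4 : normc (truncP N t) <= 4.
  have -> : truncP N t = usym d t - (usym d t - truncP N t) by ring.
  rewrite (le_trans (le_normcB _ _))// (_ : 4 = 2 + 2) ?lerD//; last by rewrite -natrD.
    rewrite normc_usym; have [d0 d2] := andP d1.
    apply: (@le_trans _ _ (2 `^ d)).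
      by apply: ge0_ler_powR; rewrite ?nnegrE ?normc_ge0 ?(ltW d0)// normc_1Bcis_le2.
    by rewrite -[leRHS](powRr1 (ler0n R 2)) ler_powR ?ler1n//; lra.
  rewrite (le_trans G1)// ler_piMr// (le_trans (gauge_le _ _ _))//.
  have N1 : 1 <= N.+1%:R :> R by rewrite ler1n.
  by rewrite -[leRHS](powRr0 N.+1%:R) ler_powR// oppr_le0; case/andP: d1 => /ltW.
have -> : (symU t - truncQ N t) i j = (usym d t - truncP N t) * B t i j + truncP N t * (B t - truncB N t) i j.
  by rewrite !mxE; ring.
rewrite (le_trans (le_normcD _ _))// [leRHS]mulrDl; apply: lerD; rewrite normcM.
  by rewrite mulrAC ler_pM ?normc_ge0.
rewrite -!mulrA ler_pM ?normc_ge0// (le_trans (HK2 N t i j))//.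
by rewrite ler_wpM2l// inv_sqr_le_cgauge.
Qed.

Let spec_truncP N : spec (2 * d) (- N%:Z) 0 (fun t => (truncP N t)^J).
Proof. by have := @spec_psumJ R _ dd (binc d) 0 N; rewrite oppr0; apply. Qed.

Let mspec_truncQ N : mspec (2 * d) 0 (N%:Z + N%:Z) (truncQ N).
Proof.
move=> i j; under eq_fun do rewrite !mxE.
have hP : spec (2 * d) 0 N%:Z (truncP N) by exact: (@spec_psum R _ dd _ 0 N).
have hB : spec (2 * d) 0 N%:Z (fun t => psum (Bc i j) (cis t) N.+1).
  exact: (@spec_psum R _ dd _ 0 N).
by have := specM hP hB; rewrite addr0.
Qed.

Let mspec_truncQJ N : mspec (2 * d) (- (N%:Z + N%:Z)) 0 (fun t => adjmx (truncQ N t)).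
Proof.
move=> i j.
have -> : (fun t => adjmx (truncQ N t) i j) = fun t => (truncP N t)^J * (psum (Bc j i) (cis t) N.+1)^J.
  by apply/funext => t; rewrite !mxE rmorphM.
have hB : spec (2 * d) (- N%:Z) 0 (fun t => (psum (Bc j i) (cis t) N.+1)^J).
  by have := @spec_psumJ R _ dd (Bc j i) 0 N; rewrite oppr0; apply.
by have := specM (spec_truncP N) hB; rewrite addr0 -opprD.
Qed.

(** Turns a coefficient of positive index into a conjugate, the form in which [usym_orth]
    applies. *)
Let conj_term (a x u z : C) : a * (u * x^J) * z^J = a * (x * (u^J * z))^J.
Proof.
case: a x u z => a1 a2 [x1 x2] [u1 u2] [z1 z2].
by apply: complex_eqP => /=; ring.
Qed.

Section finite.
Variables (n : nat) (p : nat -> 'M[C]_q).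
Hypothesis n0 : (0 < n)%N.

Definition polyb t : 'M[C]_q := 1%:M - \sum_(1 <= k < n.+1) zpow k%:Z t *: p k.
Definition errf t : 'M[C]_q := polyb t - c0 *m symU t.

Hypothesis orthb : mann (2 * d) (fun t => polyb t *m G t *m adjmx (G t)) 1 n%:Z.

Lemma mbounded_polyb : mbounded polyb.
Proof.
apply: mboundedB; first exact: mbounded_cst.
move=> i j; under eq_fun do rewrite summxE.
apply: (@cbounded_sum R _ _ _ (fun k t => (zpow k%:Z t *: p k) i j)) => k.
by under eq_fun do rewrite mxE; apply: cboundedM; [exact: cbounded_zpow|exact: cbounded_cst].
Qed.

Lemma mbounded_errf : mbounded errf.
Proof.
apply: mboundedB; first exact: mbounded_polyb.
by apply: mboundedM => //; exact: mbounded_cst.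
Qed.

Lemma mbounded_errfGG : mbounded (fun t => errf t *m G t *m adjmx (G t)).
Proof.
apply: mboundedM; last exact: mbounded_adj.
by apply: mboundedM => //; exact: mbounded_errf.
Qed.

(** The normal equations of the infinite predictor. [B] cancels [G] and leaves c0 u G^*, whose
    coefficients of index k >= 1 are combinations of conjugates of the integrals in [usym_orth]. *)
Lemma orthU : mann (2 * d) (fun t => c0 *m symU t *m G t *m adjmx (G t)) 1 n%:Z.
Proof.
have E t : c0 *m symU t *m G t *m adjmx (G t) = c0 *m (usym d t *: adjmx (G t)).
  by rewrite /symU -scalemxAr -!scalemxAl -(mulmxA c0) BG mulmx1 scalemxAr.
move=> i j k /andP[k1 kn].
under eq_fun do rewrite E mxE mulr_suml.
have [m kE] : exists m : nat, k = m.+1%:Z.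
  by exists (absz k).-1; lia.
have bterm (a : 'I_q) : cbounded (fun t => G t j a * ((usym d t)^J * zpow m.+1%:Z t)).
  by apply: cboundedM => //; apply: cboundedM; [exact: cboundedJ|exact: cbounded_zpow].
have -> : (fun t => \sum_a c0 i a * (usym d t *: adjmx (G t)) a j * zpow (- k) t) =
   fun t => \sum_a c0 i a * (G t j a * ((usym d t)^J * zpow m.+1%:Z t))^J.
  apply/funext => t; apply: eq_bigr => a _.
  by rewrite !mxE kE zpowN; exact: conj_term.
rewrite (@wcint_sum R _ dd _ _ _ (fun a t => c0 i a * (G t j a * ((usym d t)^J * zpow m.+1%:Z t))^J)).
  rewrite big1// => a _; rewrite wcintZ//; last exact: cboundedJ.
  by rewrite wcintJ// (usym_orth d01 (ltn0Sn m) (HG j a)) rmorph0 mulr0.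
by move=> a; apply: cboundedM; [exact: cbounded_cst|exact: cboundedJ].
Qed.

Lemma orthf : mann (2 * d) (fun t => errf t *m G t *m adjmx (G t)) 1 n%:Z.
Proof.
move=> i j k kk.
have E t : (errf t *m G t *m adjmx (G t)) i j * zpow (- k) t =
  (polyb t *m G t *m adjmx (G t)) i j * zpow (- k) t -
  (c0 *m symU t *m G t *m adjmx (G t)) i j * zpow (- k) t.
  by rewrite /errf (mulmxBl (polyb t)) (mulmxBl (polyb t *m G t)) mxBE mulrBl.
under eq_fun do rewrite E.
have bGJ : mbounded (fun t => adjmx (G t)) by exact: mbounded_adj.
rewrite wcintB//.
- by rewrite (orthb i j kk) (orthU i j kk) subrr.
- apply: cboundedM; last exact: cbounded_zpow.
  by apply: (mboundedM (mboundedM mbounded_polyb bG) bGJ).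
- apply: cboundedM; last exact: cbounded_zpow.
  by apply: (mboundedM (mboundedM (mboundedM (mbounded_cst c0) bU) bG) bGJ).
Qed.

(** b and c0 Q both take the value 1 at z = 0, by [c0B], and have degree at most n, so their
    difference has frequencies in [1, n]; the adjoint reflects them. *)
Lemma mspec_polyb_diff N : (N + N <= n)%N ->
  mspec (2 * d) (- n%:Z) (-1) (fun t => adjmx (polyb t - c0 *m truncQ N t)).
Proof.
move=> Nn i j.
(* Coefficients deprived of their constant term, for the splitting P B_N - P(0) B(0) = P (B_N -
   B(0)) + (P - 1) B(0), where P(0) = 1. *)
pose e' a b k : C := if k == 0%N then 0 else Bc a b k.
pose be' k : C := if k == 0%N then 0 else binc d k.
have psum0 (e : nat -> C) t : psum e (cis t) N.+1 = e 0%N + psum (fun k => if k == 0%N then 0 else e k) (cis t) N.+1.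
  by rewrite /psum !big_ord_recl/= !expr0 mulr1 mul0r add0r.
have E0 t : (polyb t - c0 *m truncQ N t) j i =
  (\sum_(1 <= k < n.+1) - (p k j i * zpow k%:Z t)) +
  \sum_a (- c0 j a) * (truncP N t * psum (e' a i) (cis t) N.+1 + Bc a i 0%N * psum be' (cis t) N.+1).
  have c1 : (1%:M : 'M[C]_q) j i = \sum_a c0 j a * Bc a i 0%N.
    by rewrite -c0B mxE; apply: eq_bigr => a _; rewrite mxE.
  have -> : (polyb t - c0 *m truncQ N t) j i = (1%:M : 'M[C]_q) j i -
      \sum_(1 <= k < n.+1) (zpow k%:Z t *: p k) j i - \sum_a c0 j a * truncQ N t a i.
    by rewrite mxBE [(c0 *m _) j i]mxE /polyb mxBE summxE.
  rewrite c1 addrAC -sumrB addrC -sumrN; congr (_ + _); apply: eq_bigr => k _.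
    by rewrite mxE mulrC.
  rewrite /truncQ !mxE -/(truncP N t) (psum0 (Bc k i)).
  have -> : truncP N t = 1 + psum be' (cis t) N.+1 by rewrite /truncP psum0 /binc bin0.
  ring.
have E t : adjmx (polyb t - c0 *m truncQ N t) i j =
  (\sum_(1 <= k < n.+1) - ((p k j i)^J * zpow (- k%:Z) t)) +
  \sum_a (- (c0 j a)^J) * ((truncP N t)^J * (psum (e' a i) (cis t) N.+1)^J +
     (Bc a i 0)^J * (psum be' (cis t) N.+1)^J).
  have JD (x y : C) : (x + y)^J = x^J + y^J by exact: rmorphD.
  have JM (x y : C) : (x * y)^J = x^J * y^J by exact: rmorphM.
  have JN (x : C) : (- x)^J = - x^J by exact: rmorphN.
  have JS (I : Type) (l : seq I) (F : I -> C) : (\sum_(k <- l) F k)^J = \sum_(k <- l) (F k)^J by exact: rmorph_sum.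
  rewrite adjmxE E0 JD JS; congr (_ + _); first by apply: eq_bigr => k _; rewrite JN JM zpowN.
  by rewrite JS; apply: eq_bigr => k _; rewrite JM JN JD !JM.
under eq_fun do rewrite E.
apply: specD => //.
  under eq_fun do rewrite big_nat.
  apply: (@spec_sum R _ dd _ _ _ _ _ (fun k t => - ((p k j i)^J * zpow (- k%:Z) t))).
  move=> k /andP[k1 kn].
  under eq_fun do rewrite -mulNr.
  by apply: specZ => //; apply: spec_widen (spec_zpow _ _); lia.
apply: (@spec_sum R _ dd _ _ _ _ _ (fun a t => (- (c0 j a)^J) * ((truncP N t)^J * (psum (e' a i) (cis t) N.+1)^J +
     (Bc a i 0)^J * (psum be' (cis t) N.+1)^J))) => a _.
apply: specZ => //; apply: specD => //.
  have h : spec (2 * d) (- N%:Z) (- 1%:Z) (fun t => (psum (e' a i) (cis t) N.+1)^J).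
    by apply: spec_psumJ => // -[|//].
  by apply: spec_widen (specM (spec_truncP N) h); lia.
apply: specZ => //.
have h : spec (2 * d) (- N%:Z) (- 1%:Z) (fun t => (psum be' (cis t) N.+1)^J).
  by apply: spec_psumJ => // -[|//].
by apply: spec_widen h; lia.
Qed.

End finite.

(** With V = U and E = U - Q the right-hand side is U^* U - Q^* Q, so the left-hand side bounds it
    by 2 |U||E| + |E|^2 up to the dimension. *)
Let mixed (E V : 'M[C]_q) : adjmx V *m E + adjmx E *m V - adjmx E *m E =
  adjmx V *m V - adjmx (V - E) *m (V - E).
Proof. by rewrite adjmxB !mulmxBl !mulmxBr; apply/matrixP => i j; rewrite !mxE; ring. Qed.

(* With the weight w = |1 - z|^{-2d} G G^*, b = polyb is the best approximation of
   c_0 U by polynomials of degree <= n with value 1 at 0, such as c_0 Q. *)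
Lemma errf_energy : exists2 K : R, 0 < K & forall n p, (0 < n)%N ->
  mann (2 * d) (fun t => polyb n p t *m G t *m adjmx (G t)) 1 n%:Z ->
  forall i c, wint (2 * d) (fun t => normc ((errf n p t *m G t) i c) ^+ 2) <= K / n%:R.
Proof.
have [K1 K10 HK1] := mbounded_ex bG.
have [K2 K20 HK2] := truncQ_gauge.
have [K3 K30 HK3] := wint_cgauge_sqr d01.
have [K4 K40 HK4] := mbounded_ex (mbounded_cst c0).
pose L := q%:R * (q%:R * (K4 * K2) * K1).
(* L times the gauge bounds the entries of c0 (U - Q) G; q counts the columns, 2 comes from n <= 2
   (N + 1), and the 1 ensures positivity. *)
exists (2 * q%:R * (L ^+ 2 * K3) + 1).
  rewrite ltr_wpDl// !mulr_ge0// ?sqr_ge0// ltW//.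
move=> n p n0 orthb i c.
have bF : mbounded (fun t => errf n p t *m G t) by apply: mboundedM => //; exact: mbounded_errf.
pose N := n./2.
have Nn : (N + N <= n)%N by rewrite addnn -[leqRHS]odd_double_half leq_addl.
pose Gm t : 'M[C]_q := - (c0 *m (symU t - truncQ N t) *m G t).
have bGm : mbounded Gm.
  move=> a b; under eq_fun do rewrite mxE.
  apply: cboundedN; apply: (mboundedM (mboundedM (mbounded_cst c0) (mboundedB bU (bQ N))) bG).
pose De t := (polyb n p t - c0 *m truncQ N t) *m G t.
have FE t : De t = errf n p t *m G t - Gm t.
  rewrite /De /Gm opprK -mulmxDl; congr (_ *m _).
  by rewrite /errf mulmxBr addrA subrK.
have bDe : mbounded De.
  exact: (mboundedM (mboundedB (mbounded_polyb n p) (mboundedM (mbounded_cst c0) (bQ N))) bG).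
(* f G G^* has no weighted coefficient in [1, n], and the adjoint of b - c0 Q shifts frequencies by
   -n to -1: the window shrinks to the index 0, and the sum over a is a diagonal entry of that
   coefficient. *)
have Z : wcint (2 * d) (fun t => \sum_a (errf n p t *m G t) i a * (De t i a)^J) = 0.
  have bH := mbounded_errfGG n p; have aH := orthf n0 orthb; have := mannM dd bH aH (mspec_polyb_diff p n0 Nn).
  move=> /(_ i i 0); rewrite -[n%:Z + _]/(n%:Z - n%:Z) !subrr lexx => /(_ isT) h0; rewrite -[RHS]h0.
  congr wcint; apply/funext => t.
  have -> : zpow (- (0 : int)) t = 1 :> C by rewrite oppr0 zpow0.
  rewrite [RHS]mulr1.
  have -> : errf n p t *m G t *m adjmx (G t) *m adjmx (polyb n p t - c0 *m truncQ N t) =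
     (errf n p t *m G t) *m adjmx (De t) by rewrite /De adjmxM !mulmxA.
  have MM (M N' : 'M[C]_q) : \sum_a M i a * (N' i a)^J = (M *m adjmx N') i i.
    by rewrite mxE; apply: eq_bigr => a _; rewrite adjmxE.
  exact: MM.
have bs (M : R -> 'M[C]_q) : mbounded M -> bounded_measurable (fun t => \sum_a normc (M t i a) ^+ 2).
  move=> bM; have -> : (fun t => \sum_a normc (M t i a) ^+ 2) =
      fun t => complex.Re (\sum_a (normc (M t i a) ^+ 2)%:C).
    by apply/funext => t; rewrite raddf_sum.
  have : cbounded (fun t => \sum_a (normc (M t i a) ^+ 2)%:C); last by case.
  apply: (@cbounded_sum _ _ _ _ (fun a t => (normc (M t i a) ^+ 2)%:C)) => a.
  apply: cbounded_real; under eq_fun do rewrite expr2.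
  by apply: bounded_measurableM; exact: cbounded_normc.
have bsq (M : R -> C) : cbounded M -> bounded_measurable (fun t => normc (M t) ^+ 2).
  move=> bM; under eq_fun do rewrite expr2.
  by apply: bounded_measurableM; exact: cbounded_normc.
have bFD : cbounded (fun t => \sum_a (errf n p t *m G t) i a * (De t i a)^J).
  apply: (@cbounded_sum _ _ _ _ (fun a t => (errf n p t *m G t) i a * (De t i a)^J)) => a.
  exact: (cboundedM (bF i a) (cboundedJ (bDe i a))).
apply: (@le_trans _ _ (wint (2 * d) (fun t => \sum_a normc ((errf n p t *m G t) i a) ^+ 2))).
  apply: le_wint; [exact: dd|exact: bsq|exact: bs|].
  by move=> t; rewrite (bigD1 c)//= lerDl sumr_ge0// => a _; rewrite sqr_ge0.
apply: (@le_trans _ _ (wint (2 * d) (fun t => \sum_a normc (Gm t i a) ^+ 2))).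
  have bRe : bounded_measurable (fun t => complex.Re (\sum_a (errf n p t *m G t) i a * (De t i a)^J)).
    by case: bFD.
  have b2 : bounded_measurable (fun t => 2 * complex.Re (\sum_a (errf n p t *m G t) i a * (De t i a)^J)).
    by apply: bounded_measurableM => //; exact: bounded_measurable_cst.
  (* The new integrand exceeds the old one by the sum of |De|^2, since Gm = f G - De; the cross term
     integrates to 0 by [Z]. *)
  apply: (@le_trans _ _ (wint (2 * d) (fun t => \sum_a normc (Gm t i a) ^+ 2 +
     2 * complex.Re (\sum_a (errf n p t *m G t) i a * (De t i a)^J)))).
    apply: le_wint; [exact: dd|exact: bs|by apply: bounded_measurableD => //; exact: bs|].
    move=> t; rewrite raddf_sum mulr_sumr -big_split/=; apply: ler_sum => a _.
    rewrite FE mxBE; move: (_ i a) (Gm t i a) => x y.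
    rewrite !normc_sqrE; case: x y => x1 x2 [y1 y2] /=.
    rewrite -subr_ge0 (_ : _ - _ = (x1 - y1) ^+ 2 + (x2 - y2) ^+ 2); last by ring.
    by rewrite addr_ge0 ?sqr_ge0.
  rewrite wintD//; last exact: bs.
  rewrite wintZ//.
  by move: Z; rewrite wcintE => -[-> _]; rewrite mulr0 addr0.
have bg2 : bounded_measurable (fun t => cgauge d N t ^+ 2).
  by under eq_fun do rewrite expr2; apply: bounded_measurableM; exact: bounded_measurable_cgauge.
apply: (@le_trans _ _ (wint (2 * d) (fun t => q%:R * L ^+ 2 * cgauge d N t ^+ 2))).
  apply: le_wint; [exact: dd|exact: bs|by apply: bounded_measurableM => //; exact: bounded_measurable_cst|].
  move=> t; apply: (@le_trans _ _ (\sum_(a < q) (L * cgauge d N t) ^+ 2)).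
    have Lg : 0 <= L * cgauge d N t by apply: mulr_ge0; [rewrite !mulr_ge0|exact: cgauge_ge0].
    apply: ler_sum => a _; rewrite lerXn2r ?nnegrE ?normc_ge0//.
    have := mleM (mleM (HK4 t) (HK2 N t)) (HK1 t) i a.
    rewrite /Gm mxNE normcN => /le_trans; apply; rewrite le_eqVlt; apply/orP; left; apply/eqP.
    by rewrite /L; ring.
  by rewrite sumr_const card_ord exprMn -[leLHS]mulr_natl mulrA.
rewrite wintZ//.
rewrite ler_pdivlMr ?ltr0n//.
have nN : n%:R <= 2 * N.+1%:R :> R.
  by clear; rewrite -natrM ler_nat /N; lia.
have h := HK3 N; rewrite ler_pdivlMr ?ltr0n// in h.
have w0 : 0 <= wint (2 * d) (fun t => cgauge d N t ^+ 2).
  by apply: wint_ge0 => // t; exact: sqr_ge0.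
apply: (@le_trans _ _ (q%:R * L ^+ 2 * wint (2 * d) (fun t => cgauge d N t ^+ 2) * (2 * N.+1%:R))).
  by rewrite ler_wpM2l// !mulr_ge0 ?sqr_ge0.
apply: (@le_trans _ _ (2 * q%:R * (L ^+ 2 * K3))); last by rewrite lerDl.
have -> : q%:R * L ^+ 2 * wint (2 * d) (fun t => cgauge d N t ^+ 2) * (2 * N.+1%:R) =
  2 * q%:R * L ^+ 2 * (wint (2 * d) (fun t => cgauge d N t ^+ 2) * N.+1%:R) by ring.
by rewrite [leRHS]mulrA ler_wpM2l// !mulr_ge0 ?sqr_ge0.
Qed.

(* f w has no coefficient in [1, n], so f w Q^* Q has none in [1 + 2N, n - 2N]. *)
Lemma errf_coef : exists2 K : R, 0 < K & forall n p, (0 < n)%N ->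
  mann (2 * d) (fun t => polyb n p t *m G t *m adjmx (G t)) 1 n%:Z ->
  forall i l (j N : nat), (N + N < j)%N -> (j + (N + N) <= n)%N ->
  normc (wcint 0 (fun t => errf n p t i l * zpow (- j%:Z) t)) <=
    K * Num.sqrt (n%:R^-1 * N.+1%:R `^ (- (1 + 2 * d))).
Proof.
have [K1 K10 HK1] := mbounded_ex bG.
have [K2 K20 HK2] := truncQ_gauge.
have [K3 K30 HK3] := wint_cgauge_mixed d01.
have [K4 K40 HK4] := mbounded_ex bB.
have [K5 K50 HK5] := errf_energy.
(* K1 bounds G, K4 bounds B, and K2 the truncation error relative to the gauge: by [mixed], L times
   [mx] below bounds the entries of [Y]. *)
pose L := q%:R * (K1 * (2 * q%:R * (K4 * K2) + q%:R * K2 ^+ 2)).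
have L0 : 0 <= L by rewrite !(mulr_ge0, addr_ge0, sqr_ge0).
exists (q%:R * (2 * Num.sqrt (K5 * (L ^+ 2 * K3 + 1))) + 1).
  by rewrite ltr_wpDl// !mulr_ge0// sqrtr_ge0.
move=> n p n0 orthb i l j N jN Nn.
have bF : mbounded (fun t => errf n p t *m G t) by apply: mboundedM => //; exact: mbounded_errf.
pose V t := adjmx (symU t) *m symU t; pose W t := adjmx (truncQ N t) *m truncQ N t.
have bV : mbounded V by apply: mboundedM => //; exact: mbounded_adj.
have bW : mbounded W by apply: mboundedM => //; exact: mbounded_adj.
pose Y t := adjmx (G t) *m (V t - W t).
have bY : mbounded Y by apply: mboundedM; [exact: mbounded_adj|exact: mboundedB].
have bf : cbounded (fun t => errf n p t i l * zpow (- j%:Z) t).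
  by apply: cboundedM; [exact: mbounded_errf|exact: cbounded_zpow].
have bH := mbounded_errfGG n p; have aH := orthf n0 orthb.
have E1 t : errf n p t *m G t *m adjmx (G t) *m V t = (usym d t * (usym d t)^J) *: errf n p t.
  have h1 : adjmx (G t) *m adjmx (symU t) = (usym d t)^J *: 1%:M.
    by rewrite -adjmxM /symU -scalemxAl BG adjmxZ adjmx1.
  have h2 : G t *m symU t = usym d t *: 1%:M by rewrite /symU -scalemxAr GB.
  rewrite /V; move: h2 h1; move: (adjmx (symU t)) => A h2 h1; move: h2; move: (symU t) => A' h2.
  rewrite mulmxA -(mulmxA _ _ A) h1 -scalemxAr mulmx1 -scalemxAl -mulmxA h2.
  by rewrite -scalemxAr mulmx1 scalerA mulrC.
have I0 : wcint (2 * d) (fun t => (errf n p t *m G t *m adjmx (G t) *m W t) i l * zpow (- j%:Z) t) = 0.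
  have sW : mspec (2 * d) (- (N%:Z + N%:Z)) (N%:Z + N%:Z) W.
    by have := mspecM dd (mspec_truncQJ N) (mspec_truncQ N); rewrite addr0 add0r.
  have jj : (1 + (N%:Z + N%:Z) <= j%:Z <= n%:Z - (N%:Z + N%:Z)) by clear -jN Nn; apply/andP; split; lia.
  exact: (mannM dd bH aH sW i l jj).
have bHV : cbounded (fun t => (errf n p t *m G t *m adjmx (G t) *m V t) i l * zpow (- j%:Z) t).
  by apply: cboundedM; [exact: (mboundedM bH bV)|exact: cbounded_zpow].
have bHW : cbounded (fun t => (errf n p t *m G t *m adjmx (G t) *m W t) i l * zpow (- j%:Z) t).
  by apply: cboundedM; [exact: (mboundedM bH bW)|exact: cbounded_zpow].
(* Since |u|^2 times the weight is 1 almost everywhere, the plain coefficient of f is a weighted one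
   of f G G^* V; subtracting the vanishing [I0] turns V into V - W. *)
have -> : wcint 0 (fun t => errf n p t i l * zpow (- j%:Z) t) =
    \sum_c wcint (2 * d) (fun t => (errf n p t *m G t) i c * Y t c l * zpow (- j%:Z) t).
  rewrite -(wcint_cancel d01 bf).
  rewrite -(@wcint_sum R _ dd _ _ _ (fun c t => (errf n p t *m G t) i c * Y t c l * zpow (- j%:Z) t)); last first.
    by move=> c; apply: cboundedM; [exact: cboundedM|exact: cbounded_zpow].
  rewrite -[LHS]subr0 -[X in _ - X = _]I0 -wcintB//; last first.
    by apply: cboundedM => //; apply: cboundedM => //; exact: cboundedJ.
  congr wcint; apply/funext => t.
  transitivity ((errf n p t *m G t *m Y t) i l * zpow (- j%:Z) t); last first.
    by rewrite mxE mulr_suml.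
  have -> : usym d t * (usym d t)^J * (errf n p t i l * zpow (- j%:Z) t) =
      (errf n p t *m G t *m adjmx (G t) *m V t) i l * zpow (- j%:Z) t.
    by rewrite mulrA; congr (_ * _); rewrite E1 [RHS]mxE.
  rewrite -mulrBl -mxBE -mulmxBr; congr (_ * _).
  by rewrite /Y mulmxA.
rewrite (le_trans (normc_sum _ _ _))//.
pose S := Num.sqrt (n%:R^-1 * N.+1%:R `^ (- (1 + 2 * d))).
have nn0 : 0 < (n%:R : R)^-1 by rewrite invr_gt0 ltr0n.
have pp0 : 0 < (N.+1%:R : R) `^ (- (1 + 2 * d)) by rewrite powR_gt0.
apply: (@le_trans _ _ (\sum_(c < q) 2 * Num.sqrt (K5 * (L ^+ 2 * K3 + 1)) * S)); last first.
  rewrite sumr_const card_ord -[leLHS]mulr_natl mulrA ler_wpM2r ?sqrtr_ge0//.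
  by rewrite lerDl.
have LK0 : 0 < L ^+ 2 * K3 + 1 by rewrite ltr_wpDl// mulr_ge0 ?sqr_ge0// ltW.
apply: ler_sum => c _.
have -> : 2 * Num.sqrt (K5 * (L ^+ 2 * K3 + 1)) * S =
   2 * Num.sqrt ((K5 / n%:R) * ((L ^+ 2 * K3 + 1) * N.+1%:R `^ (- (1 + 2 * d)))).
  rewrite /S -mulrA -sqrtrM; last by rewrite mulr_ge0 ?(ltW K50)// ltW.
  by congr (_ * Num.sqrt _); ring.
pose mx t := normc (usym d t) * cgauge d N t + cgauge d N t ^+ 2.
have bmx : bounded_measurable mx.
  have bg := bounded_measurable_cgauge d N.
  apply: bounded_measurableD; first by apply: bounded_measurableM => //; exact: cbounded_normc.
  by under eq_fun do rewrite expr2; exact: bounded_measurableM.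
have bmx2 : bounded_measurable (fun t => mx t ^+ 2).
  by under eq_fun do rewrite expr2; exact: bounded_measurableM.
apply: (wcint_cauchy dd (h := fun t => normc ((errf n p t *m G t) i c)) (k := fun t => L * mx t)).
- by apply: cboundedM; [exact: cboundedM|exact: cbounded_zpow].
- exact: cbounded_normc.
- by apply: bounded_measurableM => //; exact: bounded_measurable_cst.
- move=> t; rewrite !normcM normc_zpow mulr1 ler_wpM2l ?normc_ge0//.
  have mU : mle (symU t) (normc (usym d t) * K4).
    by move=> a b; rewrite mxE normcM ler_wpM2l ?normc_ge0.
  have mE := HK2 N t.
  have := mleM (mle_adj (HK1 t)) (mleB (mleD (mleM (mle_adj mU) mE) (mleM (mle_adj mE) mU)) (mleM (mle_adj mE) mE)) c l.
  rewrite mixed opprB addrCA subrr addr0 => /le_trans; apply.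
  have u0 := normc_ge0 (usym d t); have g0 := cgauge_ge0 d N t.
  rewrite /mx; move: (normc _) (cgauge _ _ _) u0 g0 => x m x0 m0.
  rewrite /L -!mulrA ler_wpM2l// ler_wpM2l//.
  rewrite -subr_ge0.
  rewrite [X in 0 <= X](_ : _ = 2 * q%:R * K4 * K2 * m ^+ 2 + q%:R * K2 ^+ 2 * (x * m)); last by ring.
  by rewrite addr_ge0 ?mulr_ge0 ?sqr_ge0.
- by rewrite divr_gt0 ?ltr0n.
- by rewrite mulr_gt0.
- exact: HK5.
have -> : (fun t => (L * mx t) ^+ 2) = fun t => L ^+ 2 * mx t ^+ 2 by apply/funext => t; rewrite exprMn.
rewrite wintZ//; apply: le_trans (ler_wpM2l (sqr_ge0 L) (HK3 N)) _.
have := ltW pp0; move: (_ `^ _) => P P0; rewrite mulrDl mul1r mulrA lerDl.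
exact: P0.
Qed.

End baxter.

(** * Summation and lower bounds *)

Section power_sums.
Context {R : realType}.

(** Bernoulli's inequality gives (1 - s)(n+1)^{-s} <= (n+1)^{1-s} - n^{1-s}, a discrete comparison
    with the integral of x^{-s}, which telescopes. *)
Lemma sum_powRN (s : R) n : 0 < s < 1 ->
  \sum_(k < n) k.+1%:R `^ (- s) <= n%:R `^ (1 - s) / (1 - s).
Proof.
move=> /andP[s0 s1]; have h : 0 < 1 - s by rewrite subr_gt0.
elim: n => [|n IH]; first by rewrite big_ord0 divr_ge0 ?powR_ge0 ?(ltW h).
rewrite big_ord_recr/=; apply: le_trans (lerD IH (lexx _)) _.
have n0 : 0 < n.+1%:R :> R by rewrite ltr0n.
have s01 : 0 < 1 - s < 1 by rewrite h/=; lra.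
have t0 : 0 <= n%:R / n.+1%:R :> R by rewrite divr_ge0// ltW.
have p0 : 0 < n.+1%:R `^ (1 - s) :> R by rewrite powR_gt0.
have := ler_wpM2r (ltW p0) (powR_bernoulli s01 t0).
rewrite -(powRM _ t0 (ltW n0)) divfK ?gt_eqF// => B.
rewrite ler_pdivlMr// mulrDl divfK ?gt_eqF//.
have -> : n.+1%:R `^ (- s) = n.+1%:R `^ (1 - s) / n.+1%:R :> R.
  rewrite -[X in _ / X](powRr1 (ltW n0)) -powRN -powRD ?pnatr_eq0 ?implybT//.
  by congr (_ `^ _); ring.
apply: le_trans (lerD B (lexx _)) _.
rewrite le_eqVlt; apply/orP; left; apply/eqP.
rewrite -[n%:R](addrK 1) natr1; field.
by rewrite gt_eqF.
Qed.

(** The base is at least half of k + 1 or half of n - k, according to where the minimum is attained;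
    adding both bounds and reversing the second sum yields [sum_powRN] twice, with a factor 2
    each. *)
Lemma sum_powRN_min (s : R) n : 0 < s < 1 ->
  \sum_(k < n) (minn k./2 (n - k.+1)./2).+1%:R `^ (- s) <= 4 * (n%:R `^ (1 - s) / (1 - s)).
Proof.
move=> s01; have [s0 s1] := andP s01.
have H (m j : nat) : (0 < j)%N -> (j <= m.*2)%N -> m%:R `^ (- s) <= 2 * j%:R `^ (- s) :> R.
  move=> j0 jm; have m0 : (0 < m)%N by lia.
  rewrite !powRN ler_pdivlMr ?powR_gt0 ?ltr0n// mulrC ler_pdivrMr ?powR_gt0 ?ltr0n//.
  apply: (@le_trans _ _ ((m.*2)%:R `^ s)).
    by rewrite ge0_ler_powR ?nnegrE ?ler0n ?ler_nat// ltW.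
  rewrite -muln2 natrM powRM ?ler0n// mulrC ler_wpM2r ?powR_ge0//.
  by rewrite -[leRHS](powRr1 (ler0n R 2)) ler_powR ?ler1n// ltW.
apply: (@le_trans _ _ (\sum_(k < n) (2 * k.+1%:R `^ (- s) + 2 * (rev_ord k).+1%:R `^ (- s)))).
  apply: ler_sum => k _ /=; have kn := ltn_ord k.
  rewrite /minn; case: ifP => _.
    by rewrite ler_wpDr ?mulr_ge0 ?powR_ge0// H//; lia.
  by rewrite ler_wpDl ?mulr_ge0 ?powR_ge0// H//; lia.
rewrite big_split/= -!mulr_sumr.
have -> : \sum_(k < n) (n - k.+1).+1%:R `^ (- s) = \sum_(k < n) k.+1%:R `^ (- s) :> R.
  by rewrite [RHS](reindex_inj rev_ord_inj).
have := @sum_powRN s n s01; lra.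
Qed.

End power_sums.

(** * Coefficients of products, and partial sums of those of U *)

Section convolution.
Context {R : realType}.
Local Notation C := R[i].

Definition conv (e e' : nat -> C) j : C := \sum_(k < j.+1) e k * e' (j - k)%N.


(** Convergence at the one point 3/4 bounds the terms there, which leaves the ratio 2/3 =
    (1/2)/(3/4) on the circle of radius 1/2. *)
Lemma usum_half (e : nat -> C) (f : C -> C) :
  (forall z, normc z < 1 -> ccvg (psum e z) (f z)) ->
  usum (fun k => e k * (2^-1)%:C ^+ k) (fun t => f ((2^-1)%:C * cis t)).
Proof.
move=> ef.
have x1 : normc (3 / 4 : R)%:C < 1 by rewrite normcR ger0_norm; lra.
have [M HM] : exists M : R, forall k, normc (e k * (3 / 4 : R)%:C ^+ k) <= M.
  have [M HM] := ccvg_bounded (ef _ x1); exists (M + M) => k.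
  have -> : e k * (3 / 4 : R)%:C ^+ k = psum e (3 / 4 : R)%:C k.+1 - psum e (3 / 4 : R)%:C k.
    by rewrite psumS; ring.
  by rewrite (le_trans (le_normcB _ _))// lerD.
have r01 : 0 < (2 / 3 : R) < 1 by apply/andP; split; lra.
apply: (usum_geometric (C := M) r01) => [k|t].
  have -> : e k * (2^-1)%:C ^+ k = (e k * (3 / 4 : R)%:C ^+ k) * ((2 / 3 : R)%:C ^+ k).
    rewrite -mulrA -exprMn -rmorphM; by congr (_ * _%:C ^+ _); field.
  rewrite normcM [X in _ * X <= _]normcX normcR ger0_norm; last by lra.
  by rewrite ler_wpM2r ?exprn_ge0//; lra.
have z1 : normc ((2^-1)%:C * cis t : C) < 1.
  by rewrite normcM normcR normc_cis mulr1 ger0_norm; lra.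
by move=> eps /(ef _ z1)[N HN]; exists N => n /HN; rewrite psum_scale.
Qed.

(** Uniqueness of power series coefficients, read off as Fourier coefficients on |z| = 1/2: the
    series are only assumed to converge on the open disk, whence the smaller circle. *)
Lemma product_coef (e e' a : nat -> C) (f f' : C -> C) :
  (forall z, normc z < 1 -> ccvg (psum e z) (f z)) ->
  (forall z, normc z < 1 -> ccvg (psum e' z) (f' z)) ->
  (forall z, normc z < 1 -> ccvg (psum a z) (f z * f' z)) ->
  forall n, a n = conv e e' n.
Proof.
move=> /usum_half He /usum_half He' /usum_half Ha n.
have := fourier_coef n%:Z Ha; have := fourier_coefM n He' He.
move=> -> h; have p0 : (2 * pi)%:C != 0 :> C.
  by rewrite -normc_eq0 normcR gt_eqF// normr_gt0 mulf_neq0// gt_eqF// pi_gt0.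
have := mulfI p0 h => E.
have q0 : (2^-1)%:C ^+ n != 0 :> C.
  by rewrite expf_neq0// -normc_eq0 normcR gt_eqF// normr_gt0 invr_neq0.
apply: (mulIf q0); rewrite -E /conv mulr_suml; apply: eq_bigr => k _.
have kn : (k <= n)%N by rewrite -ltnS ltn_ord.
have -> : (2^-1 : R)%:C ^+ n = (2^-1 : R)%:C ^+ k * (2^-1)%:C ^+ (n - k) by rewrite -exprD subnKC.
by ring.
Qed.

Section binomial.
Variable d : R.
Hypothesis d01 : 0 < d < 2^-1.

Let d1 : 0 < d < 1. Proof. by case/andP: d01 => -> /lt_trans; apply; lra. Qed.

Lemma sum_conv_binc (e : nat -> C) n :
  \sum_(j < n.+1) conv (binc d) e j = \sum_(m < n.+1) e m * (binsum d (n - m))%:C.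
Proof.
have rev j : conv (binc d) e j = \sum_(m < j.+1) e m * binc d (j - m).
  rewrite /conv (reindex_inj rev_ord_inj)/=; apply: eq_bigr => k _.
  have kj : (k <= j)%N by rewrite -ltnS ltn_ord.
  by rewrite subSS subKn// [LHS]mulrC.
elim: n => [|n IH].
  by rewrite !big_ord_recl !big_ord0 rev big_ord_recl big_ord0 !addr0 /binc /binsum/= big_ord0 bin0.
rewrite big_ord_recr/= IH rev [X in _ + X]big_ord_recr [RHS]big_ord_recr/= addrA -big_split/=.
congr (_ + _); last by rewrite subnn /binc /binsum bin0 big_ord0.
apply: eq_bigr => k _; have kn : (k <= n)%N by rewrite -ltnS ltn_ord.
by rewrite -mulrDr subSn// -sum_bin -sum_bin [in RHS]big_ord_recr rmorphD.
Qed.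

(** Each step decreases [binsum] by at most [binsum d p / p.+1], because d < 1 and [binsum] is
    decreasing. *)
Lemma binsum_gap p m :
  p.+1%:R * (binsum d p - binsum d (p + m)) <= m%:R * binsum d p /\
  0 <= binsum d p - binsum d (p + m).
Proof.
have [d0 d2] := andP d1.
elim: m => [|m [IH1 IH2]]; first by rewrite addn0 subrr mulr0 mul0r.
rewrite addnS binsumS.
have b0 := binsum_gt0 d1 (p + m); have bp := binsum_gt0 d1 p.
have n0 : 0 < (p + m).+1%:R :> R by rewrite ltr0n.
have h : binsum d (p + m) * (d / (p + m).+1%:R) <= binsum d p / p.+1%:R.
  apply: ler_pM; rewrite ?(ltW b0) ?divr_ge0 ?(ltW d0)//; first by rewrite -subr_ge0.
  apply: (@le_trans _ _ (1 / (p + m).+1%:R)).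
    by rewrite ler_wpM2r ?invr_ge0 ?(ltW n0) ?(ltW d2).
  by rewrite mul1r lef_pV2 ?posrE ?ltr0n// ler_nat ltnS leq_addr.
have h0 : 0 <= binsum d (p + m) * (d / (p + m).+1%:R).
  by rewrite mulr_ge0 ?(ltW b0)// divr_ge0// ltW.
move: h; rewrite ler_pdivlMr ?ltr0n// => h.
move: h h0 IH1 IH2; rewrite (mulrBr (binsum d (p + m))) mulr1 -[m.+1%:R]natr1.
move: (binsum d (p + m) * _) => y; move: (binsum d (p + m)) (p.+1%:R) => z P *.
by split; lra.
Qed.

(** In each step (m+2) d / (p+m+1) <= (m+2) / (2 (m+1)) <= 1 by d < 1/2, hence (m+1)/(m+2) <= 1 -
    d/(p+m+1). *)
Lemma binsum_ratio p m : binsum d p <= m.+1%:R * binsum d (p + m).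
Proof.
have [d0 d2] := andP d01.
elim: m => [|m IH]; first by rewrite addn0 mul1r.
rewrite addnS binsumS (le_trans IH)//.
have b0 := binsum_gt0 d1 (p + m).
rewrite mulrCA mulrC ler_wpM2l ?(ltW b0)//.
have n0 : 0 < (p + m).+1%:R :> R by rewrite ltr0n.
have h : m.+2%:R * (d / (p + m).+1%:R) <= 1.
  rewrite mulrA ler_pdivrMr// mul1r.
  apply: (@le_trans _ _ (m.+2%:R * 2^-1)); first by rewrite ler_wpM2l// ltW.
  rewrite ler_pdivrMr// -natrM ler_nat; lia.
move: h; rewrite -[m.+2%:R]natr1; move: (d / _) (m.+1%:R) => y M; lra.
Qed.

(** As e decays exponentially, [binsum d (n - m)] may be replaced by [binsum d n] in
    [sum_conv_binc]; the remaining sum of e is close to b. *)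
Lemma sum_conv_asymp (e : nat -> C) (b : C) : expdec e -> ccvg (psum e 1) b ->
  exists2 K : R, 0 <= K & forall n,
    normc (\sum_(j < n.+1) conv (binc d) e j - (binsum d n)%:C * b) <= K * binsum d n / n.+1%:R.
Proof.
move=> [K [rho [r01 eK]]] eb.
have [r0 r1] := andP r01.
have K0 : 0 <= K by have := le_trans (normc_ge0 _) (eK 0%N); rewrite expr0 mulr1.
(* 5 = 3 + 2: three powers of m + 1 are lost in comparing [binsum d (n - m)] with [binsum d n], two
   more make the sum over m converge. *)
have [M HM] := natpow_expr_bound 5 r01.
have M0 : 0 <= M by have := HM 0%N; rewrite expr0 mulr1 expr1n => /(le_trans ler01).
have q0 : 0 < 1 - rho by rewrite subr_gt0.
exists (K * M * 2 + K * M / (1 - rho)).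
  by rewrite addr_ge0 ?mulr_ge0 ?invr_ge0 ?(ltW q0).
move=> n; rewrite sum_conv_binc.
have b0 := binsum_gt0 d1 n.
have n0 : 0 < n.+1%:R :> R by rewrite ltr0n.
have -> : \sum_(m < n.+1) e m * (binsum d (n - m))%:C - (binsum d n)%:C * b =
  (\sum_(m < n.+1) e m * (binsum d (n - m) - binsum d n)%:C) - (binsum d n)%:C * (b - psum e 1 n.+1).
  have -> : \sum_(m < n.+1) e m * (binsum d (n - m) - binsum d n)%:C =
     \sum_(m < n.+1) e m * (binsum d (n - m))%:C - psum e 1 n.+1 * (binsum d n)%:C.
    rewrite /psum mulr_suml -sumrB; apply: eq_bigr => m _.
    by rewrite expr1n mulr1 rmorphB mulrBr.
  by ring.
rewrite (le_trans (le_normcB _ _))// mulrDl mulrDl lerD//.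
  rewrite (le_trans (normc_sum _ _ _))//.
  apply: (@le_trans _ _ (\sum_(m < n.+1) (K * M * binsum d n / n.+1%:R) * (m.+1%:R ^+ 2)^-1)); last first.
    rewrite -mulr_sumr (le_trans (ler_wpM2l _ (@sum_inv_sqr R n.+1)))//.
      by rewrite !mulr_ge0 ?invr_ge0 ?(ltW b0) ?(ltW n0).
    by rewrite le_eqVlt; apply/orP; left; apply/eqP; ring.
  apply: ler_sum => m _; have mn : (m <= n)%N by rewrite -ltnS ltn_ord.
  have [g1 g2] := binsum_gap (n - m) m; have g3 := binsum_ratio (n - m) m.
  rewrite subnK// in g1 g2 g3.
  rewrite normcM normcR ger0_norm//.
  have p0 : 0 < (n - m).+1%:R :> R by rewrite ltr0n.
  have m0 : 0 < m.+1%:R :> R by rewrite ltr0n.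
  (* One factor m + 1 each from n + 1 <= (m + 1)(n - m + 1), [binsum_gap] and [binsum_ratio]. *)
  have h : n.+1%:R * (binsum d (n - m) - binsum d n) <= m.+1%:R ^+ 3 * binsum d n.
    apply: (@le_trans _ _ (m.+1%:R * ((n - m).+1%:R * (binsum d (n - m) - binsum d n)))).
      by rewrite mulrA ler_wpM2r// -natrM ler_nat; clear -mn; nia.
    apply: (@le_trans _ _ (m.+1%:R * (m.+1%:R * (m.+1%:R * binsum d n)))); last first.
      by rewrite le_eqVlt; apply/orP; left; apply/eqP; ring.
    rewrite ler_wpM2l// (le_trans g1)//.
    apply: ler_pM; rewrite ?ler0n ?ler_nat//.
    exact: ltW (binsum_gt0 d1 _).
  rewrite mulrAC ler_pdivlMr// mulrAC.
  apply: (@le_trans _ _ ((K * rho ^+ m) * (m.+1%:R ^+ 3 * binsum d n))).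
    by rewrite -mulrA ler_pM ?normc_ge0 ?mulr_ge0 ?(ltW n0)// mulrC.
  have m2 : 0 < m.+1%:R ^+ 2 :> R by rewrite exprn_gt0.
  rewrite -!mulrA ler_wpM2l// mulrCA [leRHS]mulrCA -subr_ge0.
  rewrite [X in 0 <= X](_ : _ = binsum d n / m.+1%:R ^+ 2 * (M - m.+1%:R ^+ 5 * rho ^+ m)); last first.
    by field; rewrite gt_eqF.
  by rewrite mulr_ge0 ?divr_ge0 ?(ltW b0) ?(ltW m2)// subr_ge0.
rewrite normcM normcR ger0_norm ?(ltW b0)//.
have eb' : ccvg (psum e (cis 0)) b by rewrite cis0.
have := geometric_tail n.+1 r01 eK eb'; rewrite cis0 => /(ler_wpM2l (ltW b0))/le_trans; apply.
have h : rho ^+ n.+1 <= M / n.+1%:R.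
  rewrite ler_pdivlMr// mulrC; apply: le_trans (HM n).
  rewrite ler_pM ?ler0n ?exprn_ge0 ?(ltW r0)//.
    by rewrite -[leLHS]expr1 ler_weXn2l ?ler1n.
  by rewrite exprS ler_piMl ?exprn_ge0 ?(ltW r0) ?(ltW r1).
apply: (@le_trans _ _ (binsum d n * (K * (M / n.+1%:R) / (1 - rho)))).
  rewrite ler_wpM2l ?(ltW b0)// ler_wpM2r ?invr_ge0 ?(ltW q0)//.
  by rewrite ler_wpM2l.
by rewrite le_eqVlt; apply/orP; left; apply/eqP; ring.
Qed.

(** The partial sums are close to [binsum d n * r], of order n^{-d}, and become much smaller later
    on: the terms in between must make up the difference. *)
Lemma tail_lower (x : nat -> C) (r : C) (K : R) : r != 0 -> 0 <= K ->
  (forall n, normc (\sum_(j < n.+1) x j - (binsum d n)%:C * r) <= K * binsum d n / n.+1%:R) ->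
  exists2 c : R, 0 < c & forall n, (0 < n)%N -> exists N,
    c * n%:R `^ (- d) <= \sum_(n.+1 <= j < N.+1) normc (x j).
Proof.
move=> r0 K0 xr; have nr0 : 0 < normc r by rewrite normc_gt0.
have [d0 d2] := andP d1.
have [n0 Hn0] : exists n0, forall n, (n0 <= n)%N -> K / n.+1%:R <= normc r / 4.
  exists (Num.truncn (4 * K / normc r)).+1 => n nn.
  have : 4 * K / normc r < n.+1%:R.
    apply: lt_le_trans (truncnS_gt _) _.
    by rewrite ler_nat ltnW// ltnS.
  rewrite ltr_pdivrMr// => h; rewrite ler_pdivrMr ?ltr0n//; move: h; lra.
have S n : (n0 <= n)%N -> normc (\sum_(j < n.+1) x j - (binsum d n)%:C * r) <= normc r / 4 * binsum d n.
  move=> nn; rewrite (le_trans (xr n))// mulrAC ler_wpM2r ?(ltW (binsum_gt0 d1 n))//.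
  exact: Hn0.
(* n0.+2 extends the estimate to n < n0, through max(n, n0) + 1 <= (n0 + 2) n; 1 - d is the constant
   of [binsum_lb]. *)
exists (normc r / 2 * ((1 - d) * (n0.+2)%:R `^ (- d))).
  by rewrite !mulr_gt0 ?divr_gt0 ?powR_gt0 ?subr_gt0.
move=> n npos; pose n1 := maxn n n0.
have b1 := binsum_gt0 d1 n1.
(* The index m is taken so large that [binsum d m] is at most a fifth of [binsum d n1]; with
   relative errors of a quarter, the fraction left is 1 - 1/4 - 1/5 - 1/20 = 1/2. *)
have [N /(_ (maxn n1 N) (leq_maxr _ _)) HN] := powRN_lt_eps d0 (divr_gt0 b1 (ltr0Sn R 4)).
move: HN; set m := maxn n1 N => HN.
have n1m : (n1 <= m)%N by rewrite leq_maxl.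
have nn1 : (n <= n1)%N by rewrite leq_maxl.
have n01 : (n0 <= n1)%N by rewrite leq_maxr.
have bm := binsum_gt0 d1 m.
have bm5 : binsum d m <= binsum d n1 / 5 by rewrite (le_trans (binsum_ub d1 m))// ltW.
exists m; rewrite (big_cat_nat (n := n1.+1)) ?ltnS//=.
apply: (@le_trans _ _ (\sum_(n1.+1 <= j < m.+1) normc (x j))); last first.
  by rewrite lerDr sumr_ge0// => j _; exact: normc_ge0.
apply: (@le_trans _ _ (normc r / 2 * binsum d n1)).
  rewrite -(mulrA (normc r / 2)) ler_wpM2l ?divr_ge0 ?(ltW nr0)//.
  apply: le_trans (binsum_lb d1 n1).
  rewrite -(mulrA (1 - d)) ler_wpM2l ?subr_ge0 ?(ltW d2)//.
  rewrite -powRM ?ler0n// -natrM !powRN lef_pV2 ?posrE ?powR_gt0 ?ltr0n ?muln_gt0//.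
  by rewrite ge0_ler_powR ?nnegrE ?ler0n ?(ltW d0)// ler_nat /n1; clear -npos; nia.
apply: le_trans (normc_sum _ _ _).
have -> : \sum_(n1.+1 <= j < m.+1) x j =
  (\sum_(j < m.+1) x j - (binsum d m)%:C * r) - (\sum_(j < n1.+1) x j - (binsum d n1)%:C * r) +
   (binsum d m)%:C * r - (binsum d n1)%:C * r.
  have -> : \sum_(j < m.+1) x j = \sum_(j < n1.+1) x j + \sum_(n1.+1 <= j < m.+1) x j.
    by rewrite -!(big_mkord xpredT x) -big_cat_nat.
  by ring.
have h1 := S _ (leq_trans n01 n1m); have h2 := S _ n01.
move: h1 h2; set A := _ - _; set A' := _ - _ => h1 h2.
have t1 : normc ((binsum d n1)%:C * r) = binsum d n1 * normc r.
  by rewrite normcM normcR ger0_norm// ltW.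
have t2 : normc ((binsum d m)%:C * r) = binsum d m * normc r.
  by rewrite normcM normcR ger0_norm// ltW.
have D (y z : C) : normc z <= normc (y - z) + normc y.
  by have := le_normcB y (y - z); rewrite subKr addrC.
have := D (A - A' + (binsum d m)%:C * r) ((binsum d n1)%:C * r).
have := le_normcD (A - A') ((binsum d m)%:C * r).
have := le_normcB A A'.
rewrite t1 t2.
move: h1 h2; set u := normc A; set u' := normc A'.
have := ler_wpM2l (ltW nr0) bm5; move: nr0 b1 bm.
move: (normc r) (binsum d n1) (binsum d m) => *; nra.
Qed.

End binomial.

End convolution.

(** * Upper bound for the sum of the coefficient errors *)

Section baxter_upper.
Context {R : realType}.
Local Notation C := R[i].
Variables (d : R) (q : nat) (G B : R -> 'M[C]_q) (Gc Bc : 'I_q -> 'I_q -> nat -> C) (c0 : 'M[C]_q).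
Hypotheses (d01 : 0 < d < 2^-1) (GB : forall t, G t *m B t = 1%:M) (BG : forall t, B t *m G t = 1%:M).
Hypotheses (HB : forall i j, usum (Bc i j) (fun t => B t i j)) (HBd : forall i j, expdec (Bc i j)).
Hypotheses (HG : forall i j, usum (Gc i j) (fun t => G t i j)).
Hypothesis c0B : c0 *m (\matrix_(i, j) Bc i j 0) = 1%:M.

Let zero01 : 0 <= (0 : R) < 1. Proof. by rewrite lexx ltr01. Qed.

(** An entry of phi_{n,j} - phi_j when p = phi_n: the sum is the entry of - phi_j, by
    [neg_inverse_conv]. *)
Definition errcoef (p : nat -> 'M[C]_q) i l j : C :=
  p j i l + \sum_c c0 i c * conv (binc d) (Bc c l) j.

Lemma errf_fourier n p i l j : (0 < j)%N -> (j <= n)%N ->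
  wcint 0 (fun t => errf d B c0 n p t i l * zpow (- j%:Z) t) = - (2 * pi)%:C * errcoef p i l j.
Proof.
move=> j0 jn.
have bz k : cbounded (zpow k : R -> C) by exact: cbounded_zpow.
have bu := cbounded_usym d01; have bB c := usum_cbounded (HB c l).
pose T1 t : C := (1%:M : 'M[C]_q) i l * zpow (- j%:Z) t.
pose T2 t : C := \sum_(1 <= k < n.+1) p k i l * zpow (k%:Z - j%:Z) t.
pose T3 t : C := \sum_c c0 i c * (usym d t * B t c l * zpow (- j%:Z) t).
have E : (fun t => errf d B c0 n p t i l * zpow (- j%:Z) t) = fun t => T1 t - T2 t - T3 t.
  apply/funext => t; rewrite /errf /polyb !mxBE summxE mulrBl mulrBl; congr (_ - _ - _).
    rewrite mulr_suml; apply: eq_bigr => k _.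
    by rewrite mxE zpowD; ring.
  rewrite [(c0 *m _) i l]mxE mulr_suml /T3; apply: eq_bigr => c _.
  by rewrite /symU mxE; ring.
have b1 : cbounded T1 by apply: cboundedM => //; exact: cbounded_cst.
have b2' k : cbounded (fun t => p k i l * zpow (k%:Z - j%:Z) t).
  by apply: cboundedM => //; exact: cbounded_cst.
have b2 : cbounded T2 by apply: (@cbounded_sum _ _ _ _ (fun k t => p k i l * zpow (k%:Z - j%:Z) t)).
have b3'' c : cbounded (fun t => usym d t * B t c l * zpow (- j%:Z) t).
  by apply: cboundedM => //; exact: cboundedM.
have b3' c : cbounded (fun t => c0 i c * (usym d t * B t c l * zpow (- j%:Z) t)).
  by apply: cboundedM => //; exact: cbounded_cst.
have b3 : cbounded T3.
  by apply: (@cbounded_sum _ _ _ _ (fun c t => c0 i c * (usym d t * B t c l * zpow (- j%:Z) t))).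
rewrite E wcintB//; last exact: cboundedB.
rewrite wcintB// wcintZ// wcint_zpow oppr_eq0 eqz_nat gtn_eqF// mulr0 sub0r.
rewrite (@wcint_sum R _ zero01 _ _ _ (fun k t => p k i l * zpow (k%:Z - j%:Z) t))//.
rewrite (bigD1_seq j) ?iota_uniq ?mem_index_iota ?j0 ?ltnS//=.
rewrite wcintZ// wcint_zpow subrr eqxx big1 ?addr0; last first.
  by move=> k kj; rewrite wcintZ// wcint_zpow subr_eq0 eqz_nat (negbTE kj) mulr0.
rewrite (@wcint_sum R _ zero01 _ _ _ (fun c t => c0 i c * (usym d t * B t c l * zpow (- j%:Z) t)))//.
rewrite (eq_bigr (fun c => c0 i c * ((2 * pi)%:C * conv (binc d) (Bc c l) j))); last first.
  by move=> c _; rewrite wcintZ// (fourier_coefM j (HB c l) (usum_usym d01)).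
have -> : \sum_c c0 i c * ((2 * pi)%:C * conv (binc d) (Bc c l) j) =
    (2 * pi)%:C * \sum_c c0 i c * conv (binc d) (Bc c l) j.
  by rewrite mulr_sumr; apply: eq_bigr => c _; rewrite mulrCA.
by rewrite /errcoef; ring.
Qed.

Lemma sum_errcoef : exists2 K : R, 0 < K & forall n p, (0 < n)%N ->
  mann (2 * d) (fun t => polyb n p t *m G t *m adjmx (G t)) 1 n%:Z ->
  forall i l, \sum_(1 <= j < n.+1) normc (errcoef p i l j) <= K * n%:R `^ (- d).
Proof.
have [K K0 HK] := errf_coef d01 GB BG HB HBd HG c0B.
have [d0 d2] := andP d01.
have s01 : 0 < 2^-1 + d < 1 by apply/andP; split; lra.
have s1 : 0 < 1 - (2^-1 + d) by lra.
have pi0 : 0 < 2 * pi :> R by rewrite mulr_gt0 ?pi_gt0.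
exists (K * (4 / (1 - (2^-1 + d))) / (2 * pi)); first by rewrite divr_gt0// mulr_gt0// divr_gt0.
move=> n p n0 orthb i l; have nn0 : 0 < n%:R :> R by rewrite ltr0n.
(* With j = k + 1, this N is the largest truncation order that [errf_coef] allows; its square root
   splits into n^{-1/2} and N^{-1/2-d}. *)
have H k : (k < n)%N -> normc (errcoef p i l k.+1) <=
    K / (2 * pi) * n%:R `^ (- 2^-1) * (minn k./2 (n - k.+1)./2).+1%:R `^ (- (2^-1 + d)).
  move=> kn; set N := minn _ _.
  have := HK n p n0 orthb i l k.+1 N.
  rewrite errf_fourier// normcM normcN normcR ger0_norm ?(ltW pi0)//.
  have h1 : (N + N < k.+1)%N by rewrite /N; clear -kn; lia.
  have h2 : (k.+1 + (N + N) <= n)%N by rewrite /N; clear -kn; lia.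
  move=> /(_ h1 h2) h.
  rewrite -[leRHS]mulrA mulrAC ler_pdivlMr// mulrC; apply: (le_trans h).
  have -> : n%:R^-1 * N.+1%:R `^ (- (1 + 2 * d)) = (n%:R `^ (- 2^-1) * N.+1%:R `^ (- (2^-1 + d))) ^+ 2 :> R.
    rewrite exprMn -!powR_mulrn ?powR_ge0// -!powRrM -powR_inv1 ?(ltW nn0)//.
    by congr (_ `^ _ * _ `^ _); field.
  by rewrite sqrtr_sqr ger0_norm ?mulr_ge0 ?powR_ge0.
rewrite big_add1/= big_mkord.
apply: (@le_trans _ _ (\sum_(k < n) K / (2 * pi) * n%:R `^ (- 2^-1) * (minn k./2 (n - k.+1)./2).+1%:R `^ (- (2^-1 + d)))).
  by apply: ler_sum => k _; exact: H.
rewrite -mulr_sumr.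
have P0 : 0 <= K / (2 * pi) * n%:R `^ (- 2^-1) by rewrite mulr_ge0 ?powR_ge0// divr_ge0// ltW.
apply: le_trans (ler_wpM2l P0 (sum_powRN_min n s01)) _.
have -> : n%:R `^ (- d) = n%:R `^ (- 2^-1) * n%:R `^ (1 - (2^-1 + d)) :> R.
  by rewrite -powRD ?pnatr_eq0 ?gtn_eqF ?implybT//; congr (_ `^ _); field.
by rewrite le_eqVlt; apply/orP; left; apply/eqP; ring.
Qed.

End baxter_upper.

(** * Spectral norm and covariances *)

Section spectral_norm_bounds.
Context {R : realType} (q : nat).
Implicit Types (A : 'M[R[i]]_q) (x : 'cV[R[i]]_q).

Lemma normc_le_l2norm x i : normc (x i 0) <= l2norm x.
Proof.
rewrite /l2norm -[leLHS]ger0_norm ?normc_ge0// -sqrtr_sqr ler_wsqrtr//.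
by rewrite (bigD1 i)//= lerDl sumr_ge0// => k _; exact: sqr_ge0.
Qed.

Lemma l2norm_le_sum x : l2norm x <= \sum_i normc (x i 0).
Proof.
have s0 : 0 <= \sum_i normc (x i 0) by apply: sumr_ge0 => k _; exact: normc_ge0.
rewrite /l2norm -[leRHS]ger0_norm// -sqrtr_sqr ler_wsqrtr// expr2 mulr_suml.
apply: ler_sum => i _; rewrite expr2 ler_wpM2l ?normc_ge0//.
by rewrite (bigD1 i)//= lerDl sumr_ge0// => k _; exact: normc_ge0.
Qed.

Lemma l2norm_mul_le A x : l2norm x <= 1 -> l2norm (A *m x) <= \sum_i \sum_j normc (A i j).
Proof.
move=> x1; apply: (le_trans (l2norm_le_sum _)); apply: ler_sum => i _.
rewrite mxE (le_trans (normc_sum _ _ _))//; apply: ler_sum => j _.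
by rewrite normcM ler_piMr ?normc_ge0// (le_trans (normc_le_l2norm x j)).
Qed.

Lemma spectral_norm_le_sum A : spectral_norm A <= \sum_i \sum_j normc (A i j).
Proof.
apply: ge_sup; last by move=> _ [x /= x1 <-]; exact: l2norm_mul_le.
exists (l2norm (A *m 0)), 0 => //=.
rewrite /l2norm big1 ?sqrtr0// => i _.
by rewrite mxE normc0 expr0n.
Qed.

(** Apply A to the j-th basis vector. [l2norm_mul_le] bounds the set of norms, which is what makes
    [sup] an upper bound. *)
Lemma normc_le_spectral_norm A i j : normc (A i j) <= spectral_norm A.
Proof.
pose x : 'cV[R[i]]_q := delta_mx j 0.
have x1 : l2norm x <= 1.
  rewrite /l2norm (bigD1 j)//= mxE !eqxx normc1 expr1n big1 ?addr0 ?sqrtr1//.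
  by move=> k kj; rewrite mxE (negbTE kj) normc0 expr0n.
have -> : A i j = (A *m x) i 0.
  rewrite mxE (bigD1 j)//= big1 ?addr0 => [|k kj]; rewrite mxE ?eqxx ?mulr1//.
  by rewrite (negbTE kj) mulr0.
apply: (le_trans (normc_le_l2norm _ _)).
apply: ub_le_sup; last by exists x.
by exists (\sum_i \sum_j normc (A i j)) => _ [y /= y1 <-]; exact: l2norm_mul_le.
Qed.

End spectral_norm_bounds.

Section cintegral_linear.
Context {R : realType} {disp : measure_display} {T : measurableType disp}.
Variable mu : {measure set T -> \bar R}.
Variable D : set T.
Hypothesis mD : measurable D.
Implicit Types f g : T -> R[i].

Let integrableZ a (h : T -> R) : mu.-integrable D (EFin \o h) ->
  mu.-integrable D (EFin \o (fun t => a * h t)).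
Proof. by move=> ih; apply: eq_integrable (integrableZl _ a ih) => //. Qed.

Lemma cintegrableD f g : cintegrable mu D f -> cintegrable mu D g ->
  cintegrable mu D (fun t => f t + g t).
Proof.
move=> [f1 f2] [g1 g2]; split.
  apply: eq_integrable (integrableD mD f1 g1) => // t _ /=.
  by case: (f t) (g t) => ? ? [].
apply: eq_integrable (integrableD mD f2 g2) => // t _ /=.
by case: (f t) (g t) => ? ? [].
Qed.

Lemma cintegralD f g : cintegrable mu D f -> cintegrable mu D g ->
  cintegral mu D (fun t => f t + g t) = cintegral mu D f + cintegral mu D g.
Proof.
move=> [f1 f2] [g1 g2]; rewrite /cintegral; apply: complex_eqP => /=.
  rewrite -RintegralD//; apply: eq_Rintegral => t _.
  by case: (f t) (g t) => ? ? [].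
rewrite -RintegralD//; apply: eq_Rintegral => t _.
by case: (f t) (g t) => ? ? [].
Qed.

Lemma cintegrableZ c f : cintegrable mu D f -> cintegrable mu D (fun t => c * f t).
Proof.
move=> [f1 f2]; split.
  apply: eq_integrable (integrableB mD (integrableZ (complex.Re c) f1) (integrableZ (complex.Im c) f2)) => // t _ /=.
  by rewrite Rec_mul.
apply: eq_integrable (integrableD mD (integrableZ (complex.Re c) f2) (integrableZ (complex.Im c) f1)) => // t _ /=.
by rewrite Imc_mul.
Qed.

Lemma cintegralZ c f : cintegrable mu D f ->
  cintegral mu D (fun t => c * f t) = c * cintegral mu D f.
Proof.
move=> [f1 f2]; rewrite /cintegral; apply: complex_eqP; rewrite ?Rec_mul ?Imc_mul/=.
  rewrite -!RintegralZl// -RintegralB//; [|exact: integrableZ..].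
  by apply: eq_Rintegral => t _; rewrite Rec_mul.
rewrite -!RintegralZl// -RintegralD//; [|exact: integrableZ..].
by apply: eq_Rintegral => t _; rewrite Imc_mul.
Qed.

Lemma cintegrable0 : cintegrable mu D (fun=> 0).
Proof. by split; exact: integrable0. Qed.

Lemma cintegral0 : cintegral mu D (fun=> 0) = 0.
Proof. by rewrite -[RHS](mul0r (cintegral mu D (fun=> 0))) -(cintegralZ 0 cintegrable0) mul0r. Qed.

Lemma cintegral_sum (I : Type) (l : seq I) (F : I -> T -> R[i]) :
  (forall k, cintegrable mu D (F k)) ->
  cintegrable mu D (fun t => \sum_(k <- l) F k t) /\
  cintegral mu D (fun t => \sum_(k <- l) F k t) = \sum_(k <- l) cintegral mu D (F k).
Proof.
move=> HF; elim: l => [|k l [IH1 IH2]].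
  under eq_fun do rewrite big_nil.
  by rewrite big_nil; split; [exact: cintegrable0|exact: cintegral0].
under eq_fun do rewrite big_cons.
split; first exact: cintegrableD.
by rewrite big_cons cintegralD// IH2.
Qed.

End cintegral_linear.

Lemma square_integrable_mulJ {R : realType} {disp : measure_display} {T : measurableType disp}
  (P : probability T R) (f g : T -> R[i]) :
  square_integrable P f -> square_integrable P g ->
  cintegrable P setT (fun t => f t * (g t)^J).
Proof.
move=> [[mf1 mf2] fi] [[mg1 mg2] gi].
have dom (h : T -> R) : measurable_fun setT h ->
   (forall t, `|h t| <= normc (f t) * normc (g t)) -> P.-integrable setT (EFin \o h).
  move=> mh hb; apply: (le_integrable _ _ _ (integrableD measurableT fi gi)) => //.
    exact/measurable_EFinP.
  move=> t _ /=; rewrite lee_fin (le_trans (hb t))// ger0_norm ?addr_ge0 ?sqr_ge0//.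
  have := sqr_ge0 (normc (f t) - normc (g t)).
  have := sqr_ge0 (normc (f t)); have := sqr_ge0 (normc (g t)).
  move: (normc _) (normc _) => a b; nra.
split; apply: dom.
- have -> : (fun t => complex.Re (f t * (g t)^J)) = fun t =>
    complex.Re (f t) * complex.Re (g t) + complex.Im (f t) * complex.Im (g t).
    by apply/funext => t; case: (f t) (g t) => ? ? [? ?] /=; ring.
  by apply: measurable_funD; exact: measurable_funM.
- by move=> t; rewrite (le_trans (ler_abs_Re _))// normcM normcJ.
- have -> : (fun t => complex.Im (f t * (g t)^J)) = fun t =>
    complex.Im (f t) * complex.Re (g t) - complex.Re (f t) * complex.Im (g t).
    by apply/funext => t; case: (f t) (g t) => ? ? [? ?] /=; ring.
  by apply: measurable_funB; exact: measurable_funM.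
- by move=> t; rewrite (le_trans (ler_abs_Im _))// normcM normcJ.
Qed.

(** * From the projection to the normal equations *)

Section predictor.
Context {R : realType} {disp : measure_display} {T : measurableType disp}.
Variables (P : probability T R) (q : nat) (d : R) (g : R[i] -> 'M[R[i]]_q).
Variable X : int -> T -> 'cV[R[i]]_q.
Local Notation C := R[i].
Hypothesis d01 : 0 < d < 2^-1.
Hypothesis bG : mbounded (fun t => g (cis t)).
Hypothesis statX : stationary_process P X.
Hypothesis densX : has_spectral_density P X (farima_density d g).

Let dd : 0 <= 2 * d < 1. Proof. by case/andP: d01 => ? ?; apply/andP; split; lra. Qed.
Let S t := g (cis t) *m adjmx (g (cis t)).
Let bS : mbounded S. Proof. by apply: mboundedM => //; exact: mbounded_adj. Qed.

Lemma inner_entry (m n : int) a b : inner P (entry X m a) (entry X n b) =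
  ((2 * pi)^-1)%:C * wcint (2 * d) (fun t => S t a b * zpow (- (m - n)) t).
Proof.
have [_ _ /(_ m n a b)] := densX; rewrite mxE => ->; congr (_ * cintegral _ _ _).
apply/funext => t.
have -> : farima_density d g (cis t) a b = (cweight (2 * d) t)%:C * S t a b.
  by rewrite /farima_density mxE.
by rewrite /zpow mulrNz mulNr; ring.
Qed.

Let mul_entry m n a b : cintegrable P setT (fun t => entry X m a t * (entry X n b t)^J).
Proof. by have [sq _ _] := statX; exact: square_integrable_mulJ. Qed.

Lemma inner_predictor (n : nat) (p : nat -> 'M[C]_q) i m b :
  inner P (entry X 0 i \- (fun t => (\sum_(1 <= j < n.+1) p j *m X (- j%:Z) t) i 0)) (entry X m b) =
  inner P (entry X 0 i) (entry X m b) -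
    \sum_(1 <= j < n.+1) \sum_a p j i a * inner P (entry X (- j%:Z) a) (entry X m b).
Proof.
pose F j a t := p j i a * (entry X (- j%:Z) a t * (entry X m b t)^J).
have iF j a : cintegrable P setT (F j a) by exact: cintegrableZ.
have iFj j := cintegral_sum measurableT (index_enum 'I_q) (iF j).
have [iFF eFF] := cintegral_sum measurableT (index_iota 1 n.+1) (fun j => (iFj j).1).
rewrite /inner.
have -> : (fun t => (entry X 0 i \- (fun t => (\sum_(1 <= j < n.+1) p j *m X (- j%:Z) t) i 0)) t * (entry X m b t)^J) =
   fun t => entry X 0 i t * (entry X m b t)^J + -1 * (\sum_(1 <= j < n.+1) \sum_a F j a t).
  apply/funext => t /=; rewrite mulrBl mulN1r summxE mulr_suml; congr (_ - _).
  apply: eq_bigr => j _; rewrite mxE mulr_suml; apply: eq_bigr => a _.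
  by rewrite /F mulrA.
rewrite (cintegralD measurableT (mul_entry _ _ _ _) (cintegrableZ measurableT (-1) iFF)).
rewrite (cintegralZ measurableT _ iFF) mulN1r; congr (_ - _).
rewrite [LHS]eFF; apply: eq_bigr => j _; rewrite (iFj j).2; apply: eq_bigr => a _.
exact: (cintegralZ measurableT).
Qed.

(** Testing the residual of the projection against the entries of X_{-k}, for 1 <= k <= n, gives on
    the spectral side the k-th coefficient of b g g^* times the weight, up to 1 / (2 pi). *)
Lemma predictor_orth (n : nat) (p : nat -> 'M[C]_q) : (0 < n)%N ->
  forward_finite_predictor P X n p ->
  mann (2 * d) (fun t => polyb n p t *m g (cis t) *m adjmx (g (cis t))) 1 n%:Z.
Proof.
move=> n0 pred i b k /andP[k1 kn].
have [m kE] : exists m : nat, k = m.+1%:Z by exists (absz k).-1; lia.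
have mn : (m < n)%N by lia.
have [_ /(_ (entry X (- m.+1%:Z) b))] := pred i.
have spanv : past_span X n (entry X (- m.+1%:Z) b).
  exists (fun j a => ((j == Ordinal mn) && (a == b))%:R); apply/funext => t.
  rewrite (bigD1 (Ordinal mn))//= (bigD1 b)//= !eqxx mul1r.
  rewrite big1 ?addr0 => [|a ab]; last by rewrite (negbTE ab) mul0r.
  rewrite big1 ?addr0// => j jm; rewrite big1// => a _.
  by rewrite (negbTE jm) mul0r.
move=> /(_ spanv); rewrite inner_predictor inner_entry.
under eq_bigr do under eq_bigr do rewrite inner_entry mulrCA.
under eq_bigr do rewrite -mulr_sumr.
rewrite -mulr_sumr -mulrBr => /eqP; rewrite mulf_eq0 => /orP[|/eqP I0].
  by rewrite -normc_eq0 normcR normr_eq0 invr_eq0 gt_eqF// mulr_gt0// pi_gt0.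
rewrite -[RHS]I0.
have bz j : cbounded (zpow j : R -> C) by exact: cbounded_zpow.
pose F j a t : C := p j i a * (S t a b * zpow (- (- j%:Z - - m.+1%:Z)) t).
have bF' j a : cbounded (fun t => S t a b * zpow (- (- j%:Z - - m.+1%:Z)) t) by exact: cboundedM.
have bF j a : cbounded (F j a) by apply: cboundedM => //; exact: cbounded_cst.
have bFj j : cbounded (fun t => \sum_a F j a t) by exact: (@cbounded_sum _ _ _ _ (F j)).
have bFF : cbounded (fun t => \sum_(1 <= j < n.+1) \sum_a F j a t).
  exact: (@cbounded_sum _ _ _ _ (fun j t => \sum_a F j a t)).
have -> : (fun t => (polyb n p t *m g (cis t) *m adjmx (g (cis t))) i b * zpow (- k) t) =
  fun t => S t i b * zpow (- (0 - - m.+1%:Z)) t - \sum_(1 <= j < n.+1) \sum_a F j a t.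
  apply/funext => t; rewrite /polyb -mulmxA -/(S t) mulmxBl mul1mx mxBE mulrBl kE sub0r opprK.
  congr (_ - _); rewrite mulmx_suml summxE mulr_suml; apply: eq_bigr => j _.
  rewrite mxE mulr_suml; apply: eq_bigr => a _; rewrite mxE /F.
  have -> : - (- j%:Z - - m.+1%:Z) = j%:Z + - m.+1%:Z by ring.
  by rewrite zpowD; ring.
rewrite wcintB//; last exact: cboundedM.
congr (_ - _).
rewrite (@wcint_sum R _ dd _ _ _ (fun j t => \sum_a F j a t))//; apply: eq_bigr => j _.
rewrite (@wcint_sum R _ dd _ _ _ (F j))//; apply: eq_bigr => a _.
by rewrite wcintZ.
Qed.

End predictor.

(** * Power series of the inverse of h *)

Section farima_symbols.
Context {R : realType} (q : nat) (d : R) (g : R[i] -> 'M[R[i]]_q).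
Local Notation C := R[i].
Hypothesis d01 : 0 < d < 2^-1.
Hypothesis gdet : forall z, closed_disk z -> \det (g z) != 0.

Lemma invmx_farima_h z : open_disk z -> invmx (farima_h d g z) = cpow (1 - z) d *: invmx (g z).
Proof.
move=> z1; have z0 : 1 - z != 0.
  by rewrite subr_eq0 eq_sym; apply: contraPneq z1 => ->; rewrite /open_disk /mkset normc1 ltxx.
have c1 := cpowVN d z0.
have cN0 : cpow (1 - z) (- d) != 0.
  by apply: contra_eq_neq c1 => ->; rewrite mul0r eq_sym oner_eq0.
have gU : g z \in unitmx by rewrite unitmxE unitfE gdet//; exact: ltW.
rewrite /farima_h invmxZ; last first.
  by rewrite unitmxE detZ unitfE mulf_neq0 ?expf_neq0// gdet//; exact: ltW.
congr (_ *: _); apply: (mulfI cN0); rewrite c1 mulfV//.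
Qed.

(** On the open disk the inverse of h is (1 - z)^d g^{-1}, a product of two known series, and
    [product_coef] identifies its coefficients with - a_k. *)
Lemma neg_inverse_conv (a : nat -> 'M[C]_q) (Bc : 'I_q -> 'I_q -> nat -> C) :
  neg_inverse_coefficients (farima_h d g) a ->
  (forall i j z, normc z <= 1 -> ccvg (psum (Bc i j) z) (invmx (g z) i j)) ->
  forall i j k, a k i j = - conv (binc d) (Bc i j) k.
Proof.
move=> ha hB i j k; apply/eqP; rewrite -eqr_oppLR; apply/eqP.
have d1 : 0 < d < 1 by case/andP: d01 => -> /lt_trans; apply; lra.
apply: (@product_coef _ (binc d) (Bc i j) (fun k => - a k i j)
   (fun z => cpow (1 - z) d) (fun z => invmx (g z) i j)) => z z1.
- by apply: psum_bin_cvg => //; exact: ltW.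
- by apply: hB; exact: ltW.
move=> eps eps0; have [N HN] := ccvgP (ha z z1 i j) eps0; exists N => n /HN.
rewrite -normcN; congr (normc _ < _); rewrite opprB addrC; congr (_ + _).
  by rewrite /psum big_mkord -sumrN; apply: eq_bigr => m _; rewrite mulNr mulrC.
by rewrite invmx_farima_h// mxNE mxE.
Qed.

End farima_symbols.

Theorem theorem6p9 (R : realType) (disp : measure_display)
    (T : measurableType disp) (P : probability T R) (q : nat) (d : R)
    (g : R[i] -> 'M[R[i]]_q) (X : int -> T -> 'cV[R[i]]_q)
    (phi : nat -> nat -> 'M[R[i]]_q) (a : nat -> 'M[R[i]]_q) :
  (0 < q)%N ->
  0 < d < 1 / 2 ->
  (forall i j, rational_on_closed_disk (fun z => g z i j)) ->
  (forall z, closed_disk z -> \det (g z) != 0) ->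
  stationary_process P X ->
  has_spectral_density P X (farima_density d g) ->
  (forall n, (0 < n)%N -> forward_finite_predictor P X n (phi n)) ->
  neg_inverse_coefficients (farima_h d g) a ->
  let phi_inf := forward_infinite_predictor (farima_h d g) a in
  exists2 K : R, 0 < K &
    forall n, (0 < n)%N ->
      ((\sum_(1 <= j < n.+1) spectral_norm (phi n j - phi_inf j))%:E <=
       K%:E * \sum_(n.+1 <= j <oo) (spectral_norm (phi_inf j))%:E)%E.
Proof.
move=> q0; rewrite mul1r => d01 grat gdet statX densX pred ha phi_inf.
have d1 : 0 < d < 1 by case/andP: d01 => -> /lt_trans; apply; lra.
have cD t : closed_disk (cis t : R[i]) by rewrite /closed_disk /mkset normc_cis.
have gU z : closed_disk z -> g z \in unitmx by move=> zD; rewrite unitmxE unitfE gdet.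
have symbol (M : R[i] -> 'M[R[i]]_q) : (forall i j, rational_on_closed_disk (fun z => M z i j)) ->
    exists Mc : 'I_q -> 'I_q -> nat -> R[i], [/\ forall i j, expdec (Mc i j),
      forall i j z, normc z <= 1 -> ccvg (psum (Mc i j) z) (M z i j) &
      forall i j, usum (Mc i j) (fun t => M (cis t) i j)].
  move=> rM.
  have H ij : exists e : nat -> R[i], expdec e /\ forall z, normc z <= 1 -> ccvg (psum e z) (M z ij.1 ij.2).
    by have [e e1 e2] := analytic_rational (rM ij.1 ij.2); exists e.
  have [Mc HM] := choice H; exists (fun i j => Mc (i, j)); split=> i j.
  - by have [] := HM (i, j).
  - by move=> z; have [_] := HM (i, j); apply.
  have [[K [rho [r01 eK]]] cM] := HM (i, j).
  by apply: (usum_geometric r01 eK) => t; apply: cM; rewrite normc_cis.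
have [Gc [_ _ HG]] := symbol g grat.
have [Bc [HBd cB HB]] := symbol (fun z => invmx (g z)) (rational_invmx grat gdet).
have D0 : closed_disk (0 : R[i]) by rewrite /closed_disk /mkset normc0 ler01.
(* The constant coefficients of g^{-1} form g(0)^{-1}: evaluate the series at z = 0. *)
have c0B : g 0 *m (\matrix_(i, j) Bc i j 0%N) = 1%:M.
  rewrite -(mulmxV (gU 0 D0)); congr (_ *m _); apply/matrixP => i j; rewrite mxE.
  have n0 : normc (0 : R[i]) <= 1 by rewrite normc0.
  apply/esym/(ccvg_unique (cB i j 0 n0)) => eps eps0; exists 1%N => -[//|n] _.
  rewrite /psum big_ord_recl expr0 mulr1 big1 ?addr0 ?subrr ?normc0// => k _.
  by rewrite expr0n/= mulr0.
have GB t : g (cis t) *m invmx (g (cis t)) = 1%:M by rewrite mulmxV// gU.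
have BG t : invmx (g (cis t)) *m g (cis t) = 1%:M by rewrite mulVmx// gU.
have bG : mbounded (fun t => g (cis t)) by move=> i j; exact: usum_cbounded (HG i j).
have aE := neg_inverse_conv d01 gdet ha cB.
have h0 : farima_h d g 0 = g 0.
  rewrite /farima_h subr0 (_ : cpow 1 (- d) = 1) ?scale1r//.
  have carg1 : carg (1 : R[i]) = 0 by rewrite /carg normc1 /= lexx divr1 acos1.
  by rewrite /cpow normc1 powR1 carg1 mulr0 cis0 mul1r.
pose x i l j := \sum_c g 0 i c * conv (binc d) (Bc c l) j.
have phiE j i l : phi_inf j i l = - x i l j.
  rewrite /phi_inf /forward_infinite_predictor h0 mxE -sumrN; apply: eq_bigr => c _.
  by rewrite aE mulrN.
have [K K0 HK] := sum_errcoef d01 GB BG HB HBd HG c0B.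
have upper n : (0 < n)%N -> \sum_(1 <= j < n.+1) spectral_norm (phi n j - phi_inf j) <=
    q%:R * (q%:R * (K * n%:R `^ (- d))).
  move=> n0; have orth := predictor_orth d01 bG statX densX n0 (pred n n0).
  apply: (@le_trans _ _ (\sum_(1 <= j < n.+1) \sum_i \sum_l normc (errcoef d Bc (g 0) (phi n) i l j))).
    apply: ler_sum => j _; apply: (le_trans (spectral_norm_le_sum _)).
    apply: ler_sum => i _; apply: ler_sum => l _.
    by rewrite mxBE phiE opprK.
  rewrite exchange_big/=.
  apply: (@le_trans _ _ (\sum_(i < q) \sum_(l < q) K * n%:R `^ (- d))); last first.
    by rewrite !sumr_const !card_ord !mulr_natl.
  apply: ler_sum => i _; rewrite exchange_big/=; apply: ler_sum => l _.
  exact: HK.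
(* g(0) g(1)^{-1} is invertible, hence nonzero as q > 0; the tail of the corresponding entry of
   phi_j already has the order n^{-d}. *)
have [i [l r0]] : exists i l, (g 0 *m invmx (g 1)) i l != 0.
  have D1 : closed_disk (1 : R[i]) by rewrite /closed_disk /mkset normc1.
  have U : g 0 *m invmx (g 1) \in unitmx by rewrite unitmx_mul unitmx_inv !gU.
  apply: contrapT => h; move: U.
  have -> : g 0 *m invmx (g 1) = 0.
    apply/matrixP => i l; rewrite [RHS]mxE; apply/eqP.
    by apply: contrapT => /negP h'; apply: h; exists i, l.
  by rewrite -(scale0r (0 : 'M[R[i]]_q)) unitmxE detZ expr0n gtn_eqF// mul0r unitr0.
have asymp c : exists Kc : R, 0 <= Kc /\ forall n,
    normc (\sum_(j < n.+1) conv (binc d) (Bc c l) j - (binsum d n)%:C * invmx (g 1) c l) <=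
    Kc * binsum d n / n.+1%:R.
  have n1 : normc (1 : R[i]) <= 1 by rewrite normc1.
  by have [Kc k0 HKc] := sum_conv_asymp d01 (HBd c l) (cB c l 1 n1); exists Kc.
have [Kc HKc] := choice asymp.
have L0 : 0 <= \sum_c normc (g 0 i c) * Kc c.
  by apply: sumr_ge0 => c _; rewrite mulr_ge0 ?normc_ge0//; case: (HKc c).
have [c c_gt0 Hc] : exists2 c : R, 0 < c & forall n, (0 < n)%N -> exists N,
    c * n%:R `^ (- d) <= \sum_(n.+1 <= j < N.+1) normc (x i l j).
  apply: (tail_lower d01 r0 L0) => n.
  have -> : \sum_(j < n.+1) x i l j - (binsum d n)%:C * (g 0 *m invmx (g 1)) i l =
     \sum_c g 0 i c * (\sum_(j < n.+1) conv (binc d) (Bc c l) j - (binsum d n)%:C * invmx (g 1) c l).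
    rewrite /x exchange_big/= mxE mulr_sumr -sumrB; apply: eq_bigr => c _.
    by rewrite -mulr_sumr mulrBr; congr (_ - _); rewrite mulrCA.
  rewrite (le_trans (normc_sum _ _ _))// -mulrA mulr_suml; apply: ler_sum => c _.
  by rewrite normcM -mulrA ler_wpM2l ?normc_ge0// mulrA; case: (HKc c).
(* q * q entries, each contributing at most [K] times n^{-d}, against the lower bound [c] times
   n^{-d} for the tail. *)
exists (q%:R * (q%:R * K) / c); first by rewrite divr_gt0// !mulr_gt0 ?ltr0n.
move=> n n0; have [N HN] := Hc n n0.
have sn0 j : 0 <= spectral_norm (phi_inf j).
  exact: le_trans (normc_ge0 _) (normc_le_spectral_norm _ i l).
have low : ((c * n%:R `^ (- d))%:E <= \sum_(n.+1 <= j <oo) (spectral_norm (phi_inf j))%:E)%E.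
  apply: (@le_trans _ _ (\sum_(n.+1 <= j < N.+1) (spectral_norm (phi_inf j))%:E)%E); last first.
    by apply: (nneseries_lim_ge (P := xpredT)) => j _ _; rewrite lee_fin.
  rewrite sumEFin lee_fin (le_trans HN)//; apply: ler_sum => j _.
  by rewrite -normcN -phiE normc_le_spectral_norm.
have Kc0 : 0 <= q%:R * (q%:R * K) / c by rewrite divr_ge0 ?mulr_ge0 ?(ltW K0) ?(ltW c_gt0).
apply: le_trans (lee_wpmul2l _ low); last by rewrite lee_fin.
rewrite -EFinM lee_fin (le_trans (upper n n0))// le_eqVlt; apply/orP; left; apply/eqP.
by field; rewrite gt_eqF.
Qed.
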